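(* Let $d\ge2$ be a fixed integer. Then, as $V$ runs through the positive integers, $$\lim_{V\to\infty}\frac{\log|K_V^d|}{\log|L_V^d|}=1 .$$
   Context: A convex lattice polytope is the convex hull of a finite subset of $\mathbb{Z}^d$; polytopes here are $d$-dimensional in $\mathbb{R}^d$, and the normalized volume of $P$ is $d!\,\mathrm{vol}(P)\in\mathbb{Z}$. Two polytopes are unimodular equivalent if some affine transformation with determinant $\pm1$ preserving $\mathbb{Z}^d$ maps one onto the other; they are affinely equivalent if some affine transformation of $\mathbb{R}^d$ (real coefficients) maps one onto the other. For an affine equivalence class $\mathcal{A}(P)$ (the set of all convex lattice polytopes affinely equivalent to $P$), $V_{min}(\mathcal{A}(P))$ is the minimal volume of a polytope in $\mathcal{A}(P)$. For a positive integer $V$: - $A_V^d$ is a set of representatives, one from each affine equivalence class whose $V_{min}$ equals $V/d!$, each representative itself having volume $V/d!$; for $V/i$ not an integer, $A_{V/i}^d=\emptyset$. - $L_V^d:=\bigcup_{i=1}^V(i\cdot A_{V/i}^d)$, where the product $i\cdot A_{V/i}^d$ is performed on each polytope of $A_{V/i}^d$. Polytopes arising from different $i$ are in different affine classes, so $|L_V^d|=\sum_{i=1}^V|A_{V/i}^d|$. - $K_V^d$ is a set of representatives, under unimodular equivalence, of the convex lattice polytopes with normalized volume $V$ (one from each class). *)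

(* Defs.v *)
From HB Require Import structures.
From mathcomp Require Import all_boot all_order all_algebra finmap.
From mathcomp Require Import all_classical all_reals all_analysis.

Set Implicit Arguments.
Unset Strict Implicit.
Unset Printing Implicit Defensive.

Import Order.TTheory GRing.Theory Num.Theory.
Import numFieldNormedType.Exports.

Local Open Scope classical_set_scope.
Local Open Scope ring_scope.

Section Volume.
Context {R : realType}.

(* d-fold product of the one-dimensional Lebesgue measure, by recursion on d;
   tuples are used because MathComp-Analysis equips them, and not row vectors,
   with the product sigma-algebra. *)
Fixpoint lebesgue_tuple (d : nat) :
    set (d.-tuple (measurableTypeR R)) -> \bar R :=
  match d with
  | 0 => fun A => \d_([tuple] : 0.-tuple (measurableTypeR R)) A
  | n.+1 => fun A => (@lebesgue_measure R \x @lebesgue_tuple n)%E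
                       [set p | A (cons_tuple p.1 p.2)]
  end.

Definition vol (d : nat) (P : set 'rV[R]_d) : \bar R :=
  lebesgue_tuple
    [set t : d.-tuple (measurableTypeR R) | P (\row_i (tnth t i : R))].

Definition normalized_vol (d : nat) (P : set 'rV[R]_d) : \bar R :=
  ((d`!%:R)%:E * vol P)%E.

End Volume.

Section Polytopes.
Context {R : realType} {d : nat}.
Implicit Types (S P Q : set 'rV[R]_d) (C F : set (set 'rV[R]_d)).

Definition int_lattice : set 'rV[R]_d :=
  [set x | forall j, x ord0 j \is a Num.int].

Definition convex_hull S : set 'rV[R]_d :=
  smallest (@convex_set R 'rV[R]_d) S.

Definition affine_set S : Prop :=
  forall x y t, S x -> S y -> S (t *: x + (1 - t) *: y).

Definition affine_hull S : set 'rV[R]_d := smallest affine_set S.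

Definition full_dimensional S : Prop := affine_hull S = setT.

Definition lattice_polytope P : Prop :=
  full_dimensional P /\
  exists S, [/\ finite_set S, S `<=` int_lattice & P = convex_hull S].

Definition affine_map (M : 'M[R]_d) (b x : 'rV[R]_d) : 'rV[R]_d := x *m M + b.

Definition affinely_equivalent P Q : Prop :=
  exists (M : 'M[R]_d) (b : 'rV[R]_d),
    M \in unitmx /\ affine_map M b @` P = Q.

Definition unimodularly_equivalent P Q : Prop :=
  exists (M : 'M[R]_d) (b : 'rV[R]_d),
    [/\ \det M = 1 \/ \det M = -1,
        affine_map M b @` int_lattice = int_lattice &
        affine_map M b @` P = Q].

Definition affine_class P : set (set 'rV[R]_d) :=
  [set Q | lattice_polytope Q /\ affinely_equivalent P Q].

(* The class of P has V_min equal to v: the minimum is required to be attained. *)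
Definition has_Vmin P (v : \bar R) : Prop :=
  (exists2 Q, affine_class P Q & vol Q = v) /\
  (forall Q, affine_class P Q -> (v <= vol Q)%E).

Definition representatives (E : set 'rV[R]_d -> set 'rV[R]_d -> Prop) C F :
    Prop :=
  F `<=` C /\ forall P, C P -> exists! Q, F Q /\ E P Q.

Definition affine_representatives (V : nat) F : Prop :=
  representatives affinely_equivalent
    [set P | lattice_polytope P /\ has_Vmin P (V%:R / d`!%:R)%:E] F /\
  (forall P, F P -> vol P = (V%:R / d`!%:R)%:E).

Definition unimodular_representatives (V : nat) F : Prop :=
  representatives unimodularly_equivalent
    [set P | lattice_polytope P /\ normalized_vol P = V%:R%:E] F.

Definition dilate (i : nat) P : set 'rV[R]_d := ( *:%R i%:R) @` P.

Definition L_of (A : nat -> set (set 'rV[R]_d)) (V : nat) :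
    set (set 'rV[R]_d) :=
  \bigcup_(i in [set i : nat | (1 <= i <= V)%N])
    (dilate i @` (if (i %| V)%N then A (V %/ i)%N else set0)).

(* Junk value 0 on infinite families.  Since ln 0 = 0 and x / 0 = 0, a quotient
   ln (cardinal F) / ln (cardinal G) is nonzero only if F and G are finite with at least
   two elements; a nonzero limit of such quotients thus implies finiteness. *)
Definition cardinal F : nat := #|` fset_set F|.

End Polytopes.

(* Main.v *)
(* A lattice polytope is the image of a primitive one, whose vertices affinely span Z^d, under
   an integral affine map x |-> x N + c, and |det N| is the ratio of the volumes.  A primitive
   polytope has minimal volume in its affine class, so, normalized volumes being integers by
   triangulation, the classes counted by L_V are those of the polytopes of normalized volume V,
   and |L_V| <= |K_V|.  For fixed P and m = |det N|, the unimodular class of P N + c depends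
   only on N modulo m, hence |K_V| <= |L_V| (V + 1)^(d^2).

   It remains to see that |K_V| grows faster than any power of V.  Take iterated pyramids over
   the polygons spanned by the points (i, i^2), 0 <= i <= 2n, where odd i are optional, together
   with two fixed points far above the parabola and a further point tuning the normalized area
   to be exactly V.  For n a large multiple of log V this gives 2^n polytopes with coordinates
   polynomial in V, of which only polynomially many can be equivalent to each other. *)
Require Import Defs.
From HB Require Import structures.
From mathcomp Require Import all_boot all_order all_algebra finmap.
From mathcomp Require Import all_classical all_reals all_analysis.
From mathcomp Require Import unstable measurable_realfun ring lra zify.

Set Implicit Arguments.
Unset Strict Implicit.
Unset Printing Implicit Defensive.

Import Order.TTheory GRing.Theory Num.Theory.
Import numFieldNormedType.Exports.

Local Open Scope classical_set_scope.
Local Open Scope ring_scope.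

(** * Volume under affine maps *)

(** Since [vol] is an iterated integral along the coordinates, scaling by the determinant is reduced
    to maps that act on slices. Integrality of normalized volumes needs a genuine decomposition into
    simplices; lifting the points by generic weights and pivoting as in the simplex method yields
    one without any theory of faces.

    As [cardinal] is 0 on infinite families, finiteness of [K V] is a separate task; it is where a
    simplex of maximal volume enters.

    The comparison of the two counts loses a fixed power of V, so the logarithms differ by O(log V).
    This is negligible only if log |L_V| outgrows log V, hence the need for superpolynomial growth.

    In the construction the fixed part of the polygon has size polynomial in log V, since n is of
    order log V. Nearly all of the volume V is thus free to be supplied by the single tuning
    triangle, whatever optional points were chosen. *)

Section SigmaFinitePack.
Context d (T : measurableType d) (R : realType) (mu : {measure set T -> \bar R}).
Variable mu_sfin : sigma_finite setT mu.

(* The dummy [let] keeps [mu_sfin] in the term, so that the instances below can recover it. *)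
Definition sigma_finite_pack : set T -> \bar R := let _ := mu_sfin in mu.

HB.instance Definition _ := isMeasure.Build _ _ _ sigma_finite_pack
  (measure0 mu) (measure_ge0 mu) (@measure_semi_sigma_additive _ _ _ mu).

HB.instance Definition _ := Measure_isSigmaFinite.Build _ _ _ sigma_finite_pack mu_sfin.

End SigmaFinitePack.

Section LebesgueTuple.
Context {R : realType}.
Local Notation mT := (measurableTypeR R).

(** By uniqueness of the Lebesgue measure: [|a|] times the image measure agrees with it on the
    intervals []x, y]]. For negative [a] the preimage of such an interval is closed on the left and
    open on the right, with the same length formula. *)
Lemma lebesgue_measure_affine (a b : R) (A : set mT) :
  a != 0 -> measurable A ->
  lebesgue_measure ((fun x : mT => (a * x + b : mT)) @^-1` A) =
  (`|a|^-1%:E * lebesgue_measure A)%E.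
Proof.
move=> a0 mA.
have a_gt0 : 0 < `|a| by rewrite normr_gt0.
set f := (fun x : mT => (a * x + b : mT)).
have mf : measurable_fun setT f.
  apply: (@measurable_funD _ _ _ _ (fun x : mT => a * x) (fun=> b)) => //.
  exact: (@measurable_funM _ _ _ _ (fun=> a) (fun x : mT => x)).
pose pf : {measure set mT -> \bar R} :=
  measure_function_pushforward__canonical__measure_function_Measure lebesgue_measure mf.
pose mu : {measure set mT -> \bar R} := mscale (NngNum (ltW a_gt0)) pf.
suff -> : lebesgue_measure A = mu A.
  rewrite /mu/= /mscale/= muleA -EFinM mulVf ?mul1e//.
  by rewrite gt_eqF.
apply: lebesgue_measure_unique => // X [[x y] _ <-].
rewrite /mu/= /mscale/= /pushforward/= lebesgue_measure_itv/= lte_fin.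
have fE t : f t = a * t + b by [].
case: (ltrgt0P a) a0 => // a_sgn _.
- have -> : f @^-1` `]x, y]%classic = `](x - b) / a, (y - b) / a]%classic.
    apply/seteqP; split => t /=; rewrite !in_itv/= fE ltr_pdivrMr// ler_pdivlMr//
      ltrBlDr lerBrDr (mulrC t);
    exact.
  rewrite lebesgue_measure_itv/= lte_fin ltr_pM2r ?invr_gt0// ltrD2r.
  case: ifPn => xy; last by rewrite mule0.
  by rewrite -!EFinD -EFinM; congr EFin; field; rewrite gt_eqF.
- have -> : f @^-1` `]x, y]%classic = `[(y - b) / a, (x - b) / a[%classic.
    apply/seteqP; split => t /=; rewrite !in_itv/= fE ler_ndivrMr// ltr_ndivlMr//
      ltrBlDr lerBrDr (mulrC t);
    by rewrite andbC.
  rewrite lebesgue_measure_itv/= lte_fin ltr_nM2r ?invr_lt0// ltrD2r.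
  case: ifPn => xy; last by rewrite mule0.
  by rewrite -!EFinD -EFinM; congr EFin; field; rewrite lt_eqF.
Qed.

(** [lebesgue_tuple] is a bare set function. At each step it is the image of a product measure under
    [cons_tuple]; sigma-finiteness of the second factor makes the product a measure, so it is
    carried through the induction. *)
Lemma lebesgue_tuple_sigma_finite_measure d :
  exists mu : {sigma_finite_measure set (d.-tuple mT) -> \bar R},
    @lebesgue_tuple R d = mu.
Proof.
elim: d => [|n [mu muE]].
  by exists \d_([tuple] : 0.-tuple mT).
pose phi (p : mT * n.-tuple mT) := cons_tuple p.1 p.2.
have mphi : measurable_fun setT phi by apply: measurable_cons.
pose psi (t : n.+1.-tuple mT) := (tnth t ord0, [tuple of behead t]) : mT * n.-tuple mT.
have mpsi : measurable_fun setT psi.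
  by apply/measurable_fun_pairP; split; [exact: measurable_tnth|exact: measurable_behead].
have phiK : cancel phi psi.
  by move=> [x t]; rewrite /psi /phi /=; congr pair; apply/val_inj.
pose m : {measure set _ -> \bar R} := product_measure1 (@lebesgue_measure R) mu.
pose nu : {measure set (n.+1.-tuple mT) -> \bar R} :=
  measure_function_pushforward__canonical__measure_function_Measure m mphi.
have nuE : nu = @lebesgue_tuple R n.+1 :> (set _ -> \bar R).
  by apply/funext => A; rewrite /= muE.
have snu : sigma_finite setT nu.
  have /sigma_finiteP[F [FT ndF Foo]] := sigma_finiteT (@lebesgue_measure R).
  have /sigma_finiteP[G [GT ndG Goo]] := sigma_finiteT mu.
  exists (fun k => psi @^-1` (F k `*` G k)).
    rewrite -preimage_bigcup (_ : \bigcup_k (F k `*` G k) = setT) ?preimage_setT//.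
    apply/seteqP; split => // -[x y] _.
    have : setT x by []. rewrite FT => -[i _ Fix].
    have : setT y by []. rewrite GT => -[k _ Gky].
    exists (maxn i k) => //; split => /=.
    - by move: x Fix; exact/subsetPset/ndF/leq_maxl.
    - by move: y Gky; exact/subsetPset/ndG/leq_maxr.
  move=> k; have [mF Fk] := Foo k; have [mG Gk] := Goo k; split.
    by rewrite -[X in measurable X]setTI; apply: mpsi => //; exact: measurableX.
  rewrite /= /pushforward -comp_preimage (_ : psi \o phi = id); last first.
    by apply/funext => p /=; rewrite phiK.
  by rewrite preimage_id product_measure1E// lte_mul_pinfty// ge0_fin_numE.
exists (sigma_finite_pack snu).
by rewrite -nuE.
Qed.

Definition leb d : {sigma_finite_measure set (d.-tuple mT) -> \bar R} :=
  projT1 (cid (lebesgue_tuple_sigma_finite_measure d)).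

Lemma lebE d : @lebesgue_tuple R d = leb d.
Proof. exact: (projT2 (cid (lebesgue_tuple_sigma_finite_measure d))). Qed.

Definition row_of d (t : d.-tuple mT) : 'rV[R]_d := \row_i (tnth t i : R).

Definition tuple_of d (x : 'rV[R]_d) : d.-tuple mT := [tuple (x ord0 i : mT) | i < d].

Lemma tuple_ofK d : cancel (@tuple_of d) (@row_of d).
Proof. by move=> x; apply/rowP => i; rewrite mxE tnth_mktuple. Qed.

Definition rmeasurable d (P : set 'rV[R]_d) : Prop := measurable (@row_of d @^-1` P).

Lemma volE d (P : set 'rV[R]_d) : vol P = leb d (@row_of d @^-1` P).
Proof. by rewrite /vol lebE. Qed.

Lemma measurable_row_sum d (c : 'cV[R]_d) :
  measurable_fun setT (fun t : d.-tuple mT => ((row_of t *m c) ord0 ord0 : mT)).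
Proof.
under eq_fun do rewrite mxE.
apply: (@measurable_sum _ _ _ _ _ _ (fun i t => row_of t ord0 i * c i ord0)) => i.
apply: measurable_funM => //.
under eq_fun do rewrite mxE.
exact: measurable_tnth.
Qed.

Lemma rmeasurable_affine d e (M : 'M[R]_(d, e)) (b : 'rV[R]_e) (P : set 'rV[R]_e) :
  rmeasurable P -> rmeasurable ((fun x => x *m M + b) @^-1` P).
Proof.
pose g (t : d.-tuple mT) := tuple_of (row_of t *m M + b).
have mg : measurable_fun setT g.
  apply/measurable_fun_tnthP => i.
  rewrite (_ : _ \o _ = fun t => ((row_of t *m col i M) ord0 ord0 + b ord0 i : mT)).
    exact: measurable_funD (measurable_row_sum _) (measurable_cst _).
  apply/funext => t /=; rewrite tnth_mktuple !mxE; congr (_ + _).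
  by apply: eq_bigr => k _; rewrite !mxE.
move=> mP; rewrite /rmeasurable.
suff -> : @row_of d @^-1` ((fun x => x *m M + b) @^-1` P) = g @^-1` (@row_of e @^-1` P).
  by rewrite -[X in measurable X]setTI; exact: mg.
by apply/funext => t /=; rewrite tuple_ofK.
Qed.

Lemma row_of_cons d (x : mT) (t : d.-tuple mT) :
  row_of (cons_tuple x t) = row_mx x%:M (row_of t) :> 'rV_(1 + d).
Proof.
apply/rowP => i; case: (split_ordP i) => j ->.
  rewrite row_mxEl !mxE (ord1 j) eqxx mulr1n.
  have -> : lshift d (ord0 : 'I_1) = ord0 :> 'I_d.+1 by exact/val_inj.
  by rewrite tnth0.
rewrite row_mxEr !mxE.
have -> : rshift 1 j = lift ord0 j :> 'I_d.+1 by exact/val_inj.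
by rewrite tnthS.
Qed.

Definition pair_set d (P : set 'rV[R]_(1 + d)) : set (mT * d.-tuple mT)%type :=
  [set p | P (row_mx (p.1 : R)%:M (row_of p.2))].

Lemma rmeasurable_pair_set d (P : set 'rV[R]_(1 + d)) :
  rmeasurable P -> measurable (pair_set P).
Proof.
pose phi (p : mT * d.-tuple mT) := cons_tuple p.1 p.2.
have mphi : measurable_fun setT phi by apply: measurable_cons.
move=> mP; rewrite (_ : pair_set P = phi @^-1` (@row_of d.+1 @^-1` P)).
  by rewrite -[X in measurable X]setTI; exact: mphi.
by apply/funext => p; rewrite /pair_set /= row_of_cons.
Qed.

Lemma vol_xsection d (P : set 'rV[R]_(1 + d)) :
  vol P = (\int[lebesgue_measure]_(x in setT) vol [set y : 'rV[R]_d | P (row_mx (x : mT)%:M y)])%E.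
Proof.
rewrite {1}/vol /= /product_measure1; apply: eq_integral => x _ /=.
rewrite /vol; congr lebesgue_tuple; apply/funext => t.
by rewrite xsectionE /= -row_of_cons.
Qed.

(** Tonelli's theorem: slicing in the order opposite to the recursion of [vol] requires
    measurability, whereas [vol_xsection] unfolds the definition. *)
Lemma vol_ysection d (P : set 'rV[R]_(1 + d)) : rmeasurable P ->
  vol P = (\int[leb d]_(t in setT)
    lebesgue_measure [set x : mT | P (row_mx (x : R)%:M (row_of t))])%E.
Proof.
move=> /rmeasurable_pair_set mP.
have := indic_fubini_tonelli lebesgue_measure (leb d) mP.
rewrite indic_fubini_tonelli_FE// indic_fubini_tonelli_GE// => H.
transitivity (\int[lebesgue_measure]_(x in setT) (leb d \o xsection (pair_set P)) x)%E.
  rewrite vol_xsection; apply: eq_integral => x _ /=; rewrite volE; congr (leb d _).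
  by rewrite xsectionE.
by rewrite H; apply: eq_integral => t _ /=; rewrite ysectionE.
Qed.

(** Stated with preimages, whose measurability under affine maps is immediate; [c] is therefore the
    inverse of the usual factor. [vol_image] returns to images. *)
Definition scales d (f : 'rV[R]_d -> 'rV[R]_d) (c : R) : Prop :=
  forall P, rmeasurable P -> vol (f @^-1` P) = (c%:E * vol P)%E.

(** On the slice with first coordinate [x], the map acts as [N] followed by a translation depending
    on [x]; the hypothesis therefore ranges over all translations. *)
Lemma scales_xsection d (N : 'M[R]_d) (b e : 'rV[R]_d) c : 0 <= c ->
  (forall e, scales (fun y => y *m N + e) c) ->
  scales (fun x : 'rV[R]_(1 + d) => x *m block_mx 1%:M b 0 N + row_mx 0 e) c.
Proof.
move=> c0 IH P mP; have mp := rmeasurable_pair_set mP.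
rewrite !vol_xsection -ge0_integralZl//.
- apply: eq_integral => x _; rewrite -(IH (x%:M *m b + e)).
    congr vol; apply/funext => y /=.
    by rewrite mul_row_block mulmx1 mulmx0 addr0 add_row_mx addr0 addrAC addrC.
  have := measurable_xsection x mp; rewrite xsectionE; exact.
- rewrite (_ : (fun _ => _) = leb d \o xsection (pair_set P)); last first.
    by apply/funext => x; rewrite volE /= xsectionE.
  exact: measurable_fun_xsection.
- by move=> x _; rewrite volE; exact: measure_ge0.
Qed.

(** With the last [d] coordinates frozen, the map acts on the first one as a one-dimensional affine
    map of slope [a]. *)
Lemma scales_ysection d (a : R) (c : 'cV[R]_d) (e : 'M[R]_1) : a != 0 ->
  scales (fun x : 'rV[R]_(1 + d) => x *m block_mx a%:M 0 c 1%:M + row_mx e 0) `|a|^-1.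
Proof.
move=> a0 P mP; have mp := rmeasurable_pair_set mP.
rewrite !vol_ysection//; last exact: rmeasurable_affine.
rewrite -ge0_integralZl//.
- apply: eq_integral => t _.
  rewrite -(lebesgue_measure_affine ((row_of t *m c) 0 0 + e 0 0))//.
    congr lebesgue_measure; apply/funext => y /=.
    rewrite mul_row_block mulmx1 mulmx0 add0r add_row_mx addr0 -scalar_mxM.
    rewrite {1}[_ *m c]mx11_scalar {1}[e]mx11_scalar -!raddfD/=.
    by rewrite mulrC addrA.
  have := measurable_ysection (t : d.-tuple mT) mp; rewrite ysectionE; exact.
- rewrite (_ : (fun _ => _) = lebesgue_measure \o ysection (pair_set P)); last first.
    by apply/funext => x; rewrite /= ysectionE.
  exact: measurable_fun_ysection.
Qed.

Lemma scales_comp d (f g : 'rV[R]_d -> 'rV[R]_d) a b :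
  (forall P, rmeasurable P -> rmeasurable (g @^-1` P)) ->
  scales f a -> scales g b -> scales (fun x => g (f x)) (a * b).
Proof.
move=> mg fa gb P mP.
by rewrite (fa (g @^-1` P))// ?gb// ?muleA ?EFinM//; exact: mg.
Qed.

(* Block LU decomposition reduces an invertible matrix with nonzero corner to the two shears
   above; otherwise a row operation makes the corner nonzero. *)
Lemma scales_affine d (M : 'M[R]_d) (b : 'rV[R]_d) : M \in unitmx ->
  scales (fun x => x *m M + b) `|\det M|^-1.
Proof.
elim: d M b => [|d IH] M b Mu.
  move=> P mP; rewrite det_mx00 normr1 invr1 mul1e.
  by congr vol; apply/funext => x /=; rewrite [_ + _]thinmx0 [x]thinmx0.
suff main (M' : 'M[R]_(1 + d)) (b' : 'rV[R]_(1 + d)) : M' \in unitmx -> M' 0 0 != 0 ->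
    scales (fun x => x *m M' + b') `|\det M'|^-1.
  have [M00|] := eqVneq (M ord0 ord0) 0; last exact: main.
  have [k Mk0] : exists k : 'I_d, M (rshift 1 k : 'I_(1 + d)) ord0 != 0.
    apply/existsP; apply: contraTT Mu; rewrite negb_exists => /forallP M0.
    rewrite unitmxE (expand_det_col _ ord0) big1 ?unitr0// => i _.
    have [-> | [j ->]] : i = ord0 \/ exists j : 'I_d, i = rshift 1 j.
    - by case: (split_ordP (i : 'I_(1 + d))) => j ->; 
        [left; apply/val_inj; rewrite /= (ord1 j)|right; exists j].
    - by rewrite M00 mul0r.
    - by have /negPn/eqP -> := M0 j; rewrite mul0r.
  pose E (s : R) : 'M[R]_(1 + d) := block_mx 1%:M (s *: delta_mx 0 k) 0 1%:M.
  have detE s : \det (E s) = 1 by rewrite det_ublock !det1 mulr1.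
  have EE : E (-1) *m (E 1) = 1%:M.
    rewrite mulmx_block !mulmx1 !mul1mx !mulmx0 !mul0mx !addr0 add0r.
    by rewrite -scalerDl subrr scale0r -scalar_mx_block.
  have sE : scales (fun x => x *m E (-1) + row_mx 0 0) 1.
    apply: scales_xsection => // e.
    by have := IH 1%:M e (unitmx1 _ _); rewrite det1 normr1 invr1.
  have Mu' : (E 1 *m (M : 'M[R]_(1 + d))) \in unitmx.
    by rewrite unitmx_mul; apply/andP; split; [rewrite unitmxE detE unitr1|exact: Mu].
  have EM00 : (E 1 *m (M : 'M[R]_(1 + d))) 0 0 != 0.
    have E1 j : E 1 (0 : 'I_(1 + d)) (rshift 1 j) = (j == k)%:R.
      have -> : (0 : 'I_(1 + d)) = lshift d ord0 by exact/val_inj.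
      by rewrite block_mxEur !mxE eqxx mul1r.
    rewrite mxE big_split_ord /= big_ord1.
    have -> : lshift d (ord0 : 'I_1) = ord0 :> 'I_d.+1 by exact/val_inj.
    rewrite M00 mulr0 add0r (bigD1 k)//= big1 ?addr0 ?E1 ?eqxx ?mul1r// => j jk.
    by rewrite E1 (negPf jk) mul0r.
  have := main _ b Mu' EM00; rewrite det_mulmx detE mul1r => sM.
  have := scales_comp (fun P => @rmeasurable_affine _ _ _ _ P) sE sM.
  rewrite mul1r row_mx0; congr scales; apply/funext => x.
  by rewrite addr0 !mulmxA -[_ *m E (-1) *m _]mulmxA EE mulmx1.
move=> M'u M'00.
pose a := M' 0 0; pose B := ursubmx M'; pose C := dlsubmx M'; pose D := drsubmx M'.
have M'E : M' = block_mx a%:M B C D.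
  by rewrite -[LHS]submxK [ulsubmx M']mx11_scalar !mxE; congr block_mx;
    congr (_%:M); congr (M' _ _); exact/val_inj.
(* The Schur complement of the corner [a], to which the induction hypothesis applies. *)
pose N := D - a^-1 *: (C *m B).
have M'F : M' = block_mx a%:M 0 C 1%:M *m block_mx 1%:M (a^-1 *: B) 0 N.
  rewrite M'E mulmx_block !mulmx1 !mulmx0 !mul1mx mul0mx !addr0.
  by rewrite mul_scalar_mx scalerA mulfV// scale1r -scalemxAr /N addrCA subrr addr0.
have detM' : \det M' = a * \det N.
  by rewrite M'F det_mulmx det_lblock det_ublock !det1 det_scalar1 mulr1 mul1r.
have Nu : N \in unitmx.
  by move: M'u; rewrite !unitmxE detM' unitrM => /andP[].
have s1 := @scales_ysection d a C (lsubmx b') M'00.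
pose e' := rsubmx b' - lsubmx b' *m (a^-1 *: B).
have s2 := @scales_xsection d N (a^-1 *: B) e' `|\det N|^-1
  (ltac:(by rewrite invr_ge0)) (fun e => IH N e Nu).
have := scales_comp (fun P => @rmeasurable_affine _ _ _ _ P) s1 s2.
rewrite detM' normrM invfM; congr scales; apply/funext => x.
rewrite mulmxDl -mulmxA -M'F -addrA; congr (_ + _).
rewrite mul_row_block mulmx1 !mul0mx !addr0 add_row_mx addr0 addrC subrK.
by rewrite hsubmxK.
Qed.
End LebesgueTuple.

(** * Additivity, null sets and the standard simplex *)

Section Volume.
Context {R : realType}.
Local Notation mT := (measurableTypeR R).

Lemma rmeasurableI d (P Q : set 'rV[R]_d) :
  rmeasurable P -> rmeasurable Q -> rmeasurable (P `&` Q).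
Proof. exact: measurableI. Qed.

Lemma rmeasurableU d (P Q : set 'rV[R]_d) :
  rmeasurable P -> rmeasurable Q -> rmeasurable (P `|` Q).
Proof. exact: measurableU. Qed.

Lemma rmeasurableD d (P Q : set 'rV[R]_d) :
  rmeasurable P -> rmeasurable Q -> rmeasurable (P `\` Q).
Proof. exact: measurableD. Qed.

Lemma rmeasurable_fin_bigcup d (I : finType) (p : pred I) (P : I -> set 'rV[R]_d) :
  (forall i, p i -> rmeasurable (P i)) -> rmeasurable [set x | exists2 i, p i & P i x].
Proof.
move=> mP; rewrite /rmeasurable.
rewrite (_ : _ @^-1` _ = \bigcup_(i in [set i | p i]) (@row_of _ d @^-1` P i)).
  by apply: fin_bigcup_measurable => //; exact: mP.
by apply/seteqP; split => x [i pi Pi]; exists i.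
Qed.

Lemma rmeasurable_fin_bigcap d (I : finType) (P : I -> set 'rV[R]_d) :
  (forall i, rmeasurable (P i)) -> rmeasurable [set x | forall i, P i x].
Proof.
move=> mP; rewrite /rmeasurable.
rewrite (_ : _ @^-1` _ = \bigcap_(i in [set: I]) (@row_of _ d @^-1` P i)).
  by apply: fin_bigcap_measurable => // i _; exact: mP.
by apply/seteqP; split => x Px i => [_|]; exact: Px.
Qed.

Lemma rmeasurable_linear d (w : 'cV[R]_d) (A : set mT) : measurable A ->
  rmeasurable [set x : 'rV[R]_d | A ((x *m w) ord0 ord0)].
Proof.
move=> mA; rewrite /rmeasurable -[X in measurable X]setTI.
exact: (measurable_row_sum w).
Qed.

Lemma vol_ge0 d (P : set 'rV[R]_d) : (0 <= vol P)%E.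
Proof. by rewrite volE; exact: measure_ge0. Qed.

Lemma vol0 d : vol (set0 : set 'rV[R]_d) = 0%E.
Proof. by rewrite volE preimage_set0 measure0. Qed.

Lemma vol_le d (P Q : set 'rV[R]_d) : rmeasurable P -> rmeasurable Q ->
  P `<=` Q -> (vol P <= vol Q)%E.
Proof.
by move=> mP mQ PQ; rewrite !volE; apply: le_measure; rewrite ?inE// => x; exact: PQ.
Qed.

Lemma vol_leD d (P Q : set 'rV[R]_d) : rmeasurable P -> rmeasurable Q ->
  (vol (P `|` Q) <= vol P + vol Q)%E.
Proof. by move=> mP mQ; rewrite !volE preimage_setU; apply: measureU2. Qed.

Lemma vol_negligibleU d (P N : set 'rV[R]_d) : rmeasurable P -> rmeasurable N ->
  vol N = 0%E -> vol (P `|` N) = vol P.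
Proof.
move=> mP mN N0; apply/eqP; rewrite eq_le; apply/andP; split.
  by rewrite (le_trans (vol_leD mP mN))// N0 adde0.
by apply: vol_le; [|exact: rmeasurableU|exact: subsetUl].
Qed.

Lemma vol_negligible_bigcup d (I : finType) (p : pred I) (P : I -> set 'rV[R]_d) :
  (forall i, p i -> rmeasurable (P i)) -> (forall i, p i -> vol (P i) = 0%E) ->
  vol [set x | exists2 i, p i & P i x] = 0%E.
Proof.
move=> mP P0.
have -> : [set x | exists2 i, p i & P i x] = \big[setU/set0]_(i in p) P i.
  by rewrite -bigcup_pred; apply/seteqP; split => x [i pi Pi]; exists i.
suff [] : rmeasurable (\big[setU/set0]_(i in p) P i) /\ vol (\big[setU/set0]_(i in p) P i) = 0%E.
  by [].
elim/big_ind: _ => [|A B [mA A0] [mB B0]|i pi].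
- by split; [exact: measurable0|exact: vol0].
- by split; [exact: rmeasurableU|rewrite vol_negligibleU].
- by split; [exact: mP|exact: P0].
Qed.

Lemma vol_disjointU d (P Q : set 'rV[R]_d) : rmeasurable P -> rmeasurable Q ->
  P `&` Q = set0 -> vol (P `|` Q) = (vol P + vol Q)%E.
Proof.
move=> mP mQ PQ0; rewrite !volE preimage_setU; apply: measureU => //.
by rewrite -preimage_setI PQ0 preimage_set0.
Qed.

Lemma vol_disjoint_bigcup d (I : finType) (p : pred I) (P : I -> set 'rV[R]_d) :
  (forall i, p i -> rmeasurable (P i)) ->
  (forall i j x, p i -> p j -> P i x -> P j x -> i = j) ->
  vol [set x | exists2 i, p i & P i x] = (\sum_(i | p i) vol (P i))%E.
Proof.
move=> mP tP.
suff main (s : seq I) : uniq s ->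
    let S := [set x | exists i, [/\ i \in s, p i & P i x]] in
    rmeasurable S /\ vol S = (\sum_(i <- s | p i) vol (P i))%E.
  have [_ <-] := main (index_enum I) (index_enum_uniq I).
  congr vol; apply/seteqP; split => x [i].
    by exists i; split => //; exact: mem_index_enum.
  by case=> _ pi Pi; exists i.
elim: s => [_ S|i s IH /= /andP[nis us]].
  rewrite big_nil (_ : S = set0) ?vol0; first by split=> //; exact: measurable0.
  by apply/seteqP; split => x // [i []].
have {IH} [mS volS] := IH us.
rewrite big_cons.
have [pi|npi] := ifPn; last first.
  rewrite -volS; set A := (X in rmeasurable X -> _) in mS *; set B := [set x | _].
  suff -> : B = A by [].
  apply/seteqP; split => x [j [js pj Pj]].
    move: js; rewrite inE => /orP[/eqP ji|]; first by rewrite -ji pj in npi.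
    by exists j; split.
  by exists j; split => //; rewrite inE js orbT.
rewrite -volS -vol_disjointU//; last 2 first.
- exact: mP.
- apply/seteqP; split => x // -[Pi [j [js pj Pj]]].
  by move: nis; rewrite (tP i j x)// js.
set A := [set x | _]; set B := _ `|` _.
suff -> : A = B by split=> //; apply: rmeasurableU => //; exact: mP.
apply/seteqP; split => x.
  move=> [j [+ pj Pj]]; rewrite inE => /orP[/eqP ji|js]; first by left; rewrite -ji.
  by right; exists j.
by move=> [Pi|[j [js pj Pj]]]; [exists i; rewrite inE eqxx|exists j; rewrite inE js orbT].
Qed.

Lemma affine_map_image d (M : 'M[R]_d) b (P : set 'rV[R]_d) : M \in unitmx ->
  affine_map M b @` P = (fun x => x *m invmx M + - (b *m invmx M)) @^-1` P.
Proof.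
move=> Mu; apply/seteqP; split => [_ [x Px <-] /=|x /= Px].
  by rewrite /affine_map mulmxDl mulmxK// addrK.
by eexists; [exact: Px|]; rewrite /affine_map -mulmxBl mulmxKV// subrK.
Qed.

Lemma vol_image d (M : 'M[R]_d) b (P : set 'rV[R]_d) : M \in unitmx ->
  rmeasurable P -> vol (affine_map M b @` P) = (`|\det M|%:E * vol P)%E.
Proof.
move=> Mu mP; rewrite affine_map_image// scales_affine ?unitmx_inv//.
by rewrite det_inv normfV invrK.
Qed.

(** If [w] has a nonzero entry beyond the first, the slices at fixed first coordinate are
    hyperplanes of lower dimension; otherwise the slices parallel to the first axis are single
    points. *)
Lemma vol_hyperplane d (w : 'cV[R]_d) (c : R) : w != 0 ->
  vol [set x : 'rV[R]_d | (x *m w) ord0 ord0 = c] = 0%E.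
Proof.
elim: d w c => [|d IH] w c; first by rewrite [w]flatmx0 eqxx.
pose W : 'cV[R]_(1 + d) := w.
have E (x : mT) (y : 'rV[R]_d) :
    (row_mx x%:M y *m W) ord0 ord0 = x * w ord0 ord0 + (y *m dsubmx W) ord0 ord0.
  rewrite -{1}[W]vsubmxK mul_row_col mxE mul_scalar_mx !mxE; congr (_ * W _ _ + _).
  exact/val_inj.
have mP : rmeasurable [set x : 'rV[R]_(1 + d) | (x *m W) ord0 ord0 = c].
  exact: (@rmeasurable_linear _ W [set c] (measurable_set1 _)).
move=> w0; rewrite -/W; have [wd0|wd0] := eqVneq (dsubmx W) 0.
  have w00 : w ord0 ord0 != 0.
    apply: contra w0 => /eqP w00; rewrite -/W -[W]vsubmxK wd0.
    rewrite (_ : usubmx W = 0) ?col_mx0//; apply/matrixP => i j.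
    rewrite !mxE !ord1 -[RHS]w00; congr (W _ _); exact/val_inj.
  rewrite (vol_ysection mP); apply: integral0_eq => t _ /=.
  rewrite (_ : [set x : mT | _] = [set c / w ord0 ord0]) ?lebesgue_measure_set1//.
  apply/seteqP; split => x /=; rewrite E wd0 mulmx0 mxE addr0.
    by move=> <-; rewrite mulfK.
  by move=> ->; rewrite divfK.
rewrite vol_xsection; apply: integral0_eq => x _ /=.
rewrite -[RHS](IH _ (c - x * w ord0 ord0) wd0); congr vol.
by apply/seteqP; split => y /=; rewrite E => H; lra.
Qed.

Definition open_simplex d : set 'rV[R]_d :=
  [set x | (forall i, 0 < x ord0 i) /\ \sum_i x ord0 i < 1].

Lemma rmeasurable_open_simplex d : rmeasurable (@open_simplex d).
Proof.
apply: rmeasurableI.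
  apply: rmeasurable_fin_bigcap => i.
  have := @rmeasurable_linear d (delta_mx i ord0) `]0, +oo[%classic (measurable_itv _).
  congr rmeasurable; apply/funext => x /=; rewrite in_itv/= andbT mxE (bigD1 i)//= big1.
    by rewrite !mxE !eqxx mulr1 addr0.
  by move=> j ji; rewrite mxE (negPf ji) mulr0.
have := @rmeasurable_linear d (const_mx 1) `]-oo, 1[%classic (measurable_itv _).
congr rmeasurable; apply/funext => x /=; rewrite in_itv/= mxE.
congr (is_true (_ < 1)); apply: eq_bigr => i _; by rewrite mxE mulr1.
Qed.

Lemma integral_onemXn n :
  (\int[lebesgue_measure]_(x in (`]0, 1[%classic : set R)%R) ((onem x ^+ n)%R)%:E = (n.+1%:R^-1)%:E)%E.
Proof.
rewrite -(Rintegral_onemXn n) /Rintegral -(integral_itv_bndoo true false); last first.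
  apply/measurable_EFinP; apply: measurable_funX.
  by apply: measurable_funB.
rewrite fineK//; apply: integrable_fin_num => //.
apply: continuous_compact_integrable; first exact: segment_compact.
by apply: continuous_in_subspaceT => x _; exact: continuous_onemXn.
Qed.

(** The slice at [x] in []0, 1[] is the lower-dimensional simplex scaled by [1 - x], so the
    recursion integrates [(1 - x)^d / d!]. *)
Lemma vol_open_simplex d : vol (@open_simplex d) = (d`!%:R^-1)%:E.
Proof.
elim: d => [|d IH].
  rewrite (_ : @open_simplex 0 = setT).
    by rewrite /vol /= diracE mem_set// fact0 invr1.
  by apply/seteqP; split => // x _; split => [[]//|]; rewrite big_ord0.
rewrite vol_xsection.
have sE (x : R) (y : 'rV[R]_d) : @open_simplex (1 + d) (row_mx x%:M y) <->
    [/\ 0 < x, forall i, 0 < y ord0 i & x + \sum_i y ord0 i < 1].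
  rewrite /open_simplex /= (@big_split_ord _ _ _ 1 d) /= big_ord1 row_mxEl mxE eqxx mulr1n.
  under eq_bigr do rewrite row_mxEr.
  split=> [[H ?]|[x0 H ?]]; split=> //.
  - by have := H (lshift d ord0); rewrite row_mxEl mxE eqxx mulr1n.
  - by move=> i; have := H (rshift 1 i); rewrite row_mxEr.
  - move=> i; case: (split_ordP (i : 'I_(1 + d))) => j ->; last by rewrite row_mxEr.
    by rewrite row_mxEl mxE (ord1 j) eqxx mulr1n.
under eq_integral => x _.
  rewrite (_ : vol _ =
    ((fun y : R => (d`!%:R^-1)%:E * (onem y ^+ d)%:E)%E \_ `]0, 1[%classic) x); last first.
    rewrite patchE (_ : (x \in _) = (0 < x < 1)); last first.
      by apply/idP/idP; rewrite inE /= in_itv.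
    case: ifPn => [/andP[x0 x1]|x01].
      have x1' : 0 < onem x by rewrite /onem subr_gt0.
      rewrite -IH muleC.
      have := @scales_affine R d ((onem x)^-1)%:M 0.
      rewrite unitmxE det_scalar unitfE expf_neq0 ?invr_neq0 ?gt_eqF// => /(_ isT).
      rewrite ger0_norm ?exprn_ge0 ?invr_ge0 ?ltW// exprVn invrK => <-;
        last exact: rmeasurable_open_simplex.
      congr vol; apply/seteqP.
      have e (y : 'rV[R]_d) i : (y *m ((onem x)^-1)%:M + 0) ord0 i = (onem x)^-1 * y ord0 i.
        by rewrite addr0 mul_mx_scalar mxE.
      split => y /=.
        move=> /sE[_ y0 s1]; split=> [i|]; first by rewrite e mulr_gt0// invr_gt0.
        under eq_bigr do rewrite e.
        by rewrite -mulr_sumr mulrC ltr_pdivrMr// mul1r /onem ltrBrDl.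
      move=> [y0 s1]; apply/sE; split=> // [i|].
        by have := y0 i; rewrite e pmulr_rgt0// invr_gt0.
      move: s1; under eq_bigr do rewrite e.
      by rewrite -mulr_sumr mulrC ltr_pdivrMr// mul1r /onem ltrBrDl.
    transitivity (vol (set0 : set 'rV[R]_d)); last by rewrite vol0.
    congr vol; apply/seteqP; split => // y /= /sE[x0 y0 s1].
    move/negP: x01; apply; rewrite x0 /=; apply: le_lt_trans s1.
    by rewrite lerDl sumr_ge0// => i _; exact: ltW.
  over.
rewrite -integral_mkcond ge0_integralZl//.
- by rewrite integral_onemXn -EFinM -invfM -natrM mulnC.
- apply/measurable_EFinP; apply: measurable_funX.
  exact: measurable_funB.
- by move=> x /=; rewrite in_itv/= => /andP[x0 x1]; rewrite lee_fin exprn_ge0// /onem subr_ge0 ltW.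
Qed.

End Volume.

(** * Triangulation of a convex hull *)

Section ConeBases.
Context {R : realFieldType} {n m : nat} (H : 'M[R]_(n, m)).
Implicit Types (s t : {ffun 'I_m -> 'I_n}) (y : 'rV[R]_m).

(** A basis is an ordered choice of rows, so one set of rows appears in several orders. For
    [H := homog G] it is a nondegenerate simplex with vertices among the rows of [G]. *)
Definition is_basis s : bool := rowsub s H \in unitmx.

Definition coords s y : 'rV[R]_m := y *m invmx (rowsub s H).

Lemma coordsK s y : is_basis s -> coords s y *m rowsub s H = y.
Proof. by move=> bs; rewrite /coords mulmxKV. Qed.

Lemma mul_rowsubE (a : 'rV[R]_m) s : a *m rowsub s H = \sum_j a ord0 j *: row (s j) H.
Proof.
rewrite mulmx_sum_row; apply: eq_bigr => j _.
by congr (_ *: _); apply/rowP => k; rewrite !mxE.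
Qed.

Lemma coords_unique s (a : 'rV[R]_m) y : is_basis s ->
  y = \sum_j a ord0 j *: row (s j) H -> coords s y = a.
Proof. by move=> bs ->; rewrite -mul_rowsubE /coords mulmxK. Qed.

(** The ratio test of the simplex method: [c] is the largest multiple of [b] that can be subtracted
    from [a] within the nonnegative orthant, and [i] is a coordinate that then vanishes. *)
Lemma ratio_test (a b : 'rV[R]_m) : (forall j, 0 <= a ord0 j) ->
  (exists j, 0 < b ord0 j) ->
  exists c i, [/\ 0 <= c, 0 < b ord0 i, a ord0 i = c * b ord0 i &
    forall j, c * b ord0 j <= a ord0 j].
Proof.
move=> a0 [j0 bj0].
pose i := [arg min_(i < j0 | 0 < b ord0 i) (a ord0 i / b ord0 i)]%O.
have [bi imin] : 0 < b ord0 i /\ forall j, 0 < b ord0 j -> a ord0 i / b ord0 i <= a ord0 j / b ord0 j.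
  by rewrite /i; case: arg_minP.
exists (a ord0 i / b ord0 i), i; split=> //.
- by rewrite divr_ge0// ltW.
- by rewrite divfK// gt_eqF.
move=> j; have [bj|bj] := ltP 0 (b ord0 j); first by rewrite -ler_pdivlMr// imin.
by rewrite (le_trans _ (a0 j))// mulr_ge0_le0// divr_ge0// ltW.
Qed.

Definition exchange s i k : {ffun 'I_m -> 'I_n} := [ffun j => if j == i then k else s j].

Lemma exchange_sum s i k (a : 'I_m -> R) c :
  \sum_j (if j == i then c else a j) *: row (exchange s i k j) H =
  c *: row k H + (\sum_j a j *: row (s j) H - a i *: row (s i) H).
Proof.
rewrite (bigD1 i)//= [in RHS](bigD1 i)//= ffunE eqxx addrAC subrr add0r.
by congr (_ + _); apply: eq_bigr => j /negPf ji; rewrite ffunE ji.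
Qed.

Lemma is_basis_exchange s i k : is_basis s -> coords s (row k H) ord0 i != 0 ->
  is_basis (exchange s i k).
Proof.
move=> bs bi; rewrite /is_basis -row_free_unit -kermx_eq0; apply/rowV0P => u.
rewrite sub_kermx => /eqP u0.
set b := coords s (row k H) in bi.
have kE : row k H = \sum_j b ord0 j *: row (s j) H by rewrite -mul_rowsubE coordsK.
(* The combination [u] of the new rows, rewritten in the old basis through [kE]; uniqueness of
   coordinates forces it to vanish. *)
pose a : 'rV[R]_m := \row_j (u ord0 i * b ord0 j + (u ord0 j) *+ (j != i)).
have a0 : coords s 0 = a.
  apply: coords_unique => //; rewrite -[LHS]u0 mul_rowsubE.
  transitivity (\sum_j (if j == i then u ord0 i else u ord0 j) *: row (exchange s i k j) H).
    by apply: eq_bigr => j _; case: eqP => [->|].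
  rewrite exchange_sum kE scaler_sumr [in RHS](eq_bigr (fun j => u ord0 i *: (b ord0 j *: row (s j) H) +
      (u ord0 j *+ (j != i)) *: row (s j) H)); last first.
    by move=> j _; rewrite mxE scalerDl scalerA.
  rewrite big_split /=; congr (_ + _).
  rewrite (bigD1 i)//= addrAC subrr add0r [RHS](bigD1 i)//= eqxx mulr0n scale0r add0r.
  by apply: eq_bigr => j /negPf ->.
have aE j : a ord0 j = 0 by rewrite -a0 /coords mul0mx mxE.
have ui : u ord0 i = 0.
  have /eqP := aE i; rewrite mxE eqxx mulr0n addr0 mulf_eq0 (negPf bi) orbF.
  by move/eqP.
apply/rowP => j; rewrite [RHS]mxE; have [->|ji] := eqVneq j i; first exact: ui.
by have := aE j; rewrite mxE ui mul0r add0r ji mulr1n.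
Qed.

Lemma coords_exchange s i k (a : 'I_m -> R) c y :
  is_basis (exchange s i k) -> a i = 0 ->
  y = c *: row k H + \sum_j a j *: row (s j) H ->
  coords (exchange s i k) y = \row_j (if j == i then c else a j).
Proof.
move=> bs ai yE; apply: coords_unique => //.
under eq_bigr do rewrite mxE.
by rewrite exchange_sum ai scale0r subr0.
Qed.

(** Generators are added one at a time. If [l k] times row [k] makes a coordinate negative, only a
    part [c <= l k] is absorbed by the current basis, up to the moment when coordinate [i] vanishes;
    row [k] then replaces row [s i] and carries the remaining weight [l k - c]. *)
Lemma conic_caratheodory s0 (l : 'I_n -> R) : is_basis s0 -> (forall k, 0 <= l k) ->
  exists2 s, is_basis s & forall j, 0 <= coords s (\sum_k l k *: row k H) ord0 j.
Proof.
move=> bs0 l0; elim/big_rec: _ => [|k y _ [s bs y0]].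
  by exists s0 => // j; rewrite /coords mul0mx mxE.
set a := coords s y in y0; set b := coords s (row k H).
have yE : y = \sum_j a ord0 j *: row (s j) H by rewrite -mul_rowsubE coordsK.
have kE : row k H = \sum_j b ord0 j *: row (s j) H by rewrite -mul_rowsubE coordsK.
have [/forallP ab|] := boolP [forall j, 0 <= l k * b ord0 j + a ord0 j].
  exists s => // j; rewrite (_ : coords _ _ = l k *: b + a).
    by rewrite mxE [X in X + _]mxE.
  by rewrite /coords mulmxDl -scalemxAl.
rewrite negb_forall => /existsP[j1]; rewrite -ltNge => ab.
have bj1 : 0 < (- b) ord0 j1.
  rewrite mxE oppr_gt0 ltNge; apply/negP => bj1.
  by move: ab; rewrite ltNge addr_ge0// mulr_ge0.
have [c [i [c0 bi ai H1]]] := @ratio_test a (- b) y0 (ex_intro _ j1 bj1).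
have clk : c <= l k.
  have := H1 j1; move: bj1 ab; rewrite mxE oppr_gt0 => bj1 ab.
  rewrite mulrN => H2; rewrite -(ler_nM2r bj1); move: H2 ab; lra.
have bs' : is_basis (exchange s i k).
  by apply: is_basis_exchange => //; rewrite -oppr_eq0 -/b; move: bi; rewrite mxE => /gt_eqF ->.
exists (exchange s i k) => // j.
rewrite (@coords_exchange _ _ _ (fun j => a ord0 j + c * b ord0 j) (l k - c))//.
- rewrite mxE; case: eqP => _; first by rewrite subr_ge0.
  by have := H1 j; rewrite mxE; lra.
- by rewrite ai mxE; lra.
- suff yE' : y = - (c *: row k H) + \sum_j (a ord0 j + c * b ord0 j) *: row (s j) H.
    by rewrite [in LHS]yE' scalerBl addrA.
  rewrite {1}yE kE scaler_sumr -sumrN -big_split.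
  apply: eq_bigr => h _ /=; rewrite scalerDl scalerA addrCA.
  by rewrite [X in _ + X]addrC subrr addr0.
Qed.

Variable w : 'I_n -> R.

Definition cost s y := \sum_j coords s y ord0 j * w (s j).

(** [cost s] is the linear form with value [w (s j)] at row [s j]. That it stays below all weights
    means that the cone over [s] lies under a face of the lower hull of the rows lifted to the
    heights [w]. *)
Definition is_lower s := [forall k, cost s (row k H) <= w k].

Lemma costD s y z : cost s (y + z) = cost s y + cost s z.
Proof.
rewrite /cost -big_split; apply: eq_bigr => j _ /=.
by rewrite /coords mulmxDl mxE mulrDl.
Qed.

Lemma costZ s c y : cost s (c *: y) = c * cost s y.
Proof.
rewrite /cost mulr_sumr; apply: eq_bigr => j _ /=.
by rewrite /coords -scalemxAl mxE mulrA.
Qed.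

Lemma cost_sum s (I : finType) (f : I -> 'rV[R]_m) : cost s (\sum_i f i) = \sum_i cost s (f i).
Proof.
apply: (big_morph (cost s) (costD s)).
by rewrite -(scale0r 0) costZ mul0r.
Qed.

(* A feasible basis of least cost is lower: otherwise a simplex-method pivot would
   decrease its cost. *)
Lemma exists_lower y (u : 'cV[R]_m) : H *m u = const_mx 1 ->
  (exists2 s, is_basis s & forall j, 0 <= coords s y ord0 j) ->
  (forall s j, is_basis s -> coords s y ord0 j != 0) ->
  exists s, [/\ is_basis s, is_lower s & forall j, 0 < coords s y ord0 j].
Proof.
move=> Hu [s0 bs0 y0] gen.
pose feas s := is_basis s && [forall j, 0 <= coords s y ord0 j].
have f0 : feas s0 by rewrite /feas bs0; apply/forallP.
pose s := [arg min_(s < s0 | feas s) cost s y]%O.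
have [/andP[bs /forallP sy] smin] : feas s /\ forall t, feas t -> cost s y <= cost t y.
  by rewrite /s; case: arg_minP.
have sy' j : 0 < coords s y ord0 j by rewrite lt_neqAle eq_sym gen//=.
exists s; split=> //; apply/forallP => k; rewrite leNgt; apply/negP => wk.
set b := coords s (row k H); set a := coords s y in sy sy'.
have kE : row k H = \sum_j b ord0 j *: row (s j) H by rewrite -mul_rowsubE coordsK.
have yE : y = \sum_j a ord0 j *: row (s j) H by rewrite -mul_rowsubE coordsK.
(* All rows of [H] lie on the hyperplane where [u] takes the value 1, so the coordinates [b] sum to
   1 and cannot all be nonpositive. *)
have bpos : exists j, 0 < b ord0 j.
  have : (b *m (const_mx 1 : 'cV[R]_m)) ord0 ord0 = 1.
    have -> : const_mx 1 = rowsub s H *m u.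
      by rewrite mul_rowsub_mx Hu; apply/colP => j; rewrite !mxE.
    by rewrite mulmxA coordsK// -row_mul Hu !mxE.
  rewrite mxE => b1; apply/existsP; apply: contraPT b1 => /existsPn b0.
  apply/eqP; rewrite lt_eqF// (@le_lt_trans _ _ 0)// sumr_le0// => j _.
  by rewrite [X in _ * X]mxE mulr1 leNgt b0.
have [c [i [c0 bi ai H1]]] := ratio_test sy bpos.
(* No coordinate of [y] is zero, so the pivot has positive length and the cost drops strictly. *)
have c_gt0 : 0 < c.
  by have := sy' i; rewrite ai pmulr_lgt0.
have bs' : is_basis (exchange s i k) by apply: is_basis_exchange => //; rewrite gt_eqF.
have cE := @coords_exchange s i k (fun j => a ord0 j - c * b ord0 j) c y bs'.
have {}cE : coords (exchange s i k) y = \row_j (if j == i then c else a ord0 j - c * b ord0 j).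
  apply: cE; first by rewrite ai subrr.
  rewrite yE kE scaler_sumr -big_split; apply: eq_bigr => h _ /=.
  by rewrite scalerBl scalerA addrCA subrr addr0.
have feas' : feas (exchange s i k).
  rewrite /feas bs'; apply/forallP => j; rewrite cE mxE; case: eqP => // _.
  by rewrite subr_ge0.
have := smin _ feas'; rewrite leNgt => /negP; apply.
rewrite /cost cE.
have -> : \sum_j (\row_j (if j == i then c else a ord0 j - c * b ord0 j)) ord0 j * w (exchange s i k j) =
   cost s y - c * (cost s (row k H) - w k).
  rewrite /cost (bigD1 i)//= mxE eqxx ffunE eqxx mulrBr mulr_sumr -/a -/b.
  rewrite [X in _ = X - _](bigD1 i)//= [X in _ = _ - (X - _)](bigD1 i)//= ai.
  rewrite (eq_bigr (fun j => a ord0 j * w (s j) - c * (b ord0 j * w (s j)))); last first.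
    by move=> j /negPf ji; rewrite mxE ji ffunE ji mulrBl mulrA.
  by rewrite big_split /= sumrN; ring.
by rewrite -/(cost s y) ltrBlDr ltrDl mulr_gt0// subr_gt0.
Qed.

Definition basis_set s : {set 'I_n} := [set s j | j : 'I_m].

(** No further lifted row lies on the hyperplane through a lifted basis, so that lower faces are
    simplicial. *)
Definition generic := forall s k, is_basis s -> k \notin basis_set s -> cost s (row k H) != w k.

Lemma coords_basis s i : is_basis s -> coords s (row (s i) H) = delta_mx ord0 i.
Proof.
move=> bs; apply: coords_unique => //.
rewrite (bigD1 i)//= !mxE !eqxx scale1r big1 ?addr0// => j /negPf ji.
by rewrite mxE ji andbF scale0r.
Qed.

Lemma basis_inj s : is_basis s -> injective s.
Proof.
move=> bs i j e; have := coords_basis i bs; rewrite e coords_basis//.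
move=> /(congr1 (fun u : 'rV[R]_m => u ord0 i)); rewrite !mxE !eqxx /=.
by case: eqVneq => // _ /eqP; rewrite eq_sym oner_eq0.
Qed.

Lemma coords_basis_set_gt0 s t y : is_basis s -> is_basis t ->
  basis_set s = basis_set t -> (forall j, 0 < coords s y ord0 j) ->
  forall j, 0 < coords t y ord0 j.
Proof.
move=> bs bt st sy.
have /fin_all_exists[p pE] j : exists i, t j = s i.
  have : t j \in basis_set s by rewrite st; exact: imset_f.
  by move=> /imsetP[i _ ->]; exists i.
have pinj : injective p by move=> i j pij; apply: (basis_inj bt); rewrite !pE pij.
suff -> : coords t y = \row_j coords s y ord0 (p j) by move=> j; rewrite mxE.
apply: coords_unique => //; rewrite -{1}(coordsK y bs) mul_rowsubE (reindex_inj pinj).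
by apply: eq_bigr => j _; rewrite mxE pE.
Qed.

(** Expanding [y] in the basis [t], lowness of [s] gives [cost s y <= cost t y]; as the coordinates
    are positive, genericity allows equality only if every vertex of [t] is one of [s]. The roles
    are then exchanged. *)
Lemma lower_basis_set s t y : generic ->
  is_basis s -> is_lower s -> (forall j, 0 < coords s y ord0 j) ->
  is_basis t -> is_lower t -> (forall j, 0 < coords t y ord0 j) ->
  basis_set s = basis_set t.
Proof.
move=> gen.
have key s1 t1 : is_basis s1 -> is_lower s1 -> (forall j, 0 < coords s1 y ord0 j) ->
    is_basis t1 -> (forall j, 0 < coords t1 y ord0 j) ->
    cost s1 y <= cost t1 y ?= iff (basis_set t1 \subset basis_set s1).
  move=> bs1 /forallP ls1 sy1 bt1 ty1.
  have yE : y = \sum_j coords t1 y ord0 j *: row (t1 j) H by rewrite -mul_rowsubE coordsK.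
  rewrite {1}yE cost_sum [X in _ <= X ?= iff _]/cost.
  have -> : (basis_set t1 \subset basis_set s1) = [forall j, t1 j \in basis_set s1].
    apply/fintype.subsetP/forallP => [h j|h k /imsetP[j _ ->]]; last exact: h.
    exact/h/imset_f.
  apply: leif_sum => j _; rewrite costZ; apply/leifP.
  case: ifPn => [/imsetP[h _ ->]|tj].
    apply/eqP; congr (_ * _); rewrite /cost coords_basis// (bigD1 h)//= big1.
      by rewrite mxE !eqxx mul1r addr0.
    by move=> h' /negPf hh'; rewrite mxE hh' andbF mul0r.
  by rewrite ltr_pM2l// lt_neqAle ls1 andbT gen.
move=> bs ls sy bt lt ty.
have [st1 st2] := key s t bs ls sy bt ty; have [ts1 ts2] := key t s bt lt ty bs sy.
have e : cost s y == cost t y by rewrite eq_le st1 ts1.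
by apply/eqP; rewrite finset.eqEsubset -st2 -ts2 e eq_sym e.
Qed.

End ConeBases.

Section Generic.
Context {R : realFieldType}.

Lemma poly_nonroot (p : {poly R}) : p != 0 -> exists t, p.[t] != 0.
Proof.
move=> p0; apply: contrapT => /forallNP np.
have np' t : root p t by apply/rootP/eqP; rewrite -[_ == _]negbK; apply/negP/np.
pose s := [seq i%:R : R | i <- iota 0 (size p)].
have := @max_poly_roots _ p s p0.
rewrite size_map size_iota ltnn => H; suff: false by [].
apply: H; first by apply/allP => t _; exact: np'.
rewrite map_inj_uniq ?iota_uniq// => i j /eqP; rewrite eqr_nat; exact/eqP.
Qed.

(** With weights [t ^+ k], a coincidence is a root [t] of [p s k], which is nonzero because ['X^k]
    has coefficient 1 in it. A nonroot of the product of these polynomials avoids all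
    coincidences. *)
Lemma exists_generic n m (H : 'M[R]_(n, m)) : exists w, generic H w.
Proof.
pose p (s : {ffun 'I_m -> 'I_n}) (k : 'I_n) : {poly R} :=
  'X^k - \sum_j coords H s (row k H) ord0 j *: 'X^(s j).
have p0 (s : {ffun 'I_m -> 'I_n}) (k : 'I_n) : k \notin basis_set s -> p s k != 0.
  move=> ks; apply/eqP => /(congr1 (fun q : {poly R} => q`_k)); apply/eqP.
  rewrite coefB coefXn eqxx coef_sum big1 ?subr0 ?coef0 ?oner_eq0// => j _.
  rewrite coefZ coefXn; case: eqP => [kj|]; last by rewrite mulr0.
  by case/imsetP: ks; exists j => //; exact/val_inj.
pose q := \prod_(sk : {ffun 'I_m -> 'I_n} * 'I_n | sk.2 \notin basis_set sk.1) p sk.1 sk.2.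
have [t qt] : exists t, q.[t] != 0.
  by apply: poly_nonroot; apply/prodf_neq0 => -[s k] /=; exact: p0.
exists (fun k => t ^+ k) => s k bs ks.
move: qt; rewrite horner_prod => /prodf_neq0 /(_ (s, k) ks) /=.
rewrite hornerD hornerN hornerXn horner_sum subr_eq0 eq_sym.
by under eq_bigr do rewrite hornerZ hornerXn.
Qed.
End Generic.

(** * Convex hulls and simplices in homogeneous coordinates *)

Section Hull.
Context {R : realType}.

(** Points are placed at height one. Convex combinations become conic ones, affine maps become
    matrices, and the determinant of a simplex is its signed normalized volume. *)
Definition homog {n d} (G : 'M[R]_(n, d)) : 'M[R]_(n, 1 + d) := row_mx (const_mx 1) G.

Lemma row_homog n d (G : 'M[R]_(n, d)) k : row k (homog G) = homog (row k G).
Proof. by rewrite /homog row_row_mx row_const. Qed.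

Lemma rowsub_homog n d m (f : 'I_m -> 'I_n) (G : 'M[R]_(n, d)) :
  rowsub f (homog G) = homog (rowsub f G).
Proof.
apply/matrixP => i j; rewrite !mxE; case: split_ordP => k _; by rewrite ?mxE.
Qed.

Lemma homog_mulmx n d (G : 'M[R]_(n, d)) : homog G *m col_mx 1%:M 0 = const_mx 1.
Proof. by rewrite mul_row_col mulmx0 addr0 mulmx1. Qed.

Lemma homog_affine n d (G : 'M[R]_(n, d)) (M : 'M[R]_d) (b : 'rV[R]_d) :
  homog (G *m M + const_mx 1 *m b) = homog G *m block_mx 1%:M b 0 M.
Proof. by rewrite /homog mul_row_block mulmx1 mulmx0 addr0 addrC. Qed.

Definition hull {n d} (G : 'M[R]_(n, d)) : set 'rV[R]_d :=
  [set x | exists2 l : 'I_n -> R, forall k, 0 <= l k & homog x = \sum_k l k *: row k (homog G)].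

Lemma hullP n d (G : 'M[R]_(n, d)) x : hull G x <->
  exists l : 'I_n -> R, [/\ forall k, 0 <= l k, \sum_k l k = 1 & x = \sum_k l k *: row k G].
Proof.
have E (l : 'I_n -> R) : \sum_k l k *: row k (homog G) =
    row_mx (const_mx (\sum_k l k)) (\sum_k l k *: row k G).
  apply/rowP => j; rewrite summxE; case: (split_ordP j) => i ->.
    by rewrite row_mxEl mxE; apply: eq_bigr => k _; rewrite row_homog mxE row_mxEl mxE mulr1.
  by rewrite row_mxEr summxE; apply: eq_bigr => k _; rewrite row_homog mxE row_mxEr [RHS]mxE.
split=> [[l l0]|[l [l0 l1 ->]]].
  rewrite E => /eq_row_mx[/(congr1 (fun u : 'M[R]_1 => u ord0 ord0))]; rewrite !mxE => l1 xE.
  by exists l; split.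
by exists l => //; rewrite E l1.
Qed.

Lemma convexP d (C : set 'rV[R]_d) : convex_set C <->
  forall x y (t : R), 0 <= t -> t <= 1 -> C x -> C y -> C (t *: x + (1 - t) *: y).
Proof.
have E (x y : convex_lmodType 'rV[R]_d) (t : {i01 R}) :
  conv t x y = t%:inum *: (x : 'rV[R]_d) + (1 - t%:inum) *: (y : 'rV[R]_d) :> 'rV[R]_d by [].
split=> [cC x y t t0 t1 Cx Cy|cC x y t /set_mem Cx /set_mem Cy].
  have := cC x y (Itv01 t0 t1) (mem_set Cx) (mem_set Cy).
  by rewrite inE E.
by rewrite inE E; apply: cC.
Qed.

Lemma sub_convex_hull d (S : set 'rV[R]_d) : S `<=` convex_hull S.
Proof. exact: sub_smallest. Qed.

Lemma convex_hull_min d (S C : set 'rV[R]_d) :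
  (forall x y (t : R), 0 <= t -> t <= 1 -> C x -> C y -> C (t *: x + (1 - t) *: y)) ->
  S `<=` C -> convex_hull S `<=` C.
Proof. by move=> /convexP cC SC; exact: smallest_sub. Qed.

Lemma convex_hull_convex d (S : set 'rV[R]_d) x y (t : R) : 0 <= t -> t <= 1 ->
  convex_hull S x -> convex_hull S y -> convex_hull S (t *: x + (1 - t) *: y).
Proof.
move=> t0 t1 Sx Sy C [cC SC]; have /convexP := cC; apply => //.
- by apply: Sx.
- by apply: Sy.
Qed.

Lemma convex_hull_mono d (S T : set 'rV[R]_d) : S `<=` convex_hull T ->
  convex_hull S `<=` convex_hull T.
Proof. by apply: convex_hull_min => x y t; exact: convex_hull_convex. Qed.

(** Points of weight zero are exempt from lying in the hull; this lets a family keep a point that is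
    being expressed through the others, as in [irredundant_extreme]. *)
Lemma convex_hull_sum d (S : set 'rV[R]_d) (I : finType) (l : I -> R) (g : I -> 'rV[R]_d) :
  (forall i, 0 <= l i) -> \sum_i l i = 1 -> (forall i, l i != 0 -> convex_hull S (g i)) ->
  convex_hull S (\sum_i l i *: g i).
Proof.
move=> l0 l1 Sg.
suff main (s : seq I) : 0 < \sum_(i <- s) l i ->
    convex_hull S ((\sum_(i <- s) l i)^-1 *: \sum_(i <- s) l i *: g i).
  by have := main (index_enum I); rewrite l1 invr1 scale1r; apply; exact: ltr01.
elim: s => [|i s IH]; first by rewrite big_nil ltxx.
rewrite !big_cons; set W := \sum_(j <- s) l j; set X := \sum_(j <- s) _.
have W0 : 0 <= W by apply: sumr_ge0.
move=> pos; have [li0|li0] := eqVneq (l i) 0.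
  by move: pos; rewrite li0 !add0r scale0r add0r; exact: IH.
have li_gt0 : 0 < l i by rewrite lt_neqAle eq_sym li0 l0.
have [We|Wn] := eqVneq W 0.
  rewrite We addr0 (_ : X = 0) ?addr0 ?scalerA ?mulVf// ?scale1r; first exact: Sg.
  rewrite /X big_seq big1// => j js.
  have /allP/(_ j js)/implyP/(_ isT)/eqP -> : all (fun j => true ==> (l j == 0)) s.
    by move/eqP: We; rewrite /W psumr_eq0.
  by rewrite scale0r.
have W_gt0 : 0 < W by rewrite lt_neqAle eq_sym Wn.
have := @convex_hull_convex _ S (g i) (W^-1 *: X) (l i / (l i + W)) _ _ (Sg _ li0) (IH W_gt0).
have -> : 1 - l i / (l i + W) = W / (l i + W) by field; rewrite gt_eqF.
rewrite scalerDr !scalerA mulrAC mulfV// mul1r [_^-1 * _]mulrC; apply.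
  by rewrite divr_ge0// ltW.
by rewrite ler_pdivrMr// mul1r lerDl.
Qed.

Definition rows {n d} (G : 'M[R]_(n, d)) : set 'rV[R]_d := [set row k G | k in setT].

Lemma hull_convex n d (G : 'M[R]_(n, d)) x y (t : R) : 0 <= t -> t <= 1 ->
  hull G x -> hull G y -> hull G (t *: x + (1 - t) *: y).
Proof.
move=> t0 t1 /hullP[l [l0 l1 ->]] /hullP[k [k0 k1 ->]]; apply/hullP.
exists (fun i => t * l i + (1 - t) * k i); split.
- by move=> i; rewrite addr_ge0// mulr_ge0// subr_ge0.
- by rewrite big_split /= -!mulr_sumr l1 k1; ring.
- by rewrite !scaler_sumr -big_split; apply: eq_bigr => i _; rewrite [RHS]scalerDl !scalerA.
Qed.

Lemma hull_row n d (G : 'M[R]_(n, d)) k : hull G (row k G).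
Proof.
apply/hullP; exists (fun i => (i == k)%:R); split=> //.
  by rewrite (bigD1 k)//= eqxx big1 ?addr0// => i /negPf ->.
by rewrite (bigD1 k)//= eqxx scale1r big1 ?addr0// => i /negPf ->; rewrite scale0r.
Qed.

Lemma convex_hull_rows n d (G : 'M[R]_(n, d)) : convex_hull (rows G) = hull G.
Proof.
apply/seteqP; split.
  apply: convex_hull_min => [x y t|_ [k _ <-]]; first exact: hull_convex.
  exact: hull_row.
move=> _ /hullP[l [l0 l1 ->]]; apply: convex_hull_sum => // i _.
by apply: sub_convex_hull; exists i.
Qed.

Lemma finite_rows d (S : set 'rV[R]_d) : finite_set S -> exists n (G : 'M[R]_(n, d)), S = rows G.
Proof.
move=> /finite_seqP[s ->]; exists (size s), (\matrix_(i < size s) nth 0 s i).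
apply/seteqP; split=> x /=.
  move=> xs; have i : (index x s < size s)%N by rewrite index_mem.
  by exists (Ordinal i) => //; rewrite rowK nth_index.
by move=> [k _ <-]; rewrite rowK mem_nth.
Qed.

Lemma finite_set_rows n d (G : 'M[R]_(n, d)) : finite_set (rows G).
Proof. by apply: finite_image; exact: finite_finset. Qed.
End Hull.

Section Simplex.
Context {R : realType} {d : nat}.
Implicit Types (V : 'M[R]_(1 + d, d)) (x v : 'rV[R]_d) (E : 'M[R]_d).

Definition bary V x : 'rV[R]_(1 + d) := homog x *m invmx (homog V).

Definition open_hull V : set 'rV[R]_d := [set x | forall j, 0 < bary V x ord0 j].

Lemma hull_simplex V x : homog V \in unitmx ->
  hull V x <-> forall j, 0 <= bary V x ord0 j.
Proof.
move=> Vu; have E (l : 'I_(1 + d) -> R) :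
    \sum_k l k *: row k (homog V) = (\row_k l k) *m homog V.
  by rewrite mulmx_sum_row; apply: eq_bigr => k _; rewrite mxE.
split=> [[l l0 xE] j|b0]; first by rewrite /bary xE E mulmxK// mxE.
exists (fun j => bary V x ord0 j) => //.
rewrite E (_ : \row_k _ = bary V x) ?mulmxKV//.
by apply/rowP => j; rewrite mxE.
Qed.

Lemma const_mx11 : const_mx 1 = 1%:M :> 'M[R]_1.
Proof. by apply/matrixP => i k; rewrite !mxE !ord1. Qed.

Lemma baryE V x j : bary V x ord0 j =
  (x *m dsubmx (col j (invmx (homog V)))) ord0 ord0 + usubmx (col j (invmx (homog V))) ord0 ord0.
Proof.
have -> : bary V x ord0 j = (homog x *m col j (invmx (homog V))) ord0 ord0.
  by rewrite /bary mxE [RHS]mxE; apply: eq_bigr => k _; rewrite [col _ _ _ _]mxE.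
by rewrite -{1}[col j _]vsubmxK mul_row_col mxE addrC const_mx11 mul1mx.
Qed.

Lemma bary_row V k : homog V \in unitmx -> bary V (row k V) = delta_mx ord0 k.
Proof.
by move=> Vu; rewrite /bary -row_homog -row_mul mulmxV// row1.
Qed.

Lemma rmeasurable_bary V j (A : set (measurableTypeR R)) : measurable A ->
  rmeasurable [set x | A (bary V x ord0 j)].
Proof.
move=> mA; set c := usubmx (col j (invmx (homog V))) ord0 ord0.
pose f (t : measurableTypeR R) : measurableTypeR R := t + c.
have mf : measurable_fun setT f by apply: measurable_funD.
have mB : measurable (f @^-1` A) by rewrite -[X in measurable X]setTI; exact: mf.
have := rmeasurable_linear (dsubmx (col j (invmx (homog V)))) mB.
by congr rmeasurable; apply/funext => x /=; rewrite baryE.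
Qed.

Lemma rmeasurable_open_hull V : rmeasurable (open_hull V).
Proof.
apply: rmeasurable_fin_bigcap => j.
have := @rmeasurable_bary V j `]0, +oo[%classic (measurable_itv _).
by congr rmeasurable; apply/funext => x /=; rewrite in_itv/= andbT.
Qed.

Lemma rmeasurable_simplex V : homog V \in unitmx -> rmeasurable (hull V).
Proof.
move=> Vu; rewrite (_ : hull V = [set x | forall j, 0 <= bary V x ord0 j]); last first.
  by apply/seteqP; split => x /(hull_simplex _ Vu).
apply: rmeasurable_fin_bigcap => j.
have := @rmeasurable_bary V j `[0, +oo[%classic (measurable_itv _).
by congr rmeasurable; apply/funext => x /=; rewrite in_itv/= andbT.
Qed.

Lemma rmeasurable_facet V j : rmeasurable [set x | bary V x ord0 j = 0].
Proof. exact: (@rmeasurable_bary V j [set 0] (measurable_set1 _)). Qed.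

Lemma vol_facet V j : homog V \in unitmx -> vol [set x | bary V x ord0 j = 0] = 0%E.
Proof.
move=> Vu; have [w0|w0] := eqVneq (dsubmx (col j (invmx (homog V)))) 0; last first.
  rewrite -[RHS](vol_hyperplane (- (usubmx (col j (invmx (homog V))) ord0 ord0)) w0).
  by congr vol; apply/seteqP; split => x /=; rewrite baryE => H; lra.
rewrite -(vol0 d); congr vol; apply/seteqP; split => // x /=.
have := congr1 (fun u : 'rV_(1 + d) => u ord0 j) (bary_row j Vu).
rewrite !baryE !w0 !mulmx0 !mxE !eqxx /=; lra.
Qed.

Definition edges V : 'M[R]_d := dsubmx V - const_mx 1 *m usubmx V.

Lemma homogE V : homog V = block_mx 1%:M 0 (const_mx 1) 1%:M *m
  block_mx 1%:M (usubmx V) 0 (edges V).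
Proof.
rewrite mulmx_block !mul1mx !mulmx0 !mulmx1 !mul0mx !addr0 /edges.
rewrite addrC subrK /homog -{1}[V]vsubmxK.
have -> : const_mx 1 = col_mx 1%:M (const_mx 1) :> 'M[R]_(1 + d, 1).
  by rewrite -col_mx_const const_mx11.
by rewrite -block_mxEh.
Qed.

Lemma det_homog V : \det (homog V) = \det (edges V).
Proof. by rewrite homogE det_mulmx det_lblock det_ublock !det1 !mul1r. Qed.

Lemma bary_affine_map V (y : 'rV[R]_d) : homog V \in unitmx ->
  bary V (affine_map (edges V) (usubmx V) y) = row_mx (const_mx (1 - \sum_i y ord0 i)) y.
Proof.
move=> Vu.
rewrite /bary (_ : homog _ = row_mx (const_mx (1 - \sum_i y ord0 i)) y *m homog V) ?mulmxK//.
rewrite homogE mulmxA !mul_row_block !mulmx1 !mulmx0 !add0r addr0.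
have -> : const_mx (1 - \sum_i y ord0 i) + y *m const_mx 1 = 1%:M.
  apply/matrixP => i k; rewrite !mxE !ord1 eqxx.
  rewrite -[RHS](subrK (\sum_i y ord0 i)) mulr1n; congr (_ + _).
  by apply: eq_bigr => j _; rewrite mxE mulr1.
by rewrite mul1mx /homog /affine_map const_mx11 addrC.
Qed.

Lemma open_hull_image V : homog V \in unitmx ->
  open_hull V = affine_map (edges V) (usubmx V) @` @open_simplex R d.
Proof.
move=> Vu; have Eu : edges V \in unitmx by move: Vu; rewrite !unitmxE det_homog.
have bE y := bary_affine_map y Vu.
have iffE y : open_hull V (affine_map (edges V) (usubmx V) y) <-> open_simplex y.
  rewrite /open_hull /open_simplex /= bE; split=> [H|[y0 y1] j].
    split=> [i|]; first by have := H (rshift 1 i); rewrite row_mxEr.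
    by have := H (lshift d ord0); rewrite row_mxEl mxE subr_gt0.
  case: (split_ordP j) => i ->; last by rewrite row_mxEr.
  by rewrite row_mxEl mxE subr_gt0.
apply/seteqP; split => [x|_ [y /iffE ? <-]//].
have -> : x = affine_map (edges V) (usubmx V) ((x - usubmx V) *m invmx (edges V)).
  by rewrite /affine_map mulmxKV// subrK.
by move=> /iffE ?; eexists; first eassumption.
Qed.

Lemma vol_open_hull V : homog V \in unitmx ->
  vol (open_hull V) = (`|\det (homog V)| / d`!%:R)%:E.
Proof.
move=> Vu; have Eu : edges V \in unitmx by move: Vu; rewrite !unitmxE det_homog.
rewrite open_hull_image// vol_image ?vol_open_simplex ?det_homog//.
exact: rmeasurable_open_simplex.
Qed.

Lemma vol_simplex V : homog V \in unitmx ->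
  vol (hull V) = (`|\det (homog V)| / d`!%:R)%:E.
Proof.
move=> Vu; rewrite -vol_open_hull//.
pose Z := [set x | exists2 j : 'I_(1 + d), true & bary V x ord0 j = 0].
have mZ : rmeasurable Z by apply: rmeasurable_fin_bigcup => j _; exact: rmeasurable_facet.
have Z0 : vol Z = 0%E.
  by apply: vol_negligible_bigcup => j _; [exact: rmeasurable_facet|exact: vol_facet].
apply/eqP; rewrite eq_le; apply/andP; split; last first.
  apply: vol_le; [exact: rmeasurable_open_hull|exact: rmeasurable_simplex|].
  by move=> x ox; apply/hull_simplex => // j; exact: ltW.
rewrite -(vol_negligibleU (rmeasurable_open_hull V) mZ Z0); apply: vol_le.
- exact: rmeasurable_simplex.
- exact: rmeasurableU (rmeasurable_open_hull V) mZ.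
- move=> x /(hull_simplex _ Vu) b0.
  have [/existsP[j /eqP bj]|/existsPn n] := boolP [exists j, bary V x ord0 j == 0].
    by right; exists j.
  by left=> j; rewrite lt_neqAle eq_sym n b0.
Qed.
End Simplex.

Section Triangulation.
Context {R : realType} {n d : nat} (G : 'M[R]_(n, d)).
Implicit Types s t : {ffun 'I_(1 + d) -> 'I_n}.
Local Notation H := (homog G).

Lemma coords_bary s x : coords H s (homog x) = bary (rowsub s G) x.
Proof. by rewrite /coords rowsub_homog. Qed.

Lemma is_basisE s : is_basis H s = (homog (rowsub s G) \in unitmx).
Proof. by rewrite /is_basis rowsub_homog. Qed.

Lemma hull_rowsub s : hull (rowsub s G) `<=` hull G.
Proof.
rewrite -!convex_hull_rows; apply: convex_hull_mono => _ [k _ <-].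
apply: sub_convex_hull; exists (s k) => //; by apply/rowP => j; rewrite !mxE.
Qed.

Lemma open_hull_sub s : is_basis H s -> open_hull (rowsub s G) `<=` hull G.
Proof.
move=> bs x ox; apply: (@hull_rowsub s); apply/hull_simplex; first by rewrite -is_basisE.
by move=> j; exact: ltW.
Qed.

Variable s0 : {ffun 'I_(1 + d) -> 'I_n}.
Hypothesis bs0 : is_basis H s0.

Lemma caratheodory x : hull G x ->
  exists2 s, is_basis H s & forall j, 0 <= coords H s (homog x) ord0 j.
Proof. by move=> [l l0 ->]; exact: conic_caratheodory bs0 l0. Qed.

Lemma rmeasurable_hull : rmeasurable (hull G).
Proof.
rewrite (_ : hull G = [set x | exists2 s, is_basis H s & hull (rowsub s G) x]); last first.
  apply/seteqP; split => [x /caratheodory[s bs sx]|x [s _]]; last exact: hull_rowsub.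
  exists s => //; apply/hull_simplex; first by rewrite -is_basisE.
  by move=> j; rewrite -coords_bary.
apply: rmeasurable_fin_bigcup => s bs; apply: rmeasurable_simplex.
by rewrite -is_basisE.
Qed.

(* The lower bases for generic weights are the cells of a regular triangulation; cells with
   the same vertex set are counted once. *)
Lemma vol_hull_triangulation : exists T : pred {ffun 'I_(1 + d) -> 'I_n},
  (forall s, T s -> is_basis H s) /\
  vol (hull G) = (\sum_(s | T s) (`|\det (homog (rowsub s G))| / d`!%:R)%:E)%E.
Proof.
have [w gen] := exists_generic H.
pose low s := is_basis H s && is_lower H w s.
(* The result of [pick] depends on [s] only through its vertex set, so one ordering of each cell is
   selected. *)
pose T s := low s && ([pick t | low t && (basis_set t == basis_set s)] == Some s).
exists T; have Tbasis s : T s -> is_basis H s by move=> /andP[/andP[]].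
split=> //.
(* Off this null set no coordinate in any basis is zero, as [exists_lower] requires. *)
pose Z := [set x | exists2 sj : {ffun 'I_(1 + d) -> 'I_n} * 'I_(1 + d), is_basis H sj.1 &
  bary (rowsub sj.1 G) x ord0 sj.2 = 0].
have mZ : rmeasurable Z by apply: rmeasurable_fin_bigcup => j _; exact: rmeasurable_facet.
have Z0 : vol Z = 0%E.
  apply: vol_negligible_bigcup => -[s j] /= bs; first exact: rmeasurable_facet.
  by apply: vol_facet; rewrite -is_basisE.
pose U := [set x | exists2 s, T s & open_hull (rowsub s G) x].
have mU : rmeasurable U by apply: rmeasurable_fin_bigcup => s _; exact: rmeasurable_open_hull.
have -> : vol (hull G) = vol U.
  apply/eqP; rewrite eq_le; apply/andP; split; last first.
    apply: vol_le => //; first exact: rmeasurable_hull.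
    by move=> x [s /Tbasis bs]; exact: open_hull_sub.
  rewrite -(vol_negligibleU mU mZ Z0); apply: vol_le; first exact: rmeasurable_hull.
    exact: rmeasurableU.
  move=> x /caratheodory xs; have [|nZ] := pselect (Z x); [by right|left].
  have [s [bs ls sx]] : exists s, [/\ is_basis H s, is_lower H w s &
      forall j, 0 < coords H s (homog x) ord0 j].
    apply: (exists_lower w (homog_mulmx G)) => // s j bs; rewrite coords_bary.
    by apply/eqP => e; apply: nZ; exists (s, j).
  have lows : low s by rewrite /low bs.
  case ps : [pick t | low t && (basis_set t == basis_set s)] => [t|]; last first.
    by move: ps; case: pickP => // /(_ s); rewrite lows eqxx.
  have /andP[lt /eqP ts] : low t && (basis_set t == basis_set s).
    by move: ps; case: pickP => // t' H' [<-].
  exists t; first by rewrite /T lt ts ps eqxx.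
  move=> j; rewrite -coords_bary.
  by apply: (coords_basis_set_gt0 bs _ (esym ts) sx); case/andP: lt.
rewrite vol_disjoint_bigcup.
- by apply: eq_bigr => s /Tbasis; rewrite is_basisE => /vol_open_hull.
- by move=> s _; exact: rmeasurable_open_hull.
move=> s t x Ts Tt sx tx.
move: Ts Tt => /andP[/andP[bs ls] /eqP ps] /andP[/andP[bt lt] /eqP pt].
have e : basis_set s = basis_set t.
  apply: (lower_basis_set gen bs ls (y := homog x)) => // j; rewrite coords_bary.
  - exact: sx.
  - exact: tx.
by apply: Some_inj; rewrite -ps -pt e.
Qed.
End Triangulation.

Section FullDimension.
Context {R : realType} {d : nat}.
Implicit Types (S P : set 'rV[R]_d) (E : 'M[R]_d).

(** A column killed by [homog G] is an affine form vanishing on the rows of [G], hence on their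
    affine hull, which is the whole space; so it is zero and [homog G] has full column rank. *)
Lemma full_dim_basis n (G : 'M[R]_(n, d)) : full_dimensional (hull G) ->
  exists s : {ffun 'I_(1 + d) -> 'I_n}, is_basis (homog G) s.
Proof.
move=> fd; have [Gf|] := boolP (row_full (homog G)).
  exists [ffun i => fullrankfun Gf i]; rewrite /is_basis.
  rewrite (_ : rowsub _ _ = rowsub (fullrankfun Gf) (homog G)) ?fullrowsub_unit//.
  by apply/matrixP => i j; rewrite !mxE ffunE.
rewrite -cokermx_eq0 => /eqP ck.
exfalso; apply: ck; apply/matrixP => i j.
set w := col j (cokermx (homog G)).
have wG : homog G *m w = 0.
  by rewrite /w colE mulmxA mulmx_coker mul0mx.
have all_w (x : 'rV[R]_d) : homog x *m w = 0.
  have : affine_hull (hull G) x by rewrite fd.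
  move=> /(_ [set x | homog x *m w = 0]); apply; split.
    move=> u v t uw vw /=.
    have -> : homog (t *: u + (1 - t) *: v) = t *: homog u + (1 - t) *: homog v.
      rewrite /homog !scale_row_mx add_row_mx; congr row_mx.
      by apply/matrixP => a b; rewrite !mxE; ring.
    by rewrite mulmxDl -!scalemxAl uw vw !scaler0 addr0.
  move=> u [l _ uE] /=; rewrite uE mulmx_suml big1// => k _.
  by rewrite -scalemxAl -row_mul wG row0 scaler0.
have w1 : usubmx w = 0.
  by have := all_w 0; rewrite -{1}[w]vsubmxK mul_row_col mul0mx addr0 const_mx11 mul1mx.
have w2 : dsubmx w = 0.
  apply/row_matrixP => k; have := all_w (delta_mx ord0 k).
  by rewrite -{1}[w]vsubmxK mul_row_col w1 mulmx0 add0r -rowE row0.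
have : w = 0 by rewrite -[w]vsubmxK w1 w2 col_mx0.
by move=> /(congr1 (fun u : 'cV_(1 + d) => u i ord0)); rewrite !mxE.
Qed.

Lemma full_dim_simplex S v E : E \in unitmx -> S v -> (forall i, S (v + row i E)) ->
  full_dimensional S.
Proof.
move=> Eu Sv SE; apply/seteqP; split => // x _ C [aC SC].
suff main y : C (v + y *m E) by have := main ((x - v) *m invmx E); rewrite mulmxKV// addrC subrK.
have scal t z : C (v + z *m E) -> C (v + (t *: z) *m E).
  move=> Cz; have := aC _ _ t Cz (SC _ Sv); congr C.
  by apply/rowP => k; rewrite -scalemxAl !mxE; ring.
(* Affine sets admit only combinations of total weight one, so a sum is reached as twice a
   midpoint. *)
have add u z : C (v + u *m E) -> C (v + z *m E) -> C (v + (u + z) *m E).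
  move=> Cu Cz; have := scal 2 (2^-1 *: (u + z)).
  rewrite scalerA divff// scale1r; apply.
  have := aC _ _ 2^-1 Cu Cz; congr C.
  by rewrite -scalemxAl mulmxDl; apply/rowP => k; rewrite !mxE; field.
rewrite [y]row_sum_delta; elim/big_rec: _ => [|i z _ Cz].
  by rewrite mul0mx addr0; exact: SC.
apply: add => //; apply: scal; rewrite -rowE; exact/SC/SE.
Qed.

Lemma full_dim_sub S P : S `<=` P -> full_dimensional S -> full_dimensional P.
Proof.
move=> SP fS; apply/seteqP; split => // x _ C [aC PC].
have : affine_hull S x by rewrite fS.
by apply; split=> // y /SP; exact: PC.
Qed.

Lemma full_dim_image S E b : E \in unitmx -> full_dimensional S ->
  full_dimensional (affine_map E b @` S).
Proof.
move=> Eu fS; apply/seteqP; split => // x _ C [aC SC].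
have : affine_hull S ((x - b) *m invmx E) by rewrite fS.
suff H : affine_hull S `<=` [set y | C (affine_map E b y)].
  by move=> /H /=; rewrite /affine_map mulmxKV// subrK.
apply: smallest_sub => [y z t Cy Cz /=|y Sy /=]; last by apply: SC; exists y.
have := aC _ _ t Cy Cz; congr C.
by rewrite /affine_map mulmxDl -!scalemxAl; apply/rowP => k; rewrite !mxE; ring.
Qed.

Lemma convex_hull_image S E b :
  convex_hull (affine_map E b @` S) = affine_map E b @` convex_hull S.
Proof.
have aE x y t : affine_map E b (t *: x + (1 - t) *: y) =
    t *: affine_map E b x + (1 - t) *: affine_map E b y.
  by rewrite /affine_map mulmxDl -!scalemxAl; apply/rowP => k; rewrite !mxE; ring.
apply/seteqP; split.
  apply: convex_hull_min => [_ _ t t0 t1 [x Sx <-] [y Sy <-]|_ [x Sx <-]].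
    by exists (t *: x + (1 - t) *: y) => //; exact: convex_hull_convex.
  by exists x => //; exact: sub_convex_hull.
suff H : convex_hull S `<=` [set y | convex_hull (affine_map E b @` S) (affine_map E b y)].
  by move=> _ [x Sx <-]; exact: H.
apply: convex_hull_min => [x y t t0 t1 Sx Sy /=|y Sy /=].
  by rewrite aE; exact: convex_hull_convex.
by apply: sub_convex_hull; exists y.
Qed.

End FullDimension.

Section LatticeVolume.
Context {R : realType} {d : nat}.
Implicit Types (P : set 'rV[R]_d).

Definition int_mx {m n} (M : 'M[R]_(m, n)) : Prop := forall i j, M i j \is a Num.int.

Lemma det_int n (M : 'M[R]_n) : int_mx M -> \det M \is a Num.int.
Proof.
move=> Mi; rewrite /determinant rpred_sum// => s _.
by rewrite rpredM ?rpredX ?rpredN ?rpred1// rpred_prod.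
Qed.

Lemma int_mx_homog n (G : 'M[R]_(n, d)) : int_mx G -> int_mx (homog G).
Proof.
move=> Gi i j; case: (split_ordP j) => k ->; last by rewrite row_mxEr.
by rewrite row_mxEl mxE rpred1.
Qed.

Lemma lattice_polytope_hull P : lattice_polytope P ->
  exists n (G : 'M[R]_(n, d)) (s : {ffun 'I_(1 + d) -> 'I_n}),
    [/\ int_mx G, P = hull G & is_basis (homog G) s].
Proof.
move=> [fP [S [/finite_rows[n [G SG]] Si PE]]].
have PG : P = hull G by rewrite PE SG convex_hull_rows.
have [s bs] := full_dim_basis (eq_ind _ _ fP _ PG).
exists n, G, s; split=> // i j.
have := Si (row i G) _ j; rewrite mxE; apply.
by rewrite SG; exists i.
Qed.

Lemma rmeasurable_lattice_polytope P : lattice_polytope P -> rmeasurable P.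
Proof. by move=> /lattice_polytope_hull[n [G [s [_ -> bs]]]]; exact: rmeasurable_hull bs. Qed.

Lemma simplex_vol_le n (G : 'M[R]_(n, d)) s : is_basis (homog G) s ->
  ((`|\det (homog (rowsub s G))| / d`!%:R)%:E <= vol (hull G))%E.
Proof.
move=> bs; rewrite -vol_simplex -?is_basisE//; apply: vol_le.
- by apply: rmeasurable_simplex; rewrite -is_basisE.
- exact: rmeasurable_hull bs.
- exact: hull_rowsub.
Qed.

Lemma lattice_polytope_vol P : lattice_polytope P ->
  exists2 N : nat, (0 < N)%N & vol P = (N%:R / d`!%:R)%:E.
Proof.
move=> /lattice_polytope_hull[n [G [s [Gi -> bs]]]].
have [T [Tb volE]] := vol_hull_triangulation bs.
have nat_det (t : {ffun 'I_(1 + d) -> 'I_n}) : exists N : nat, `|\det (homog (rowsub t G))| = N%:R :> R.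
  have : \det (homog (rowsub t G)) \is a Num.int.
    by apply: det_int; apply: int_mx_homog => i j; rewrite mxE.
  by move=> /natr_norm_int/natrP.
have [f fE] := fin_all_exists nat_det.
have vE : vol (hull G) = ((\sum_(t | T t) f t)%:R / d`!%:R)%:E.
  rewrite volE natr_sum mulr_suml -sumEFin.
  by apply: eq_bigr => t _; rewrite fE.
exists (\sum_(t | T t) f t)%N => //.
have := simplex_vol_le bs; rewrite vE lee_fin lt0n => H; apply: contraTneq H => ->.
rewrite mul0r -ltNge divr_gt0 ?ltr0n ?fact_gt0// normr_gt0 -unitfE.
by move: bs; rewrite is_basisE unitmxE.
Qed.
End LatticeVolume.

(** * Gluing a simplex to a convex hull *)

Section Stacking.
Context {R : realType} {d : nat}.
Implicit Types (S P Q : set 'rV[R]_d) (A : 'M[R]_d).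

Lemma vol_almost_disjointU P Q : rmeasurable P -> rmeasurable Q ->
  vol (P `&` Q) = 0%E -> vol (P `|` Q) = (vol P + vol Q)%E.
Proof.
move=> mP mQ PQ0; have mD : rmeasurable (Q `\` P) by exact: rmeasurableD.
have -> : P `|` Q = P `|` (Q `\` P) by rewrite setDE setUIr setUv setIT.
rewrite vol_disjointU//; last exact: setDIK.
congr (_ + _)%E; rewrite -(vol_negligibleU mD (rmeasurableI mP mQ) PQ0); congr vol.
apply/seteqP; split => x; first by move=> [[]//|[]].
by move=> Qx; have [Px|nPx] := pselect (P x); [right|left].
Qed.

(* A point seeing [S] through a single simplex only adds that simplex to the convex hull. *)
Lemma stack_decomposition S s0 v A : S s0 -> A - const_mx 1 *m v \in unitmx ->
  (forall i, convex_hull S (row i A)) ->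
  (forall x, S x -> exists a : 'rV[R]_d,
     [/\ forall i, 0 <= a ord0 i, 1 <= \sum_i a ord0 i & x = a *m (A - const_mx 1 *m v) + v]) ->
  convex_hull (v |` S) = convex_hull S `|` hull (col_mx v A) /\
  convex_hull S `&` hull (col_mx v A) `<=` [set x | bary (col_mx v A) x ord0 ord0 = 0].
Proof.
set E := A - _ => Ss0 Eu SA Scone.
set V := col_mx v A.
have VE : edges V = E by rewrite /edges col_mxKd col_mxKu.
have Vv : usubmx V = v by rewrite col_mxKu.
have Vu : homog V \in unitmx by rewrite unitmxE det_homog VE -unitmxE.
have Hcone x : convex_hull S x -> exists a : 'rV[R]_d,
     [/\ forall i, 0 <= a ord0 i, 1 <= \sum_i a ord0 i & x = a *m E + v].
  move: x; apply: convex_hull_min => [x y t t0 t1 [a [a0 a1 ->]] [b [b0 b1 ->]]|]; last exact: Scone.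
  exists (t *: a + (1 - t) *: b); split.
  - by move=> i; rewrite !mxE addr_ge0// mulr_ge0// subr_ge0.
  - under eq_bigr do rewrite !mxE.
    rewrite big_split /= -!mulr_sumr; nra.
  - by rewrite mulmxDl -!scalemxAl; apply/rowP => k; rewrite !mxE; ring.
have bE (y : 'rV[R]_d) : bary V (y *m E + v) = row_mx (const_mx (1 - \sum_i y ord0 i)) y.
  by rewrite -(bary_affine_map y Vu) /affine_map VE Vv.
split; last first.
  move=> x [/Hcone[a [a0 a1 ->]] /(hull_simplex _ Vu) /(_ ord0)] /=.
  rewrite bE; have -> : ord0 = lshift d ord0 :> 'I_(1 + d) by exact/val_inj.
  by rewrite row_mxEl mxE; lra.
apply/seteqP; split; last first.
  move=> x [|]; first by apply: convex_hull_mono => y Sy; apply: sub_convex_hull; right.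
  rewrite -convex_hull_rows; apply: convex_hull_mono => _ [k _ <-].
  case: (split_ordP k) => i ->.
    by apply: sub_convex_hull; left; rewrite /V rowKu ord1; apply/rowP => j; rewrite mxE.
  rewrite /V rowKd; have := SA i; apply: convex_hull_mono => y Sy.
  by apply: sub_convex_hull; right.
have key : convex_hull (v |` S) `<=`
    [set x | exists s t, [/\ convex_hull S s, 0 <= t, t <= 1 & x = t *: v + (1 - t) *: s]].
  apply: convex_hull_min => [_ _ u u0 u1 [s [t [Ss t0 t1 ->]]] [s' [t' [Ss' t0' t1' ->]]]|x].
    set T := u * t + (1 - u) * t'.
    have T0 : 0 <= T by rewrite addr_ge0// mulr_ge0// subr_ge0.
    have T1 : T <= 1 by rewrite /T; nra.
    have [Te|Tn] := eqVneq T 1.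
      exists s0, 1; split=> //; first exact: sub_convex_hull.
      have e1 : u * (1 - t) = 0 by rewrite /T in Te; nra.
      have e2 : (1 - u) * (1 - t') = 0 by rewrite /T in Te; nra.
      rewrite subrr scale0r addr0 !scalerDr !scalerA e1 e2 !scale0r !addr0 -scalerDl.
      by rewrite -/T Te.
    have T1' : 0 < 1 - T by rewrite subr_gt0 lt_neqAle Tn.
    exists ((u * (1 - t) / (1 - T)) *: s + (1 - u * (1 - t) / (1 - T)) *: s'), T; split => //.
      apply: convex_hull_convex => //.
        by rewrite divr_ge0 ?mulr_ge0 ?subr_ge0// ltW.
      by rewrite ler_pdivrMr// mul1r /T; nra.
    apply/rowP => k; rewrite !mxE; move: T1'; rewrite /T => T1'; field.
    by rewrite gt_eqF.
  move=> [->|Sx].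
    exists s0, 1; split=> //; first exact: sub_convex_hull.
    by rewrite subrr scale0r addr0 scale1r.
  exists x, 0; split=> //; first exact: sub_convex_hull.
  by rewrite scale0r add0r subr0 scale1r.
move=> x /key[s [t [Ss t0 t1 ->]]].
have [a [a0 a1 sE]] := Hcone s Ss.
have xE : t *: v + (1 - t) *: s = ((1 - t) *: a) *m E + v.
  by rewrite sE -scalemxAl; apply/rowP => k; rewrite !mxE; ring.
set W := \sum_i a ord0 i in a1.
(* The coordinate sum of the point is [(1 - t) * W], and the facet spanned by the rows of [A] is
   where it equals 1. Up to there the point lies in the simplex; beyond, it lies between the
   crossing point [z] and [s]. *)
have [tW|tW] := leP ((1 - t) * W) 1.
  right; apply/hull_simplex => // j; rewrite xE bE.
  case: (split_ordP j) => i ->; last by rewrite row_mxEr mxE mulr_ge0// subr_ge0.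
  rewrite row_mxEl mxE; under eq_bigr do rewrite mxE.
  by rewrite -mulr_sumr subr_ge0.
left; have W1 : 1 < W by nra.
have W0 : W != 0 by rewrite gt_eqF// (lt_trans ltr01).
pose z := (W^-1 *: a) *m E + v.
have Sz : convex_hull S z.
  have -> : z = \sum_i (a ord0 i / W) *: row i A.
    rewrite /z /E mulmxBr mulmxA.
    have -> : (W^-1 *: a) *m const_mx 1 = 1%:M :> 'M[R]_1.
      apply/matrixP => i k; rewrite !ord1 -scalemxAl !mxE eqxx.
      rewrite (_ : \sum_j _ = W) ?mulVf//.
      by apply: eq_bigr => j _; rewrite [const_mx _ _ _]mxE mulr1.
    rewrite mul1mx subrK mulmx_sum_row; apply: eq_bigr => i _.
    by rewrite mxE mulrC.
  apply: convex_hull_sum => [i||i _]; last exact: SA.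
    by rewrite divr_ge0// ltW// (lt_trans ltr01).
  by rewrite -mulr_suml divff.
pose th := ((1 - t) * W - 1) / (W - 1).
have -> : t *: v + (1 - t) *: s = th *: s + (1 - th) *: z.
  rewrite xE sE /z /th -!scalemxAl; apply/rowP => k; rewrite !mxE; field.
  by rewrite W0 subr_eq0 gt_eqF.
apply: convex_hull_convex => //.
  by apply: divr_ge0; rewrite subr_ge0 ltW.
by rewrite /th ler_pdivrMr ?subr_gt0// mul1r; nra.
Qed.

End Stacking.

(** * Primitive polytopes and counting of classes *)

Section IntegerMatrices.
Context {R : realType}.

Lemma int_mxM m n p (A : 'M[R]_(m, n)) (B : 'M[R]_(n, p)) :
  int_mx A -> int_mx B -> int_mx (A *m B).
Proof. by move=> Ai Bi i j; rewrite mxE rpred_sum// => k _; rewrite rpredM. Qed.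

Lemma int_mxD m n (A B : 'M[R]_(m, n)) : int_mx A -> int_mx B -> int_mx (A + B).
Proof. by move=> Ai Bi i j; rewrite mxE rpredD. Qed.

Lemma int_mxN m n (A : 'M[R]_(m, n)) : int_mx A -> int_mx (- A).
Proof. by move=> Ai i j; rewrite mxE rpredN. Qed.

Lemma int_mxB m n (A B : 'M[R]_(m, n)) : int_mx A -> int_mx B -> int_mx (A - B).
Proof. by move=> Ai Bi; apply: int_mxD => //; exact: int_mxN. Qed.

Lemma int_mxZ m n a (A : 'M[R]_(m, n)) : a \is a Num.int -> int_mx A -> int_mx (a *: A).
Proof. by move=> ai Ai i j; rewrite mxE rpredM. Qed.

Lemma int_mx_scalar n a : a \is a Num.int -> int_mx (a%:M : 'M[R]_n).
Proof. by move=> ai i j; rewrite mxE rpredMn. Qed.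

Lemma int_mx_const m n a : a \is a Num.int -> int_mx (const_mx a : 'M[R]_(m, n)).
Proof. by move=> ai i j; rewrite mxE. Qed.

Lemma int_mx_map m n (A : 'M[int]_(m, n)) : int_mx (map_mx intr A : 'M[R]_(m, n)).
Proof. by move=> i j; rewrite mxE intr_int. Qed.

Lemma int_mx_eq_map m n (A : 'M[R]_(m, n)) : int_mx A ->
  exists B : 'M[int]_(m, n), A = map_mx intr B.
Proof.
move=> Ai; exists (\matrix_(i, j) Num.floor (A i j)); apply/matrixP => i j.
by rewrite !mxE; apply/esym/eqP; rewrite -intrEfloor.
Qed.

Lemma int_mx_adj n (A : 'M[R]_n) : int_mx A -> int_mx (\adj A).
Proof.
move=> Ai i j; rewrite mxE /cofactor rpredM ?rpredX ?rpredN ?rpred1//.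
by apply: det_int => a b; rewrite !mxE.
Qed.

Lemma invmx_adj n (A : 'M[R]_n) : A \in unitmx -> invmx A = (\det A)^-1 *: \adj A.
Proof. by move=> Au; rewrite /invmx Au. Qed.

Lemma int_mx_scaled_inv n (A : 'M[R]_n) : A \in unitmx -> int_mx A ->
  int_mx (`|\det A| *: invmx A).
Proof.
move=> Au Ai; rewrite invmx_adj// scalerA.
have d0 : \det A != 0 by rewrite -unitfE -unitmxE.
have -> : `|\det A| / \det A = Num.sg (\det A) by rewrite normrEsg mulfK.
apply: int_mxZ; last exact: int_mx_adj.
by have [] := sgrP (\det A); rewrite ?rpredN1 ?rpred0 ?rpred1.
Qed.

Lemma unimodular_inv n (A : 'M[R]_n) : int_mx A -> `|\det A| = 1 ->
  A \in unitmx /\ int_mx (invmx A).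
Proof.
move=> Ai A1; have Au : A \in unitmx.
  by rewrite unitmxE unitfE -normr_eq0 A1 oner_eq0.
by split=> //; have := int_mx_scaled_inv Au Ai; rewrite A1 scale1r.
Qed.

(* [U = N^-1 N'] is integral because [N' = N + m E] gives [U = 1 + (m N^-1) E],
   where [m N^-1] is the adjugate of [N] up to sign. *)
Lemma congruent_unimodular n (N N' E : 'M[R]_n) (m : R) : 0 < m ->
  int_mx N -> int_mx E -> `|\det N| = m -> `|\det N'| = m -> N' = N + m *: E ->
  [/\ N \in unitmx, int_mx (invmx N *m N') & `|\det (invmx N *m N')| = 1].
Proof.
move=> m0 Ni Ei dN dN' N'E.
have Nu : N \in unitmx by rewrite unitmxE unitfE -normr_eq0 dN gt_eqF.
split=> //; last by rewrite det_mulmx det_inv normrM normfV dN dN' mulVf// gt_eqF.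
rewrite N'E mulmxDr mulVmx// -scalemxAr scalemxAl.
apply: int_mxD; first exact/int_mx_scalar/rpred1.
by apply: int_mxM => //; rewrite -dN; exact: int_mx_scaled_inv.
Qed.

(** Residues modulo any [m <= V] are stored in ['I_V.+1], so that codes for all [m] share one finite
    type. *)
Lemma residue_mx n (N : 'M[R]_n) (m V : nat) : int_mx N -> (0 < m <= V)%N ->
  exists (r : 'M['I_V.+1]_n) (E : 'M[R]_n),
    int_mx E /\ N = map_mx (fun k : 'I_V.+1 => (k : nat)%:R) r + m%:R *: E.
Proof.
move=> /int_mx_eq_map[B ->] /andP[m0 mV].
have mz : (m : int) != 0 by rewrite -lt0n.
exists (\matrix_(i, j) inord `|(B i j %% m)%Z|%N), (map_mx intr (\matrix_(i, j) (B i j %/ m)%Z)).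
split; first exact: int_mx_map.
apply/matrixP => i j; rewrite !mxE inordK; last first.
  rewrite ltnS (leq_trans _ mV)// ltnW// -ltz_nat gez0_abs ?modz_ge0//.
  by rewrite ltz_pmod.
rewrite natr_absz ger0_norm ?modz_ge0// addrC {1}(divz_eq (B i j) m) rmorphD rmorphM /=.
by rewrite mulrC.
Qed.

End IntegerMatrices.

Section Unimodular.
Context {R : realType} {d : nat}.
Implicit Types (P Q : set 'rV[R]_d) (M : 'M[R]_d) (b : 'rV[R]_d).

Lemma affine_map_comp M b M' b' (P : set 'rV[R]_d) :
  affine_map M' b' @` (affine_map M b @` P) = affine_map (M *m M') (b *m M' + b') @` P.
Proof.
rewrite image_comp; apply: eq_imagel => x _.
by rewrite /affine_map /= mulmxDl mulmxA addrA.
Qed.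

Lemma affine_map_id P : affine_map 1%:M 0 @` P = P.
Proof.
by rewrite -[RHS]image_id; apply: eq_imagel => x _; rewrite /affine_map mulmx1 addr0.
Qed.

Lemma affine_map_inv M b P Q : M \in unitmx -> affine_map M b @` P = Q ->
  affine_map (invmx M) (- (b *m invmx M)) @` Q = P.
Proof. by move=> Mu <-; rewrite affine_map_comp mulmxV// subrr affine_map_id. Qed.

Lemma affinely_equivalent_refl P : affinely_equivalent P P.
Proof. by exists 1%:M, 0; rewrite unitmx1 affine_map_id. Qed.

Lemma affinely_equivalent_sym P Q : affinely_equivalent P Q -> affinely_equivalent Q P.
Proof.
move=> [M [b [Mu /(affine_map_inv Mu) E]]].
by exists (invmx M), (- (b *m invmx M)); rewrite unitmx_inv.
Qed.

Lemma affinely_equivalent_trans P Q S : affinely_equivalent P Q ->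
  affinely_equivalent Q S -> affinely_equivalent P S.
Proof.
move=> [M [b [Mu <-]]] [M' [b' [Mu' <-]]].
by exists (M *m M'), (b *m M' + b'); rewrite unitmx_mul Mu Mu' affine_map_comp.
Qed.

Lemma int_affine_map M b x : int_mx M -> int_mx b -> int_lattice x ->
  int_lattice (affine_map M b x).
Proof.
by move=> Mi bi xi j; apply: int_mxD => //; apply: int_mxM => // i k; rewrite ord1.
Qed.

(** The images of 0 and of the unit vectors show that [b] and [M] are integral; conversely, a
    determinant of absolute value 1 makes the inverse integral as well. *)
Lemma unimodularly_equivalentP P Q : unimodularly_equivalent P Q <->
  exists M b, [/\ int_mx M, int_mx b, `|\det M| = 1 & affine_map M b @` P = Q].
Proof.
split=> [[M [b [dM Mi PQ]]]|[M [b [Mi bi dM PQ]]]]; last first.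
  have [Mu iMi] := unimodular_inv Mi dM.
  exists M, b; split=> //.
    move/eqP: dM; rewrite eqr_norml ler01 andbT => /orP[]/eqP; by [left|right].
  apply/seteqP; split=> [_ [x xi <-]|x xi]; first exact: int_affine_map.
  exists (affine_map (invmx M) (- (b *m invmx M)) x); last first.
    by rewrite /affine_map mulmxDl mulNmx !mulmxKV// subrK.
  by apply: int_affine_map => //; exact/int_mxN/int_mxM.
exists M, b.
have im x : int_lattice x -> int_lattice (affine_map M b x) by rewrite -{2}Mi => xi; exists x.
have bi : int_mx b.
  move=> i j; rewrite ord1; have := im 0 _ j; rewrite /affine_map mul0mx add0r; apply.
  by move=> k; rewrite mxE.
split=> //; last by case: dM => ->; rewrite ?normrN normr1.
move=> i j; have := im (delta_mx ord0 i) _ j.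
rewrite /affine_map -rowE !mxE => H.
rewrite -[M i j](addrK (b ord0 j)) rpredB//; first apply: H => k.
by rewrite mxE rpred_nat.
Qed.

Lemma unimodularly_affinely P Q : unimodularly_equivalent P Q -> affinely_equivalent P Q.
Proof.
move=> /unimodularly_equivalentP[M [b [Mi bi dM PQ]]].
by exists M, b; split=> //; case: (unimodular_inv Mi dM).
Qed.

Lemma unimodularly_equivalent_sym P Q :
  unimodularly_equivalent P Q -> unimodularly_equivalent Q P.
Proof.
move=> /unimodularly_equivalentP[M [b [Mi bi dM PQ]]]; apply/unimodularly_equivalentP.
have [Mu iMi] := unimodular_inv Mi dM.
exists (invmx M), (- (b *m invmx M)); split=> //.
- exact/int_mxN/int_mxM.
- by rewrite det_inv normfV dM invr1.
- exact: affine_map_inv.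
Qed.

Lemma unimodularly_equivalent_trans P Q S : unimodularly_equivalent P Q ->
  unimodularly_equivalent Q S -> unimodularly_equivalent P S.
Proof.
move=> /unimodularly_equivalentP[M [b [Mi bi dM <-]]].
move=> /unimodularly_equivalentP[M' [b' [Mi' bi' dM' <-]]]; apply/unimodularly_equivalentP.
exists (M *m M'), (b *m M' + b'); split.
- exact: int_mxM.
- by apply: int_mxD => //; exact: int_mxM.
- by rewrite det_mulmx normrM dM dM' mulr1.
- by rewrite affine_map_comp.
Qed.

Lemma lattice_polytope_image M b P : M \in unitmx -> int_mx M -> int_mx b ->
  lattice_polytope P -> lattice_polytope (affine_map M b @` P).
Proof.
move=> Mu Mi bi [fP [S [fS Si PE]]]; split; first exact: full_dim_image.
rewrite PE.
exists (affine_map M b @` S); split; first exact: finite_image.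
  by move=> _ [x Sx <-]; apply: int_affine_map => //; exact: Si.
by rewrite convex_hull_image.
Qed.

Lemma vol_lattice_image M b P : M \in unitmx -> lattice_polytope P ->
  vol (affine_map M b @` P) = (`|\det M|%:E * vol P)%E.
Proof. by move=> Mu /rmeasurable_lattice_polytope; exact: vol_image. Qed.

End Unimodular.

(** * Vertices and primitive polytopes *)

Section Irredundant.
Context {R : realType} {d : nat}.

(** The rows are then the extreme points of the hull, each listed once, since a repeated row would
    lie in the hull of the others. *)
Definition irredundant n (G : 'M[R]_(n, d)) : Prop :=
  forall k, ~ hull (row' k G) (row k G).

Lemma row_row' n (G : 'M[R]_(n, d)) k i : row i (row' k G) = row (lift k i) G.
Proof. by apply/rowP => j; rewrite !mxE. Qed.

Lemma hull_row' n (G : 'M[R]_(n, d)) k : hull (row' k G) (row k G) -> hull (row' k G) = hull G.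
Proof.
move=> kG; apply/seteqP; split; rewrite -!convex_hull_rows; apply: convex_hull_mono.
  by move=> _ [i _ <-]; apply: sub_convex_hull; exists (lift k i) => //; rewrite row_row'.
move=> _ [j _ <-]; case: (unliftP k j) => [i ->|->]; last by rewrite convex_hull_rows.
by apply: sub_convex_hull; exists i => //; rewrite row_row'.
Qed.

Lemma exists_irredundant n (G : 'M[R]_(n, d)) : exists n' (G' : 'M[R]_(n', d)),
  [/\ irredundant G', hull G' = hull G & rows G' `<=` rows G].
Proof.
have [m] := ubnP n; elim: m => // m IH in n G *; rewrite ltnS => nm.
have [irr|] := pselect (irredundant G); first by exists n, G; split.
move=> /existsNP[k /contrapT kG].
have lt : (n.-1 < m)%N by case: n k {G IH kG} nm => [[]|].
have [n' [G' [irr hG' rG']]] := IH _ (row' k G) lt.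
exists n', G'; split=> //; first by rewrite hG' hull_row'.
move=> x /rG'[i _ <-]; exists (lift k i) => //; by rewrite row_row'.
Qed.

(** Both representations combine to one of [row k G] with weights [c]. If [c k] is 1, all the weight
    of [x] sits on row [k]; otherwise dropping term [k] and dividing by [1 - c k] puts row [k] in
    the hull of the others. *)
Lemma irredundant_extreme n (G : 'M[R]_(n, d)) k x y (t : R) : irredundant G ->
  0 < t -> t < 1 -> hull G x -> hull G y -> t *: x + (1 - t) *: y = row k G ->
  x = row k G.
Proof.
move=> irr t0 t1 /hullP[l [l0 l1 xE]] /hullP[m [m0 m1 yE]] xyE.
pose c i := t * l i + (1 - t) * m i.
have c0 i : 0 <= c i by rewrite addr_ge0// mulr_ge0// ?subr_ge0 ltW.
have c1 : \sum_i c i = 1 by rewrite big_split /= -!mulr_sumr l1 m1; ring.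
have cE : \sum_i c i *: row i G = row k G.
  rewrite -xyE xE yE !scaler_sumr -big_split; apply: eq_bigr => i _.
  by rewrite [LHS]scalerDl !scalerA.
have le1 (f : 'I_n -> R) : (forall i, 0 <= f i) -> \sum_i f i = 1 -> f k <= 1.
  by move=> f0 <-; rewrite (bigD1 k)//= lerDl sumr_ge0.
have [ck|ck] := eqVneq (c k) 1.
  have lk : l k = 1.
    have := le1 l l0 l1; have := le1 m m0 m1; move: ck; rewrite /c; nra.
  have lz i : i != k -> l i = 0.
    move=> ik; apply/eqP; rewrite eq_le l0 andbT.
    move: l1; rewrite (bigD1 k)//= lk => /eqP; rewrite -subr_eq0 addrAC subrr add0r => /eqP s0.
    by rewrite -s0 (bigD1 i)//= lerDl sumr_ge0.
  rewrite xE (bigD1 k)//= lk scale1r big1 ?addr0// => i ik.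
  by rewrite lz// scale0r.
exfalso; apply: (irr k); rewrite -convex_hull_rows.
have ck1 : 0 < 1 - c k by rewrite subr_gt0 lt_neqAle ck le1.
have -> : row k G = \sum_i (if i == k then 0 else c i / (1 - c k)) *: row i G.
  have ck0 : 1 - c k != 0 by rewrite gt_eqF.
  apply: (scalerI ck0).
  rewrite scalerBl scale1r -{1}cE (bigD1 k)//= addrAC subrr add0r scaler_sumr.
  rewrite [RHS](bigD1 k)//= eqxx scale0r scaler0 add0r; apply: eq_bigr => i /negPf ->.
  by rewrite scalerA mulrC divfK// gt_eqF.
apply: convex_hull_sum.
- by move=> i; case: ifP => // _; rewrite divr_ge0// ltW.
- rewrite (bigD1 k)//= eqxx add0r (eq_bigr (fun i => c i / (1 - c k))); last first.
    by move=> i /negPf ->.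
  rewrite -mulr_suml; move: c1; rewrite (bigD1 k)//=; set X := \sum_(i | _) c i => c1.
  have -> : X = 1 - c k by lra.
  by rewrite divff// gt_eqF.
- move=> i; case: (eqVneq i k) => [_ /negP//|ik _].
  case: (unliftP k i) ik => [j ->|->]; last by rewrite eqxx.
  by move=> _; apply: sub_convex_hull; exists j => //; rewrite row_row'.
Qed.

(* Removing an extreme point leaves a convex set, so every generating set contains all
   extreme points. *)
Lemma irredundant_sub n (G : 'M[R]_(n, d)) (S : set 'rV[R]_d) : irredundant G ->
  convex_hull S = hull G -> rows G `<=` S.
Proof.
move=> irr SG _ [k _ <-]; apply: contrapT => nS.
have : convex_hull S (row k G) by rewrite SG; exact: hull_row.
suff : convex_hull S `<=` [set x | hull G x /\ x <> row k G] by move=> H /H[].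
apply: convex_hull_min => [x y t t0 t1 [Gx xk] [Gy yk]|x Sx]; last first.
  by split; [rewrite -SG; exact: sub_convex_hull|move=> xk; apply: nS; rewrite -xk].
split; first exact: hull_convex.
have [->|tn0] := eqVneq t 0; first by rewrite scale0r add0r subr0 scale1r.
have [->|tn1] := eqVneq t 1; first by rewrite subrr scale0r addr0 scale1r.
move=> E; apply: xk; apply: (irredundant_extreme irr _ _ Gx Gy E).
  by rewrite lt_neqAle eq_sym tn0.
by rewrite lt_neqAle tn1.
Qed.

Lemma row_affine n (G : 'M[R]_(n, d)) M b k :
  row k (G *m M + const_mx 1 *m b) = affine_map M b (row k G).
Proof.
rewrite linearD /= row_mul /affine_map; congr (_ + _).
by apply/rowP => j; rewrite !mxE big_ord1 mxE mul1r.
Qed.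

Lemma rows_affine n (G : 'M[R]_(n, d)) M b :
  rows (G *m M + const_mx 1 *m b) = affine_map M b @` rows G.
Proof.
apply/seteqP; split=> [_ [k _ <-]|_ [_ [k _ <-] <-]].
  by exists (row k G); [exists k|rewrite row_affine].
by exists k => //; rewrite row_affine.
Qed.

Lemma hull_affine n (G : 'M[R]_(n, d)) M b :
  hull (G *m M + const_mx 1 *m b) = affine_map M b @` hull G.
Proof. by rewrite -!convex_hull_rows rows_affine convex_hull_image. Qed.

Lemma irredundant_affine n (G : 'M[R]_(n, d)) M (b : 'rV[R]_d) : M \in unitmx ->
  irredundant G -> irredundant (G *m M + const_mx 1 *m b).
Proof.
move=> Mu irr k.
have -> : row' k (G *m M + const_mx 1 *m b) = row' k G *m M + const_mx 1 *m b.
  apply/row_matrixP => i; rewrite row_row' !row_affine row_row' //.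
rewrite hull_affine row_affine => -[x Gx /addIr xE]; apply: (irr k).
by rewrite -(mulmxK Mu (row k G)) -xE mulmxK.
Qed.

End Irredundant.

Section Primitive.
Context {R : realType} {d : nat}.
Implicit Types (P Q : set 'rV[R]_d) (M N : 'M[R]_d).

(* For the lattice polytopes [P] whose vertices affinely span the lattice. *)
Definition primitive P : Prop := forall N (c : 'rV[R]_d), N \in unitmx ->
  lattice_polytope (affine_map N c @` P) -> int_mx N /\ int_mx c.

(** [L] certifies that the rows of [C] generate the lattice. Vertices of a lattice polytope are
    lattice points, so [C *m N] is integral up to [c]; the zero row shows that [c] is integral, and
    [N] equals [L *m (C *m N)]. *)
Lemma primitive_hull n (C : 'M[R]_(n, d)) (L : 'M[R]_(d, n)) k0 : irredundant C ->
  int_mx L -> L *m C = 1%:M -> row k0 C = 0 -> primitive (hull C).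
Proof.
move=> irr Li LC C0 N c Nu [_ [S [_ Si SE]]].
have irr' := @irredundant_affine _ _ _ _ N c Nu irr.
rewrite -hull_affine in SE.
have Ci k : int_mx (row k C *m N + c).
  move=> i j; rewrite ord1; have := irredundant_sub irr' (esym SE) (ex_intro2 _ _ k I erefl) => /Si.
  by rewrite row_affine; apply.
have ci : int_mx c by have := Ci k0; rewrite C0 mul0mx add0r.
split=> //; have CNi : int_mx (C *m N).
  move=> i j; have := Ci i ord0 j; rewrite -row_mul !mxE => H.
  by rewrite -[X in X \is a _](addrK (c ord0 j)) rpredB.
by rewrite -[N]mul1mx -LC -mulmxA; exact: int_mxM.
Qed.

(* The Smith normal form of the matrix of vertex differences provides a basis [B] of the
   lattice they span; [P] is the image under [B] of a primitive polytope. *)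
Lemma exists_primitive P : lattice_polytope P ->
  exists P0 M b, [/\ lattice_polytope P0, primitive P0, M \in unitmx,
    int_mx M /\ int_mx b & P = affine_map M b @` P0].
Proof.
move=> LP; have [n0 [G0 [s0 [G0i PE bs0]]]] := lattice_polytope_hull LP.
have [n [G [irr GG0 rG]]] := exists_irredundant G0.
have Gi : int_mx G.
  move=> i j; have [k _ kE] := rG _ (ex_intro2 _ _ i I erefl).
  by have := congr1 (fun u : 'rV_d => u ord0 j) kE; rewrite !mxE => <-.
have PG : P = hull G by rewrite PE GG0.
have [s bs] : exists s : {ffun 'I_(1 + d) -> 'I_n}, is_basis (homog G) s.
  by apply: full_dim_basis; rewrite -PG; case: LP.
pose k0 := s ord0; pose v := row k0 G; pose D := G - const_mx 1 *m v.
have vi : int_mx v by move=> i j; rewrite mxE.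
have Di : int_mx D by apply: int_mxB => //; apply: int_mxM => //; exact/int_mx_const/rpred1.
(* The columns of [D] are independent because [G] contains a nondegenerate simplex; this excludes
   zero elementary divisors in [dn]. *)
have Dinj (w : 'cV[R]_d) : D *m w = 0 -> w = 0.
  move=> Dw; have : homog G *m col_mx (- (v *m w)) w = 0.
    rewrite mul_row_col mulmxN mulmxA -mulNmx -mulmxDl addrC.
    by rewrite -/D.
  move=> /(congr1 (rowsub s)); rewrite -mul_rowsub_mx => H.
  have : col_mx (- (v *m w)) w = 0.
    by rewrite -[LHS](mulKmx bs) H; apply/matrixP => i j;
      rewrite [RHS]mxE mxE big1// => k _; rewrite [X in _ * X]mxE mxE mulr0.
  by move=> /(congr1 dsubmx); rewrite col_mxKd linear0.
have [Dz DE] := int_mx_eq_map Di.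
have [Lz Lu [Rz Ru [ds _ DzE]]] := int_Smith_normal_form Dz.
set Dl := (X in _ = Lz *m X *m Rz) in DzE.
have intr_unitmx m (A : 'M[int]_m) : A \in unitmx -> (map_mx intr A : 'M[R]_m) \in unitmx.
  by rewrite !unitmxE det_map_mx; exact: rmorph_unit.
have Rru := intr_unitmx _ _ Ru.
pose Rr : 'M[R]_d := map_mx intr Rz; pose Lr : 'M[R]_n := map_mx intr Lz.
have dn (j : 'I_d) : (j < n)%N /\ ds`_j != 0.
  have : exists i, Dl i j != 0.
    apply/existsP; apply: contraT; rewrite negb_exists => /forallP z.
    have : invmx Rr *m delta_mx j ord0 = 0 :> 'cV[R]_d.
      apply: Dinj; rewrite DE DzE !map_mxM -/Rr -(mulmxA _ Rr) mulKVmx// -mulmxA.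
      rewrite -[map_mx _ Dl *m _]colE (_ : col j _ = 0) ?mulmx0//.
      by apply/colP => i; rewrite !mxE; have /negPn/eqP := z i; rewrite mxE => ->.
    move=> /(congr1 (mulmx Rr)); rewrite mulKVmx// mulmx0.
    by move=> /(congr1 (fun u : 'cV_d => u j ord0)) /eqP; rewrite !mxE !eqxx oner_eq0.
  move=> [i]; rewrite mxE; have [ij|_] := eqVneq (i : nat) j; last by rewrite mulr0n eqxx.
  by rewrite mulr1n ij => nz; split=> //; rewrite -ij; exact: ltn_ord.
have le_dn : (d <= n)%N.
  by rewrite leqNgt; apply/negP => nd; have [] := dn (Ordinal nd); rewrite ltnn.
(* The rectangular diagonal of the Smith form splits as [pid *m dg]. The divisors go into [B], and
   what remains, [C], has the integral left inverse [K]. *)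
pose pid : 'M[R]_(n, d) := pid_mx d.
pose dg : 'M[R]_d := diag_mx (\row_j (ds`_j)%:~R).
pose B := dg *m Rr.
have dgu : dg \in unitmx.
  rewrite unitmxE det_diag unitfE; apply/prodf_neq0 => j _; rewrite mxE intr_eq0.
  by case: (dn j).
have Bu : B \in unitmx by rewrite unitmx_mul dgu.
pose C := Lr *m pid.
have DCB : D = C *m B.
  rewrite DE DzE !map_mxM -/Lr -/Rr /C /B !mulmxA; congr (_ *m _).
  rewrite -mulmxA; congr (_ *m _); apply/matrixP => i j.
  rewrite mul_mx_diag !mxE; case: (dn j) => jn _.
  case: (eqVneq (i : nat) j) => [->|_]; last by rewrite /= mulr0n mul0r.
  by rewrite ltn_ord /= mulr1n mul1r.
pose K := pid^T *m invmx Lr.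
have Lru : Lr \in unitmx by exact: intr_unitmx.
have iLr : invmx Lr = map_mx intr (invmx Lz).
  by rewrite -[RHS](mulKmx Lru) -map_mxM mulmxV// map_mx1 mulmx1.
have KC : K *m C = 1%:M.
  rewrite /K /C mulmxA -[pid^T *m _ *m _]mulmxA mulVmx// mulmx1 /pid tr_pid_mx.
  by rewrite mul_pid_mx minnn (minn_idPr le_dn) pid_mx_1.
have pidi : int_mx pid by move=> i j; rewrite mxE rpred_nat.
have Ki : int_mx K.
  apply: int_mxM; first by move=> i j; rewrite mxE.
  by rewrite iLr; exact: int_mx_map.
have GE : G = C *m B + const_mx 1 *m v by rewrite -DCB subrK.
have irrC : irredundant C.
  have -> : C = G *m invmx B + const_mx 1 *m (- (v *m invmx B)).
    by rewrite {1}GE mulmxDl mulmxK// mulmxN mulmxA addrK.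
  by apply: irredundant_affine => //; rewrite unitmx_inv.
have C0 : row k0 C = 0.
  apply: (can_inj (mulmxK Bu)); rewrite mul0mx -row_mul -DCB.
  by rewrite /D linearB /= row_mul row_const const_mx11 mul1mx subrr.
have Ci : int_mx C by apply: int_mxM => //; exact: int_mx_map.
exists (hull C), B, v; split.
- split.
    rewrite -(@affine_map_inv _ _ B v (hull C) P) //; last by rewrite PG GE hull_affine.
    by apply: full_dim_image; [rewrite unitmx_inv|case: LP].
  exists (rows C); split; first exact: finite_set_rows.
    by move=> _ [k _ <-] j; rewrite mxE.
  by rewrite convex_hull_rows.
- exact: primitive_hull irrC Ki KC C0.
- exact: Bu.
- split=> //; apply: int_mxM; last exact: int_mx_map.
  by move=> i j; rewrite !mxE rpredMn// intr_int.
- by rewrite PG GE hull_affine.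
Qed.

End Primitive.

(** * Counting by codes; minimal volumes and representatives *)

Section CardinalBounds.
Context {X : choiceType}.
Implicit Types (F : set X) (T : finType).

(** An element may have several codes, as they record choices such as that of an affine map; what
    matters is that distinct elements share none. *)
Lemma card_le_finType T F (rel : X -> T -> Prop) (x0 : X) :
  (forall x, F x -> exists t, rel x t) ->
  (forall x y t, F x -> F y -> rel x t -> rel y t -> x = y) ->
  finite_set F /\ (#|` fset_set F| <= #|T|)%N.
Proof.
move=> ex uniq_rel.
pose g t := xget x0 [set x | F x /\ rel x t].
have gE x t : F x -> rel x t -> g t = x.
  move=> Fx xt; have [Fg gt] := xgetPex x0 (ex_intro (fun y => F y /\ rel y t) x (conj Fx xt)).
  exact: (uniq_rel _ _ t).
have Fg x : F x -> exists t, g t = x by move=> Fx; have [t xt] := ex x Fx; exists t; exact: gE.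
have fF : finite_set F.
  apply: (@sub_finite_set _ _ (g @` setT)); last by apply: finite_image; exact: finite_finset.
  by move=> x /Fg[t <-]; exists t.
split=> //; rewrite -(size_codom g); apply: uniq_leq_size; first exact: fset_uniq.
by move=> x; rewrite in_fset_set// inE => /Fg[t <-]; exact: codom_f.
Qed.

Lemma finite_enumeration F : finite_set F ->
  exists e : 'I_#|` fset_set F| -> X, injective e /\
    (forall x, F x <-> exists i, e i = x).
Proof.
move=> fF; exists (fun i => tnth (in_tuple (enum_fset (fset_set F))) i); split.
  by apply/tuple_uniqP; rewrite fset_uniq.
move=> x; split=> [Fx|[i <-]].
  have : x \in fset_set F by rewrite in_fset_set// inE.
  by move=> /(tnthP (in_tuple (enum_fset (fset_set F))))[i ->]; exists i.
have : tnth (in_tuple (enum_fset (fset_set F))) i \in fset_set F by exact: mem_tnth.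
by rewrite in_fset_set// inE.
Qed.

End CardinalBounds.

Section MinimalVolume.
Context {R : realType} {d : nat}.
Implicit Types (P Q : set 'rV[R]_d) (v : \bar R).

Lemma normalized_volE P (V : nat) :
  normalized_vol P = V%:R%:E <-> vol P = (V%:R / d`!%:R)%:E.
Proof.
have d0 : (d`!%:R : R) != 0 by rewrite pnatr_eq0 -lt0n fact_gt0.
rewrite /normalized_vol; split=> [H|->]; last by rewrite -EFinM mulrC divfK.
have : ((d`!%:R^-1)%:E * ((d`!%:R)%:E * vol P) = (d`!%:R^-1)%:E * (V%:R)%:E)%E by rewrite H.
by rewrite muleA -!EFinM mulVf// mul1e mulrC.
Qed.

Lemma Vmin_unique P v v' : has_Vmin P v -> has_Vmin P v' -> v = v'.
Proof.
move=> [[Q PQ <-] m] [[Q' PQ' <-] m'].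
by apply/eqP; rewrite eq_le m// m'.
Qed.

Lemma Vmin_equivalent P Q v : affinely_equivalent P Q -> has_Vmin P v -> has_Vmin Q v.
Proof.
move=> PQ [[S [LS PS] vS] m]; split.
  exists S => //; split=> //.
  exact: affinely_equivalent_trans (affinely_equivalent_sym PQ) PS.
by move=> T [LT QT]; apply: m; split=> //; exact: affinely_equivalent_trans PQ QT.
Qed.

Lemma unit_norm_det (N : 'M[R]_d) : N \in unitmx -> int_mx N -> 1 <= `|\det N|.
Proof.
by move=> Nu Ni; rewrite norm_intr_ge1 ?det_int// -unitfE -unitmxE.
Qed.

Lemma primitive_Vmin P : lattice_polytope P -> primitive P -> has_Vmin P (vol P).
Proof.
move=> LP pP; split; first by exists P => //; split=> //; exact: affinely_equivalent_refl.
move=> Q [LQ [N [c [Nu NPQ]]]]; have [Ni _] : int_mx N /\ int_mx c by apply: pP => //; rewrite NPQ.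
rewrite -NPQ vol_lattice_image//.
have [k _ ->] := lattice_polytope_vol LP.
rewrite -EFinM lee_fin ler_peMl ?divr_ge0//; exact: unit_norm_det.
Qed.

(** [Q] is the image of a primitive polytope of its class under an integral map; minimality forces
    determinant of absolute value 1, and primitivity passes through such a map. *)
Lemma Vmin_primitive Q : lattice_polytope Q -> has_Vmin Q (vol Q) -> primitive Q.
Proof.
move=> LQ [_ mQ]; have [P0 [M [b [LP0 pP0 Mu [Mi bi] QE]]]] := exists_primitive LQ.
have [k k0 vE] := lattice_polytope_vol LP0.
have M1 : `|\det M| = 1.
  apply/eqP; rewrite eq_le unit_norm_det// andbT.
  have : (vol Q <= vol P0)%E.
    apply: mQ; split=> //; apply: affinely_equivalent_sym; by exists M, b.
  rewrite QE vol_lattice_image// vE -EFinM lee_fin ger_pMl// divr_gt0 ?ltr0n//.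
  exact: fact_gt0.
have [_ iM] := unimodular_inv Mi M1.
move=> N c Nu; rewrite QE affine_map_comp => LN.
have MNu : M *m N \in unitmx by rewrite unitmx_mul Mu.
have [MNi bc] := pP0 _ _ MNu LN.
have Ni : int_mx N by rewrite -[N](mulKmx Mu); exact: int_mxM.
split=> //; rewrite -[c](addKr (b *m N)) addrC.
by apply: int_mxB => //; exact: int_mxM.
Qed.

(* Dilating one coordinate by [i] multiplies the volume by [i]. *)
Lemma lattice_polytope_stretch P (i j : nat) : (0 < d)%N -> (0 < i)%N -> lattice_polytope P ->
  vol P = (j%:R / d`!%:R)%:E ->
  exists Q, [/\ lattice_polytope Q, affinely_equivalent P Q & vol Q = ((i * j)%:R / d`!%:R)%:E].
Proof.
move=> d0 i0 LP vP; pose D : 'M[R]_d := diag_mx (\row_k (if k == 0%N :> nat then i%:R else 1)).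
have detD : \det D = i%:R.
  rewrite det_diag (bigD1 (Ordinal d0))//= mxE eqxx big1 ?mulr1// => k k0.
  by rewrite mxE; case: eqP => // e; case/eqP: k0; exact/val_inj.
have Du : D \in unitmx by rewrite unitmxE detD unitfE pnatr_eq0 -lt0n.
have Di : int_mx D.
  by move=> a b; rewrite !mxE rpredMn//; case: ifP => _; rewrite ?rpred_nat ?rpred1.
exists (affine_map D 0 @` P); split.
- by apply: lattice_polytope_image => //; exact/int_mx_const/rpred0.
- by exists D, 0.
- by rewrite vol_lattice_image// vP detD -EFinM normr_nat natrM mulrA.
Qed.

End MinimalVolume.

Section Representatives.
Context {R : realType} {d : nat}.
Variables (A K : nat -> set (set 'rV[R]_d)).
Hypothesis d_gt0 : (0 < d)%N.
Hypothesis A_repr : forall V : nat, (0 < V)%N -> affine_representatives V (A V).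
Hypothesis K_repr : forall V : nat, (0 < V)%N -> unimodular_representatives V (K V).

Lemma A_spec V Q : (0 < V)%N -> A V Q ->
  [/\ lattice_polytope Q, vol Q = (V%:R / d`!%:R)%:E, has_Vmin Q (V%:R / d`!%:R)%:E & primitive Q].
Proof.
move=> V0 AQ; have [[AC _] Avol] := A_repr V0.
have [LQ mQ] := AC _ AQ; split=> //; first exact: Avol.
by apply: Vmin_primitive => //; rewrite Avol.
Qed.

Lemma A_unique V Q Q' : (0 < V)%N -> A V Q -> A V Q' -> affinely_equivalent Q Q' -> Q = Q'.
Proof.
move=> V0 AQ AQ' QQ'; have [[AC Au] _] := A_repr V0.
have [S [_ uS]] := Au Q (AC _ AQ).
by rewrite -(uS Q) ?(uS Q')//; split=> //; exact: affinely_equivalent_refl.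
Qed.

Lemma A_index V V' Q Q' : (0 < V)%N -> (0 < V')%N -> A V Q -> A V' Q' ->
  affinely_equivalent Q Q' -> V = V'.
Proof.
move=> V0 V0' AQ AQ' QQ'; have [_ _ mQ _] := A_spec V0 AQ; have [_ _ mQ' _] := A_spec V0' AQ'.
have := Vmin_unique (Vmin_equivalent QQ' mQ) mQ' => -[].
move=> /(mulIf (invr_neq0 _)) => H; apply/eqP; rewrite -(eqr_nat R); apply/eqP/H.
by rewrite pnatr_eq0 -lt0n fact_gt0.
Qed.

Lemma K_spec V P : (0 < V)%N -> K V P ->
  lattice_polytope P /\ vol P = (V%:R / d`!%:R)%:E.
Proof.
by move=> V0 KP; have [KC _] := K_repr V0; have [LP /normalized_volE] := KC _ KP.
Qed.

Lemma K_unique V P P' : (0 < V)%N -> K V P -> K V P' -> unimodularly_equivalent P P' -> P = P'.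
Proof.
move=> V0 KP KP' PP'; have [KC Ku] := K_repr V0.
have [S [_ uS]] := Ku P (KC _ KP).
rewrite -(uS P) ?(uS P')//; split=> //.
apply/unimodularly_equivalentP; exists 1%:M, 0; split.
- exact/int_mx_scalar/rpred1.
- exact/int_mx_const/rpred0.
- by rewrite det1 normr1.
- exact: affine_map_id.
Qed.

Lemma K_exists V P : (0 < V)%N -> lattice_polytope P -> vol P = (V%:R / d`!%:R)%:E ->
  exists2 Q, K V Q & unimodularly_equivalent P Q.
Proof.
move=> V0 LP vP; have [_ Ku] := K_repr V0.
have [Q [[KQ PQ] _]] := Ku P (conj LP (proj2 (normalized_volE P V) vP)).
by exists Q.
Qed.

Lemma A_exists V P : (0 < V)%N -> lattice_polytope P -> vol P = (V%:R / d`!%:R)%:E ->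
  exists j Q (N : 'M[R]_d) c, [/\ (0 < j)%N, (j %| V)%N, A j Q &
    [/\ int_mx N, int_mx c, `|\det N| = (V %/ j)%:R & affine_map N c @` Q = P]].
Proof.
move=> V0 LP vP.
have [P0 [M [b [LP0 pP0 Mu [Mi bi] PE]]]] := exists_primitive LP.
have [j j0 vE] := lattice_polytope_vol LP0.
have [[_ Au] _] := A_repr j0.
have mP0 := primitive_Vmin LP0 pP0; rewrite vE in mP0.
have [Q [[AQ P0Q] _]] := Au P0 (conj LP0 mP0).
have [LQ vQ mQ pQ] := A_spec j0 AQ.
have [N [c [Nu NE]]] : affinely_equivalent Q P.
  apply: (affinely_equivalent_trans (affinely_equivalent_sym P0Q)).
  by exists M, b; rewrite Mu PE.
have [Ni ci] : int_mx N /\ int_mx c by apply: pQ => //; rewrite NE.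
have [k kE] : exists k : nat, `|\det N| = k%:R by apply/natrP/natr_norm_int/det_int.
have VE : V = (k * j)%N.
  move: vP; rewrite -NE vol_lattice_image// vQ kE -EFinM mulrA -natrM => -[].
  move=> /(mulIf (invr_neq0 _)) => H; apply/eqP; rewrite -(eqr_nat R) eq_sym; apply/eqP/H.
  by rewrite pnatr_eq0 -lt0n fact_gt0.
exists j, Q, N, c; split=> //; first by rewrite VE dvdn_mull.
by split=> //; rewrite VE mulnK.
Qed.

Lemma congruent_equivalent (Q : set 'rV[R]_d) (N N' : 'M[R]_d) c c' (r : 'M[R]_d) E E' (m : nat) :
  (0 < m)%N -> int_mx N -> int_mx c -> int_mx c' -> int_mx E -> int_mx E' ->
  `|\det N| = m%:R -> `|\det N'| = m%:R ->
  N = r + m%:R *: E -> N' = r + m%:R *: E' ->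
  unimodularly_equivalent (affine_map N c @` Q) (affine_map N' c' @` Q).
Proof.
move=> m0 Ni ci ci' Ei Ei' dN dN' NE NE'.
have m0' : (0 : R) < m%:R by rewrite ltr0n.
have EE : N' = N + m%:R *: (E' - E).
  by rewrite NE NE'; apply/matrixP => a b; rewrite !mxE; ring.
have [Nu Ui dU] := congruent_unimodular m0' Ni (int_mxB Ei' Ei) dN dN' EE.
apply/unimodularly_equivalentP; exists (invmx N *m N'), (c' - c *m (invmx N *m N')).
split=> //; first by apply: int_mxB => //; exact: int_mxM.
by rewrite affine_map_comp mulKVmx// addrC subrK.
Qed.

End Representatives.

Section MaximalSimplex.
Context {R : realFieldType} {n m : nat} (H : 'M[R]_(n, m)).

(** Cramer's rule: the exchange alters only row [j], so the cofactors along it are unchanged. *)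
Lemma det_exchange (s : {ffun 'I_m -> 'I_n}) j k : is_basis H s ->
  \det (rowsub (exchange s j k) H) = coords H s (row k H) ord0 j * \det (rowsub s H).
Proof.
move=> bs; rewrite (expand_det_row _ j).
have cof i : cofactor (rowsub (exchange s j k) H) j i = cofactor (rowsub s H) j i.
  rewrite /cofactor; congr (_ * \det _); apply/matrixP => a b.
  by rewrite !mxE ffunE eq_sym (negPf (neq_lift _ _)).
rewrite /coords /invmx -/(is_basis H s) bs -scalemxAr mxE mulrC mulrA mulfV ?mul1r; last first.
  by rewrite -unitfE -unitmxE.
by rewrite mxE; apply: eq_bigr => i _; rewrite cof !mxE ffunE eqxx.
Qed.

Lemma exists_max_basis s0 : is_basis H s0 -> exists2 s, is_basis H s &
  forall k j, `|coords H s (row k H) ord0 j| <= 1.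
Proof.
move=> bs0; pose s := [arg max_(s > s0 | is_basis H s) `|\det (rowsub s H)|]%O.
have [bs smax] : is_basis H s /\ forall t, is_basis H t -> `|\det (rowsub t H)| <= `|\det (rowsub s H)|.
  by rewrite /s; case: arg_maxP.
exists s => // k j; have [->|c0] := eqVneq (coords H s (row k H) ord0 j) 0.
  by rewrite normr0.
have ds : 0 < `|\det (rowsub s H)| by rewrite normr_gt0 -unitfE -unitmxE.
have := smax _ (is_basis_exchange bs c0).
by rewrite det_exchange// normrM ger_pMl.
Qed.

End MaximalSimplex.

(** * Finiteness and comparison of the two counts *)

Section Counting.
Context {R : realType} {d : nat}.
Variables (A K : nat -> set (set 'rV[R]_d)).
Hypothesis d_gt0 : (0 < d)%N.
Hypothesis A_repr : forall V : nat, (0 < V)%N -> affine_representatives V (A V).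
Hypothesis K_repr : forall V : nat, (0 < V)%N -> unimodular_representatives V (K V).

Definition nat_mx (V : nat) (r : 'M['I_V.+1]_d) : 'M[R]_d :=
  map_mx (fun k : 'I_V.+1 => (k : nat)%:R) r.

(** Multiplied by [m], the relevant coordinates are integers in [[-m, m]], hence in [[-V, V]]; the
    shift by [V] makes them indices of a type independent of [m]. *)
Definition grid_hull (V m : nat) (L : {set {ffun 'I_d -> 'I_(V + V).+1}}) : set 'rV[R]_d :=
  convex_hull [set x | exists2 f, f \in L &
    x = \row_i (((f i : nat)%:R - V%:R) / m%:R)].

(* Relative to a lattice simplex of maximal volume, all lattice points of the polytope have
   coordinates in [-1, 1] with denominator dividing the volume of the simplex. *)
Lemma polytope_grid_hull V P : (0 < V)%N -> lattice_polytope P ->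
  vol P = (V%:R / d`!%:R)%:E ->
  exists (m : 'I_V.+1) (L : {set {ffun 'I_d -> 'I_(V + V).+1}}) (N : 'M[R]_d) (v : 'rV[R]_d),
    [/\ (0 < m)%N, int_mx N, int_mx v, `|\det N| = m%:R &
        P = affine_map N v @` grid_hull m L].
Proof.
move=> V0 LP vP; have [n [G [s0 [Gi PG bs0]]]] := lattice_polytope_hull LP.
have [s bs smax] := exists_max_basis bs0.
pose W := rowsub s G; pose N := edges W; pose v := usubmx W.
have Wu : homog W \in unitmx by rewrite -is_basisE.
have Nu : N \in unitmx by move: Wu; rewrite !unitmxE det_homog.
have Wi : int_mx W by move=> i j; rewrite mxE.
have vi : int_mx v by move=> i j; rewrite mxE.
have Ni : int_mx N.
  apply: int_mxB; first by move=> i j; rewrite mxE.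
  by apply: int_mxM => //; exact/int_mx_const/rpred1.
have [m mE] : exists m : nat, `|\det N| = m%:R by apply/natrP/natr_norm_int/det_int.
have m0 : (0 < m)%N.
  by rewrite lt0n; apply: contraTneq Nu => m0; rewrite unitmxE unitfE -normr_eq0 mE m0 eqxx.
have mR : (0 : R) < m%:R by rewrite ltr0n.
have mV : (m <= V)%N.
  have := simplex_vol_le bs; rewrite -PG vP det_homog -/W -/N mE lee_fin ler_pM2r.
    by rewrite ler_nat.
  by rewrite invr_gt0 ltr0n fact_gt0.
pose Y : 'M[R]_(n, d) := (G - const_mx 1 *m v) *m invmx N.
have GE : G = Y *m N + const_mx 1 *m v by rewrite mulmxKV// subrK.
have Yle k i : `|Y k i| <= 1.
  have := smax k (rshift 1 i); rewrite row_homog coords_bary.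
  have -> : row k G = affine_map N v (row k Y) by rewrite {1}GE row_affine.
  by rewrite bary_affine_map// row_mxEr mxE.
have mYi k i : m%:R * Y k i \is a Num.int.
  have : int_mx ((G - const_mx 1 *m v) *m (`|\det N| *: invmx N)).
    apply: int_mxM; last exact: int_mx_scaled_inv.
    by apply: int_mxB => //; apply: int_mxM => //; exact/int_mx_const/rpred1.
  by move=> /(_ k i); rewrite -scalemxAr -/Y mE mxE.
have /fin_all_exists[c cE] : forall ki : 'I_n * 'I_d, exists c : 'I_(V + V).+1,
    (c : nat)%:R = m%:R * Y ki.1 ki.2 + V%:R.
  move=> [k i] /=; have mVR : (m%:R : R) <= V%:R by rewrite ler_nat.
  have := Yle k i; rewrite ler_norml => /andP[Y1 Y2].
  have z0 : 0 <= m%:R * Y k i + V%:R by nra.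
  have z1 : m%:R * Y k i + V%:R <= (V + V)%:R by rewrite natrD; nra.
  have : m%:R * Y k i + V%:R \is a Num.nat.
    by rewrite natrEint z0 andbT rpredD// rpred_nat.
  move=> /natrP[c cE]; have cV : (c < (V + V).+1)%N by rewrite ltnS -(ler_nat R) -cE.
  by exists (Ordinal cV).
pose L := [set [ffun i => c (k, i)] | k : 'I_n]%SET.
exists (Ordinal (mV : (m < V.+1)%N)), L, N, v; split=> //=.
rewrite PG GE hull_affine; congr image; rewrite -convex_hull_rows; congr convex_hull.
have rowE k : row k Y = \row_i ((([ffun i => c (k, i)] i : nat)%:R - V%:R) / m%:R).
  by apply/rowP => i; rewrite mxE [RHS]mxE ffunE cE addrK [RHS]mulrAC mulfV ?mul1r// gt_eqF.
apply/seteqP; split=> [_ [k _ <-]|_ [f /imsetP[k _ ->] ->]].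
  by exists [ffun i => c (k, i)]; [exact: imset_f|exact: rowE].
by exists k => //; exact: rowE.
Qed.

(** The code consists of the normalized volume [m] of a maximal simplex, the residues modulo [m] of
    its edge matrix, and the grid positions of the points; [congruent_equivalent] shows that it
    determines the unimodular class. *)
Lemma finite_K V : (0 < V)%N -> finite_set (K V).
Proof.
move=> V0.
pose T := ('I_V.+1 * ('M['I_V.+1]_d * {set {ffun 'I_d -> 'I_(V + V).+1}}))%type.
pose rel P (t : T) := exists (N E : 'M[R]_d) (v : 'rV[R]_d),
  [/\ (0 < t.1)%N, int_mx N, int_mx E, int_mx v &
   [/\ `|\det N| = (t.1 : nat)%:R, N = nat_mx t.2.1 + (t.1 : nat)%:R *: E &
    P = affine_map N v @` grid_hull t.1 t.2.2]].
apply: (proj1 (@card_le_finType _ T (K V) rel set0 _ _)) => [P KP|P P' t KP KP'].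
  have [LP vP] := K_spec K_repr V0 KP.
  have [m [L [N [v [m0 Ni vi dN PE]]]]] := polytope_grid_hull V0 LP vP.
  have mV : (0 < m <= V)%N by rewrite m0 -ltnS ltn_ord.
  have [r [E [Ei NE]]] := residue_mx Ni mV.
  by exists (m, (r, L)), N, E, v.
move=> [N [E [v [m0 Ni Ei vi [dN NE PE]]]]] [N' [E' [v' [_ Ni' Ei' vi' [dN' NE' PE']]]]].
apply: (K_unique K_repr V0 KP KP'); rewrite PE PE'.
exact: (congruent_equivalent _ m0 Ni vi vi' Ei Ei' dN dN' NE NE').
Qed.

Lemma dilateE i (Q : set 'rV[R]_d) : dilate i Q = affine_map (i%:R%:M) 0 @` Q.
Proof. by apply: eq_imagel => x _; rewrite /affine_map mul_mx_scalar addr0. Qed.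

Lemma dilate_equivalent i (Q : set 'rV[R]_d) : (0 < i)%N -> affinely_equivalent Q (dilate i Q).
Proof.
move=> i0; exists i%:R%:M, 0; rewrite dilateE; split=> //.
by rewrite unitmxE det_scalar unitrX// unitfE pnatr_eq0 -lt0n.
Qed.

(** The union runs over the dilation factor; here the index is the minimal normalized volume [j]
    instead. *)
Lemma L_ofP V X : (0 < V)%N -> L_of A V X <->
  exists j Q, [/\ (0 < j)%N, (j %| V)%N, A j Q & X = dilate (V %/ j) Q].
Proof.
move=> V0; split=> [[i /= /andP[i0 iV] [Q]]|[j [Q [j0 jV AQ ->]]]].
  case: ifPn => // iV' AQ <-; exists (V %/ i)%N, Q; split=> //.
  - by rewrite divn_gt0.
  - exact: dvdn_div.
  - by rewrite divnA// mulKn.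
exists (V %/ j)%N; first by rewrite /= divn_gt0// dvdn_leq// leq_div.
by exists Q => //; rewrite dvdn_div// divnA// mulKn.
Qed.

Lemma dilate_A_unique V j j' Q Q' X : (0 < V)%N -> (0 < j)%N -> (j %| V)%N ->
  (0 < j')%N -> (j' %| V)%N -> A j Q -> A j' Q' ->
  affinely_equivalent Q X -> affinely_equivalent Q' X -> j = j' /\ Q = Q'.
Proof.
move=> V0 j0 jV j0' jV' AQ AQ' QX QX'.
have QQ' := affinely_equivalent_trans QX (affinely_equivalent_sym QX').
have e := A_index A_repr j0 j0' AQ AQ' QQ'; split=> //.
by move: AQ'; rewrite -e => AQ'; exact: (A_unique A_repr j0).
Qed.

(** A dilation by [i] multiplies volumes by [i^d], so the elements of [L_of A V] do not in general
    have normalized volume [V]; [lattice_polytope_stretch] supplies one that does in the same affine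
    class, and distinct elements lie in distinct classes. *)
Lemma card_L_le_K V : (0 < V)%N ->
  finite_set (L_of A V) /\ (cardinal (L_of A V) <= cardinal (K V))%N.
Proof.
move=> V0; have [e [_ eK]] := finite_enumeration (finite_K V0).
have fdiv j : (0 < j)%N -> (j %| V)%N -> (0 < V %/ j)%N.
  by move=> j0 jV; rewrite divn_gt0// dvdn_leq.
pose rel X (k : 'I_#|` fset_set (K V)|) := exists j Q,
  [/\ (0 < j)%N, (j %| V)%N, A j Q, X = dilate (V %/ j) Q & affinely_equivalent Q (e k)].
have := @card_le_finType _ _ (L_of A V) rel set0; rewrite card_ord; apply.
  move=> X /(L_ofP _ V0)[j [Q [j0 jV AQ ->]]].
  have [LQ vQ _ _] := A_spec A_repr j0 AQ.
  have [S [LS QS vS]] := lattice_polytope_stretch d_gt0 (fdiv j j0 jV) LQ vQ.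
  rewrite divnK// in vS.
  have [P KP SP] := K_exists K_repr V0 LS vS.
  have /eK[k kE] := KP; exists k, j, Q; split=> //; rewrite kE.
  exact: affinely_equivalent_trans QS (unimodularly_affinely SP).
move=> X Y k _ _ [j [Q [j0 jV AQ -> Qk]]] [j' [Q' [j0' jV' AQ' -> Qk']]].
by have [-> ->] := dilate_A_unique V0 j0 jV j0' jV' AQ AQ' Qk Qk'.
Qed.

(** The exponent counts the entries of a residue matrix; integral translations are absorbed by
    unimodular equivalence and need no code. *)
Lemma card_K_le_L V : (0 < V)%N ->
  (cardinal (K V) <= cardinal (L_of A V) * V.+1 ^ (d * d))%N.
Proof.
move=> V0; have [fL _] := card_L_le_K V0; have [e [_ eL]] := finite_enumeration fL.
pose T := ('I_#|` fset_set (L_of A V)| * 'M['I_V.+1]_d)%type.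
pose rel P (t : T) := exists j Q (N E : 'M[R]_d) (c : 'rV[R]_d),
  [/\ (0 < j)%N, (j %| V)%N, A j Q, e t.1 = dilate (V %/ j) Q &
   [/\ int_mx N, int_mx E, int_mx c, `|\det N| = (V %/ j)%:R &
    N = nat_mx t.2 + (V %/ j)%:R *: E /\ P = affine_map N c @` Q]].
have := @card_le_finType _ T (K V) rel set0.
rewrite card_prod card_ord card_mx card_ord => H; apply: (proj2 (H _ _)) => {H} [P KP|P P' t KP KP'].
  have [LP vP] := K_spec K_repr V0 KP.
  have [j [Q [N [c [j0 jV AQ [Ni ci dN PE]]]]]] := A_exists A_repr V0 LP vP.
  have /eL[i iE] : L_of A V (dilate (V %/ j) Q) by apply/(L_ofP _ V0); exists j, Q.
  have Vj : (0 < V %/ j <= V)%N by rewrite divn_gt0// dvdn_leq// leq_div.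
  have [r [E [Ei NE]]] := residue_mx Ni Vj.
  by exists (i, r), j, Q, N, E, c.
move=> [j [Q [N [E [c [j0 jV AQ eQ [Ni Ei ci dN [NE PE]]]]]]]].
move=> [j' [Q' [N' [E' [c' [j0' jV' AQ' eQ' [Ni' Ei' ci' dN' [NE' PE']]]]]]]].
have Vj : (0 < V %/ j)%N by rewrite divn_gt0// dvdn_leq.
have Vj' : (0 < V %/ j')%N by rewrite divn_gt0// dvdn_leq.
have QX := dilate_equivalent Q Vj; have QX' := dilate_equivalent Q' Vj'.
rewrite -eQ in QX; rewrite -eQ' in QX'.
have [jj QQ] := dilate_A_unique V0 j0 jV j0' jV' AQ AQ' QX QX'.
apply: (K_unique K_repr V0 KP KP'); rewrite PE PE' -QQ; rewrite -jj in dN' NE'.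
exact: (congruent_equivalent _ Vj Ni ci ci' Ei Ei' dN dN' NE NE').
Qed.

End Counting.

(** * Superpolynomially many classes *)

Section Pyramid.
Context {R : realType} {k : nat}.
Local Notation d := (2 + k)%N.
Implicit Types (Z : set 'rV[R]_2) (z w : 'rV[R]_2).

Definition pt (x y : R) : 'rV[R]_2 := \row_i (if i == ord0 then x else y).

Definition embed z : 'rV[R]_d := row_mx z 0.

(* Convex hulls of [pyramid Z] are iterated pyramids of height one over the polygon spanned
   by [Z]; they have the same normalized volume as the polygon. *)
Definition pyramid Z : set 'rV[R]_d :=
  embed @` Z `|` range (fun j : 'I_k => row_mx 0 (delta_mx ord0 j)).

(** The signed normalized area of the triangle with vertices 0, [z], [w]. *)
Definition planar_det z w : R := z ord0 ord0 * w ord0 ord_max - z ord0 ord_max * w ord0 ord0.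

Lemma ptE x y : (pt x y ord0 ord0 = x) * (pt x y ord0 ord_max = y).
Proof. by rewrite !mxE. Qed.

Lemma ord2P (i : 'I_2) : i = ord0 \/ i = ord_max.
Proof.
by case: i => -[|[|//]] i; [left|right]; exact/val_inj.
Qed.

Lemma rV2P z w : z ord0 ord0 = w ord0 ord0 -> z ord0 ord_max = w ord0 ord_max -> z = w.
Proof. by move=> e0 e1; apply/rowP => i; case: (ord2P i) => ->. Qed.

Lemma det_mx22 (M : 'M[R]_2) :
  \det M = M ord0 ord0 * M ord_max ord_max - M ord0 ord_max * M ord_max ord0.
Proof.
have l0 : lift ord0 ord0 = ord_max :> 'I_2 by exact/val_inj.
have l1 : lift ord_max ord0 = ord0 :> 'I_2 by exact/val_inj.
rewrite (expand_det_row _ ord0) big_ord_recl big_ord1 /cofactor !det_mx11 !mxE.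
rewrite l0 l1 /= addn0 expr0 mul1r addn1 expr1 mulN1r mulrN.
by [].
Qed.

Lemma pyramid_setU1 w Z : pyramid (w |` Z) = embed w |` pyramid Z.
Proof. by rewrite /pyramid image_setU image_set1 setUA. Qed.

Lemma finite_pyramid Z : finite_set Z -> finite_set (pyramid Z).
Proof.
move=> fZ; rewrite /pyramid finite_setU; split; first exact: finite_image.
by apply: finite_image; exact: finite_finset.
Qed.

Lemma pyramid_sub Z Z' : Z `<=` Z' -> pyramid Z `<=` pyramid Z'.
Proof. by move=> ZZ; apply: setSU; exact: image_subset. Qed.

Lemma pyramid_int Z : (forall z, Z z -> int_mx z) -> pyramid Z `<=` int_lattice.
Proof.
move=> Zi x [[z Zz <-]|[j _ <-]] i; case: (split_ordP (i : 'I_d)) => a ->;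
  rewrite ?row_mxEl ?row_mxEr ?mxE ?rpred0 ?rpred_nat//.
exact: Zi.
Qed.

(** The rows are the embedded [z] and [w] and the [k] apexes; together with [embed v] they are the
    vertices of the iterated pyramid over a triangle. *)
Definition pyramid_mx z w : 'M[R]_d := block_mx (col_mx z w : 'M[R]_(1 + 1, 2)) 0 0 1%:M.

Lemma pyramid_mx_sub z w v : pyramid_mx z w - const_mx 1 *m embed v =
  block_mx (col_mx (z - v) (w - v) : 'M[R]_(1 + 1, 2)) 0 (- (const_mx 1 *m v)) 1%:M.
Proof.
rewrite /pyramid_mx /embed mul_mx_row mulmx0.
have -> : const_mx 1 *m v = col_mx (col_mx v v) (const_mx 1 *m v) :> 'M[R]_(2 + k, 2).
  apply/matrixP => i j; rewrite mxE big_ord1 mxE mul1r.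
  case: (split_ordP i) => a ->; last by rewrite col_mxEd mxE big_ord1 mxE mul1r.
  by rewrite col_mxEu; case: (split_ordP (a : 'I_(1 + 1))) => b ->;
    rewrite ?(@col_mxEu _ 1 1 2) ?(@col_mxEd _ 1 1 2) (ord1 b).
have -> : 0 = col_mx 0 0 :> 'M[R]_(2 + k, k) by rewrite col_mx0.
rewrite -block_mxEh opp_block_mx add_block_mx !oppr0 !addr0 sub0r.
by congr block_mx; rewrite [X in _ + X](@opp_col_mx _ 1 1 2) (@add_col_mx _ 1 1 2).
Qed.

Lemma det_pyramid_mx z w v :
  \det (pyramid_mx z w - const_mx 1 *m embed v) = planar_det (z - v) (w - v).
Proof.
rewrite pyramid_mx_sub det_lblock det1 mulr1 det_mx22 /planar_det.
have -> : (ord0 : 'I_2) = lshift 1 ord0 :> 'I_(1 + 1) by exact/val_inj.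
have -> : (ord_max : 'I_2) = rshift 1 ord0 :> 'I_(1 + 1) by exact/val_inj.
by rewrite !(@col_mxEu _ 1 1 2) !(@col_mxEd _ 1 1 2).
Qed.

Lemma mul_pyramid_mx (a b : R) z w v :
  embed (pt a b) *m (pyramid_mx z w - const_mx 1 *m embed v) = embed (a *: (z - v) + b *: (w - v)).
Proof.
rewrite pyramid_mx_sub /embed mul_row_block !mul0mx !mulmx0 !addr0; congr row_mx.
have -> : pt a b = row_mx a%:M b%:M :> 'M[R]_(1, 1 + 1).
  apply/rowP => i; rewrite mxE; case: (split_ordP (i : 'I_(1 + 1))) => j ->.
    rewrite (@row_mxEl _ _ 1 1) mxE (ord1 j) eqxx mulr1n.
    by case: eqP => // H; case: H; exact/val_inj.
  rewrite (@row_mxEr _ _ 1 1) mxE (ord1 j) eqxx mulr1n.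
  by case: eqP => // /(congr1 val).
by rewrite (@mul_row_col _ _ 1 1) !mul_scalar_mx.
Qed.

Lemma row_pyramid_mx (z w : 'rV[R]_2) Z i : Z z -> Z w -> pyramid Z (row i (pyramid_mx z w)).
Proof.
move=> Zz Zw; rewrite /pyramid_mx block_mxEv; case: (split_ordP i) => a ->.
  rewrite rowKu row_row_mx row0; left.
  case: (split_ordP (a : 'I_(1 + 1))) => b ->.
    by exists z => //; rewrite (@rowKu _ 1 1 2) /embed; congr row_mx;
      apply/rowP => j; rewrite mxE ord1.
  by exists w => //; rewrite (@rowKd _ 1 1 2) /embed; congr row_mx;
      apply/rowP => j; rewrite mxE ord1.
by right; exists a => //; rewrite rowKd row_row_mx row0 row1.
Qed.

(** The last hypothesis says that [w] sees [Z] through the segment from [z0] to [z1] only. The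
    apexes of the pyramid have coordinate sum 1 and so lie on the facet along which
    [stack_decomposition] glues. *)
Lemma vol_pyramid_stack Z z0 z1 w : finite_set Z -> full_dimensional (convex_hull (pyramid Z)) ->
  Z z0 -> Z z1 -> planar_det (z0 - w) (z1 - w) != 0 ->
  (forall z, Z z -> exists a b, [/\ 0 <= a, 0 <= b, 1 <= a + b &
     z = a *: (z0 - w) + b *: (z1 - w) + w]) ->
  vol (convex_hull (pyramid (w |` Z))) =
  (vol (convex_hull (pyramid Z)) + (`|planar_det (z0 - w) (z1 - w)| / d`!%:R)%:E)%E.
Proof.
move=> fZ fd Zz0 Zz1 det0 cone; rewrite pyramid_setU1.
pose M := pyramid_mx z0 z1.
have Eu : M - const_mx 1 *m embed w \in unitmx by rewrite unitmxE det_pyramid_mx unitfE.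
have rowM i : pyramid Z (row i M) by exact: row_pyramid_mx.
have [] := @stack_decomposition R d (pyramid Z) (embed z0) (embed w) M _ Eu _ _.
- by left; exists z0.
- by move=> i; exact: sub_convex_hull.
- move=> x [[z Zz <-]|[j _ <-]].
    have [a [b [a0 b0 ab zE]]] := cone z Zz.
    exists (embed (pt a b)); split.
    + move=> i; case: (split_ordP i) => c ->; last by rewrite row_mxEr mxE.
      by rewrite row_mxEl; case: (ord2P c) => ->; rewrite ptE.
    + rewrite big_split_ord /= [X in _ + X]big1 ?addr0; last by move=> i _; rewrite row_mxEr mxE.
      rewrite big_ord_recl big_ord1 !row_mxEl ptE.
      by rewrite (_ : lift _ _ = ord_max) ?ptE//; exact/val_inj.
    + rewrite mul_pyramid_mx /embed add_row_mx addr0; congr row_mx.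
      exact: zE.
  exists (row_mx 0 (delta_mx ord0 j)); split.
  + by move=> i; case: (split_ordP i) => c ->; rewrite ?row_mxEl ?row_mxEr mxE ?ler0n.
  + rewrite big_split_ord /= [X in X + _]big1 ?add0r; last by move=> i _; rewrite row_mxEl mxE.
    rewrite (bigD1 j)//= row_mxEr mxE !eqxx lerDl sumr_ge0// => i _.
    by rewrite row_mxEr mxE ler0n.
  + rewrite pyramid_mx_sub mul_row_block !mul0mx !add0r mulmx1 mulmxN mulmxA.
    have -> : delta_mx ord0 j *m const_mx 1 = 1%:M :> 'M[R]_1.
      by rewrite -rowE row_const const_mx11.
    by rewrite mul1mx /embed add_row_mx addNr addr0.
have Vu : homog (col_mx (embed w) M : 'M[R]_(1 + d, d)) \in unitmx.
  by rewrite unitmxE det_homog /edges col_mxKd col_mxKu -unitmxE.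
have mH : rmeasurable (convex_hull (pyramid Z)).
  have [n [G SG]] := finite_rows (finite_pyramid fZ).
  rewrite SG convex_hull_rows in fd *.
  by have [s bs] := full_dim_basis fd; exact: rmeasurable_hull bs.
have mS := rmeasurable_simplex Vu.
move=> -> sub; rewrite vol_almost_disjointU//.
  by rewrite vol_simplex// det_homog /edges col_mxKd col_mxKu det_pyramid_mx.
apply/eqP; rewrite eq_le vol_ge0 andbT -(vol_facet ord0 Vu).
by apply: vol_le => //; [exact: rmeasurableI|exact: rmeasurable_facet].
Qed.

End Pyramid.

(** * The polygons over a parabola *)

Section Family.
Context {R : realType} {k : nat}.
Local Notation d := (2 + k)%N.
Variable n : nat.
Hypothesis n_gt0 : (0 < n)%N.

Let N : R := n%:R.
Let N_ge1 : 1 <= N. Proof. by rewrite ler1n. Qed.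

Definition par (i : nat) : 'rV[R]_2 := pt i%:R (i ^ 2)%:R.

(** The factor 10 is 8 + 2: for [X] and [i] in [[0, 2n]] the term [2 i X] of [tangent_height] is at
    most [8 n^2], and the remaining [2 n^2] dominates both 1 and [|X - i|]. *)
Definition height : nat := 10 * n ^ 2.

(** The vector from [top_left] to [top_right] is [(2n, 1)]; its entry 1 is what lets lattice
    triangles on this side have any positive integer as normalized area. *)
Definition top_left : 'rV[R]_2 := pt 0 height%:R.
Definition top_right : 'rV[R]_2 := pt n.*2%:R height.+1%:R.

Definition base : set 'rV[R]_2 :=
  top_left |` (top_right |` [set par a.*2 | a in [set a : nat | (a <= n)%N]]).

Definition apex (x h : nat) : 'rV[R]_2 := pt x%:R (height + h)%:R.

(* The points [par (2 a + 1)] may be added independently of each other, each increasing the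
   normalized volume by 2. *)
Definition arc_family (x h : nat) (s : {pred 'I_n}) : set 'rV[R]_2 :=
  [set par (a : 'I_n).*2.+1 | a in [set a | a \in s]] `|` (apex x h |` base).

Lemma heightE : height%:R = 10 * N ^+ 2 :> R.
Proof. by rewrite /height natrM natrX. Qed.

Lemma doubleR (i : nat) : i.*2%:R = 2 * i%:R :> R.
Proof. by rewrite -mul2n natrM. Qed.

Lemma finite_base : finite_set base.
Proof.
rewrite /base !finite_setU; split=> //; split=> //; apply: finite_image.
by apply: (sub_finite_set _ (finite_II n.+1)) => a.
Qed.

Lemma finite_family x h s : finite_set (arc_family x h s).
Proof.
rewrite /arc_family finite_setU; split; first by apply: finite_image; exact: finite_finset.
by rewrite finite_setU; split; [exact: finite_set1|exact: finite_base].
Qed.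

(** An affine frame made of points common to all members of the family; it gives full dimension and
    serves to code affine maps. *)
Definition frame : 'M[R]_(1 + d, d) := col_mx (embed (par 0)) (pyramid_mx top_left top_right).

Lemma par0 : par 0 = 0.
Proof. by apply: rV2P; rewrite ptE mxE. Qed.

Lemma edges_frame : edges frame = pyramid_mx top_left top_right - const_mx 1 *m embed (par 0).
Proof. by rewrite /edges col_mxKd col_mxKu. Qed.

Lemma frame_unit : homog frame \in unitmx.
Proof.
rewrite unitmxE det_homog edges_frame det_pyramid_mx unitfE par0 !subr0 /planar_det !ptE.
rewrite mul0r sub0r oppr_eq0 mulf_neq0// pnatr_eq0 -lt0n ?double_gt0//.
by rewrite muln_gt0 expn_gt0 n_gt0.
Qed.

Lemma base_par a : (a <= n)%N -> base (par a.*2).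
Proof. by move=> an; right; right; exists a. Qed.

Lemma base_top_left : base top_left. Proof. by left. Qed.
Lemma base_top_right : base top_right. Proof. by right; left. Qed.

Lemma frame_base i : pyramid base (row i frame).
Proof.
rewrite /frame; case: (split_ordP i) => a ->.
  rewrite rowKu; left; exists (par 0); first exact: (base_par (leq0n n)).
  by apply/rowP => j; rewrite [RHS]mxE (ord1 a).
by rewrite rowKd; apply: row_pyramid_mx; [exact: base_top_left|exact: base_top_right].
Qed.

Lemma full_dim_base : full_dimensional (convex_hull (@pyramid R k base)).
Proof.
apply: (@full_dim_simplex _ _ _ (embed (par 0)) (edges frame)).
- by have := frame_unit; rewrite !unitmxE det_homog.
- by apply: sub_convex_hull; left; exists (par 0) => //; exact: (base_par (leq0n n)).
- move=> i; rewrite edges_frame linearB /= row_mul row_const const_mx11 mul1mx addrC subrK.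
  apply: sub_convex_hull; apply: row_pyramid_mx; [exact: base_top_left|exact: base_top_right].
Qed.

Lemma full_dim_family x h s : full_dimensional (convex_hull (@pyramid R k (arc_family x h s))).
Proof.
apply: full_dim_sub full_dim_base; apply: convex_hull_mono => z Bz.
by apply: sub_convex_hull; apply: pyramid_sub Bz => y By; right; right.
Qed.

Lemma cone_coordinates (z z0 z1 w : 'rV[R]_2) a b :
  z ord0 ord0 - w ord0 ord0 =
    a * (z0 ord0 ord0 - w ord0 ord0) + b * (z1 ord0 ord0 - w ord0 ord0) ->
  z ord0 ord_max - w ord0 ord_max =
    a * (z0 ord0 ord_max - w ord0 ord_max) + b * (z1 ord0 ord_max - w ord0 ord_max) ->
  z = a *: (z0 - w) + b *: (z1 - w) + w.
Proof. by move=> e0 e1; apply: rV2P; rewrite !mxE -?e0 -?e1 subrK. Qed.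

Lemma planar_det_apex x h (D : R) : D = n.*2%:R * h%:R - x%:R ->
  planar_det (top_left - apex x h) (top_right - apex x h) = D.
Proof.
move=> ->; rewrite /planar_det /top_left /top_right /apex !mxE /= -!natr1 natrD doubleR.
ring.
Qed.

(* The choice of [x] and [h] realizes every positive integer [D], which is how the volume of
   the members of the family is adjusted to a prescribed value. *)
Lemma vol_apex x h (D : R) : (x <= n.*2)%N -> (0 < h)%N -> D = n.*2%:R * h%:R - x%:R -> 0 < D ->
  vol (convex_hull (@pyramid R k (apex x h |` base))) =
  (vol (convex_hull (@pyramid R k base)) + (D / d`!%:R)%:E)%E.
Proof.
move=> xn h0 DE D0.
rewrite (@vol_pyramid_stack _ _ _ top_left top_right) //.
- by rewrite (planar_det_apex DE) gtr0_norm.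
- exact: finite_base.
- exact: full_dim_base.
- exact: base_top_left.
- exact: base_top_right.
- by rewrite (planar_det_apex DE) gt_eqF.
have xR : (x%:R : R) <= 2 * N by rewrite -doubleR ler_nat.
have x0 : (0 : R) <= x%:R by [].
have h1 : (1 : R) <= h%:R by rewrite ler1n.
have Dn : D != 0 by rewrite gt_eqF.
rewrite doubleR -/N in DE.
move=> z Bz.
(* Cramer's rule, with [D] the determinant of the two edges at the apex. *)
exists (((z ord0 ord0 - x%:R) * (1 - h%:R) -
  (2 * N - x%:R) * (z ord0 ord_max - (height%:R + h%:R))) / D).
exists ((h%:R * (z ord0 ord0 - x%:R) - x%:R * (z ord0 ord_max - (height%:R + h%:R))) / D).
split.
- apply: divr_ge0; last exact: ltW.
  case: Bz => [->|[->|[a /= an <-]]]; rewrite ?ptE -?natr1 ?doubleR -?/N.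
  + nra.
  + nra.
  have aN : (a%:R : R) <= N by rewrite ler_nat.
  have a0 : (0 : R) <= a%:R by [].
  have ZH : 0 <= 10 * N ^+ 2 - (2 * a%:R) ^+ 2 by nra.
  have p1 := mulr_ge0 (_ : 0 <= 2 * N - x%:R) ZH.
  have p2 := @mulr_ge0 R (h%:R - 1) (2 * N - 2 * a%:R).
  rewrite natrX doubleR heightE; move: (p1 ltac:(lra)) (p2 ltac:(lra) ltac:(lra)); lra.
- apply: divr_ge0; last exact: ltW.
  case: Bz => [->|[->|[a /= an <-]]]; rewrite ?ptE -?natr1 ?doubleR -?/N.
  + nra.
  + nra.
  have aN : (a%:R : R) <= N by rewrite ler_nat.
  have a0 : (0 : R) <= a%:R by [].
  have ZH : 0 <= 10 * N ^+ 2 - (2 * a%:R) ^+ 2 by nra.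
  have p1 := mulr_ge0 x0 ZH.
  have p2 := @mulr_ge0 R h%:R (2 * a%:R).
  rewrite natrX doubleR heightE; move: p1 (p2 ltac:(lra) ltac:(lra)); lra.
- rewrite -mulrDl ler_pdivlMr// mul1r.
  case: Bz => [->|[->|[a /= an <-]]]; rewrite ?ptE -?natr1 ?doubleR -?/N.
  + rewrite DE; lra.
  + rewrite DE; lra.
  have aN : (a%:R : R) <= N by rewrite ler_nat.
  have a0 : (0 : R) <= a%:R by [].
  have ZH : 0 <= 10 * N ^+ 2 - (2 * a%:R) ^+ 2 by nra.
  have p1 := @mulr_ge0 R N _ _ ZH.
  rewrite natrX doubleR heightE; move: (p1 ltac:(lra)); rewrite DE; lra.
- by apply: cone_coordinates; rewrite /top_left /top_right /apex !ptE -?natr1 ?natrD ?doubleR -?/N;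
    move: Dn; rewrite DE => Dn; field.
Qed.

End Family.

Section FamilyVolume.
Context {R : realType} {k : nat}.
Local Notation d := (2 + k)%N.
Variable n : nat.
Hypothesis n_gt0 : (0 < n)%N.

Let N : R := n%:R.
Let N_ge1 : 1 <= N. Proof. by rewrite ler1n. Qed.

(* The height of a point over the tangent line at [(i, i^2)] of the parabola through the
   points [par j]. *)
Definition tangent_height (i : nat) (z : 'rV[R]_2) : R :=
  z ord0 ord_max + i%:R ^+ 2 - 2 * i%:R * z ord0 ord0.

Lemma tangent_height_par i j : tangent_height i (par j) = (j%:R - i%:R) ^+ 2.
Proof. by rewrite /tangent_height /par !ptE natrX; ring. Qed.

Lemma nat_dist_ge1 (i j : nat) : i != j -> 1 <= `|j%:R - i%:R : R|.
Proof.
by move=> ij; rewrite norm_intr_ge1// ?rpredB ?rpred_nat// subr_eq0 eqr_nat eq_sym.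
Qed.

(** The other parabola points have as height a nonzero square [(j - i)^2], and the top points are
    high enough by the choice of [height]. The second bound is the cone condition needed to stack
    [par a.*2.+1]. *)
Lemma tangent_height_family x h (s : {pred 'I_n}) (a : 'I_n) z : (x <= n.*2)%N -> a \notin s ->
  arc_family x h s z ->
  1 <= tangent_height a.*2.+1 z /\ `|z ord0 ord0 - a.*2.+1%:R| <= tangent_height a.*2.+1 z.
Proof.
move=> xn as_; set i := a.*2.+1.
have par_case j : i != j -> 1 <= tangent_height i (par j) /\
    `|par j ord0 ord0 - i%:R| <= tangent_height i (par j) :> R.
  move=> /nat_dist_ge1 ij; rewrite tangent_height_par ptE -[_ ^+ 2]real_normK ?num_real//.
  by set t := `|_ - _| in ij *; split; nra.
have top_case (X Z : R) : 0 <= X -> X <= 2 * N -> 10 * N ^+ 2 <= Z ->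
    1 <= tangent_height i (pt X Z) /\ `|pt X Z ord0 ord0 - i%:R| <= tangent_height i (pt X Z).
  move=> X0 XN ZH; rewrite /tangent_height !ptE ler_norml.
  have i0 : (0 : R) <= i%:R by [].
  have iN : i%:R <= 2 * N :> R.
    by rewrite -doubleR ler_nat /i ltn_double.
  move: (i%:R : R) i0 iN => r r0 rN.
  have N1 : 1 <= N by exact: N_ge1.
  have p1 : 0 <= r * (2 * N - X) by apply: mulr_ge0 => //; lra.
  have p2 : 0 <= N * (2 * N - r) by apply: mulr_ge0; lra.
  have p3 : 0 <= N * (N - 1) by apply: mulr_ge0; lra.
  have p4 := sqr_ge0 r.
  by split; [|apply/andP; split]; lra.
have nR : n.*2%:R = 2 * N :> R by rewrite doubleR.
move=> [[b /= bs <-]|[->|[->|[->|[b /= bn <-]]]]].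
- apply: par_case; apply: contra as_ => /eqP [] /double_inj e.
  by rewrite (_ : a = b)//; exact/val_inj.
- apply: top_case => //; first by rewrite -nR ler_nat.
  by rewrite natrD heightE -/N lerDl.
- apply: top_case => //; first by rewrite mulr_ge0.
  by rewrite heightE -/N.
- apply: top_case => //; first by rewrite nR.
  by rewrite -[(height n).+1%:R]natr1 heightE -/N lerDl.
- apply: par_case; apply/eqP => /(congr1 odd); by rewrite /i /= !odd_double.
Qed.

Lemma vol_family x h (s : seq 'I_n) : (x <= n.*2)%N -> uniq s ->
  vol (convex_hull (@pyramid R k (arc_family x h (mem s)))) =
  (vol (convex_hull (@pyramid R k (apex n x h |` base n))) + ((2 * size s)%:R / d`!%:R)%:E)%E.
Proof.
move=> xn; elim: s => [_|a s IH /= /andP[ans us]].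
  rewrite muln0 mul0r adde0; congr vol; congr convex_hull; congr pyramid.
  by apply/seteqP; split=> z; [move=> [[]//|]|right].
have -> : arc_family x h (mem (a :: s)) = par a.*2.+1 |` arc_family x h (mem s) :> set 'rV[R]_2.
  apply/seteqP; split=> z.
    move=> [[b /=]|]; last by right; right.
    rewrite inE => /orP[/eqP -> <-|bs <-]; first by left.
    by right; left; exists b.
  move=> [->|[[b /= bs <-]|Bz]]; last by right.
    by left; exists a => //=; rewrite inE eqxx.
  by left; exists b => //=; rewrite inE bs orbT.
have detE : planar_det (par a.*2 - par a.*2.+1) (par a.+1.*2 - par a.*2.+1) = - 2 :> R.
  rewrite /planar_det /par !mxE /= !natrX doubleS -!natr1; ring.
rewrite (@vol_pyramid_stack _ _ _ (par a.*2) (par a.+1.*2)).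
- rewrite IH// detE normrN ger0_norm// -addeA -EFinD; congr (_ + EFin _)%E.
  by rewrite mulnS natrD [RHS]mulrDl addrC.
- exact: finite_family.
- exact: full_dim_family.
- by right; right; apply: base_par; exact: ltnW.
- by right; right; apply: base_par.
- by rewrite detE oppr_eq0 pnatr_eq0.
move=> z Fz; have [W1 Wu] := tangent_height_family xn ans Fz.
set W := tangent_height _ z in W1 Wu.
pose u := z ord0 ord0 - a.*2.+1%:R.
move: Wu; rewrite -/u ler_norml => /andP[u1 u2].
(* In the coordinates [(u, W)] based at the new point, its two neighbours are [(-1, 1)] and
   [(1, 1)]. *)
exists ((W - u) / 2), ((W + u) / 2); split; [lra|lra|lra|].
by apply: cone_coordinates;
  rewrite /par !ptE ?natrX doubleS -?natr1 /u /W /tangent_height -?natr1; field.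
Qed.

Definition box (B : R) : set 'rV[R]_d := [set x | forall i, 0 <= x ord0 i <= B].

Lemma convex_box B x y (t : R) : 0 <= t -> t <= 1 -> box B x -> box B y ->
  box B (t *: x + (1 - t) *: y).
Proof.
move=> t0 t1 Bx By i; rewrite !mxE.
have /andP[x0 x1] := Bx i; have /andP[y0 y1] := By i.
apply/andP; split; nra.
Qed.

Lemma family_box x h (s : {pred 'I_n}) : (x <= n.*2)%N ->
  convex_hull (@pyramid R k (arc_family x h s)) `<=` box (height n + h).+1%:R.
Proof.
move=> xn; apply: convex_hull_min; first exact: convex_box.
have H1 : (1 <= (height n + h).+1)%N by [].
have Hn : (n.*2 <= (height n + h).+1)%N.
  by rewrite (@leq_trans (height n)) -?addnS ?leq_addr// /height; nia.
move=> x' [[z Fz <-]|[j _ <-]] i; case: (split_ordP i) => c ->;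
  rewrite ?row_mxEl ?row_mxEr ?mxE ?lexx ?ler0n//; last by rewrite andTb ler_nat; case: (_ && _).
have ptB (X Z : nat) : (X <= (height n + h).+1)%N -> (Z <= (height n + h).+1)%N ->
    0 <= (pt X%:R Z%:R : 'rV[R]_2) ord0 c <= (height n + h).+1%:R.
  by move=> XB ZB; case: (ord2P c) => ->; rewrite ptE ler0n ler_nat.
case: Fz => [[b /= bs <-]|[->|[->|[->|[b /= bn <-]]]]].
- have := ltn_ord b; move=> bn; apply: ptB; rewrite /height; nia.
- by apply: ptB => //; exact: leq_trans Hn.
- by apply: (ptB 0%N) => //; rewrite -addnS leq_addr.
- by apply: ptB => //; rewrite ltnS leq_addr.
- by apply: ptB; rewrite /height; nia.
Qed.

End FamilyVolume.

Section FamilyCount.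
Context {R : realType} {k : nat}.
Local Notation d := (2 + k)%N.
Variable n : nat.
Hypothesis n_gt0 : (0 < n)%N.

(** The polytope thus determines the chosen set. If [a] is not chosen, everything has tangent height
    at least 1, including the apexes, whose planar part 0 has height [i^2]; the optional point has
    height 0. *)
Lemma embed_par_mem x h (s : {pred 'I_n}) (a : 'I_n) : (x <= n.*2)%N ->
  convex_hull (@pyramid R k (arc_family x h s)) (embed (par a.*2.+1)) -> a \in s.
Proof.
move=> xn; apply: contraPT => as_; set i := a.*2.+1.
pose C := [set p : 'rV[R]_d | 1 <= tangent_height i (lsubmx p)].
have hull_C : convex_hull (pyramid (arc_family x h s)) `<=` C.
  apply: convex_hull_min => [p q t t0 t1|p].
    by rewrite /C /= /tangent_height !mxE; nra.
  move=> [[z Fz <-]|[j _ <-]]; rewrite /C /= row_mxKl.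
    by have [] := tangent_height_family n_gt0 xn as_ Fz.
  rewrite /tangent_height !mxE mulr0 subr0 add0r -natrX ler1n expn_gt0 //.
move=> /hull_C; rewrite /C /= row_mxKl tangent_height_par subrr expr0n /=.
by rewrite ler10.
Qed.

Lemma lattice_polytope_pyramid (Z : set 'rV[R]_2) : finite_set Z ->
  (forall z, Z z -> int_mx z) -> full_dimensional (convex_hull (@pyramid R k Z)) ->
  lattice_polytope (convex_hull (@pyramid R k Z)).
Proof.
move=> fZ Zi fd; split=> //; exists (pyramid Z); split=> //.
  exact: finite_pyramid.
exact: pyramid_int.
Qed.

Lemma int_pt (x y : nat) : int_mx (pt x%:R y%:R : 'rV[R]_2).
Proof. by move=> i j; rewrite mxE; case: ifP => _; rewrite rpred_nat. Qed.

Lemma int_base z : base n z -> int_mx (z : 'rV[R]_2).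
Proof.
by move=> [->|[->|[a _ <-]]]; [exact: (int_pt 0)|exact: int_pt|exact: int_pt].
Qed.

Lemma int_family x h s z : @arc_family R n x h s z -> int_mx z.
Proof. by move=> [[a _ <-]|[->|]]; [exact: int_pt|exact: int_pt|exact: int_base]. Qed.

Lemma lattice_polytope_base : lattice_polytope (convex_hull (@pyramid R k (base n))).
Proof.
apply: lattice_polytope_pyramid; [exact: finite_base|exact: int_base|exact: full_dim_base].
Qed.

Lemma lattice_polytope_family x h s :
  lattice_polytope (convex_hull (@pyramid R k (@arc_family R n x h s))).
Proof.
by apply: lattice_polytope_pyramid; [exact: finite_family|exact: int_family|exact: full_dim_family].
Qed.

(** The largest coordinate sum is [2n + 10 n^2 + 1 <= 13 n^2], at [top_right], so the base lies in
    the standard simplex dilated by [13 n^2]. *)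
Lemma vol_base_le :
  (vol (convex_hull (@pyramid R k (base n))) <= (((13 * n ^ 2) ^ d)%:R / d`!%:R)%:E)%E.
Proof.
set m := (13 * n ^ 2)%N; pose V : 'M[R]_(1 + d, d) := col_mx 0 (m%:R%:M).
have m0 : (0 : R) < m%:R by rewrite ltr0n muln_gt0 expn_gt0 n_gt0.
have VE : edges V = m%:R%:M by rewrite /edges col_mxKd col_mxKu mulmx0 subr0.
have Vu : homog V \in unitmx.
  by rewrite unitmxE det_homog VE det_scalar unitrX// unitfE gt_eqF.
have <- : vol (hull V) = ((m ^ d)%:R / d`!%:R)%:E.
  by rewrite vol_simplex// det_homog VE det_scalar ger0_norm ?natrX// exprn_ge0// ltW.
apply: vol_le; [|exact: rmeasurable_simplex|].
  by apply: rmeasurable_lattice_polytope; exact: lattice_polytope_base.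
have H : convex_hull (pyramid (base n)) `<=`
    [set x : 'rV[R]_d | (forall i, 0 <= x ord0 i) /\ \sum_i x ord0 i <= m%:R].
  apply: convex_hull_min => [x y t t0 t1 [x0 xm] [y0 ym]|].
    split=> [i|]; first by rewrite !mxE addr_ge0// mulr_ge0// subr_ge0.
    under eq_bigr do rewrite !mxE.
    by rewrite big_split /= -!mulr_sumr; nra.
  have ptH (X Z : nat) : (X + Z <= m)%N ->
     (forall i, 0 <= (embed (pt X%:R Z%:R) : 'rV[R]_d) ord0 i) /\
     \sum_i (embed (pt X%:R Z%:R) : 'rV[R]_d) ord0 i <= m%:R.
    move=> XZ; split.
      move=> i; case: (split_ordP i) => c ->; rewrite ?row_mxEl ?row_mxEr ?mxE//.
      by case: ifP.
    rewrite big_split_ord /= [X in _ + X]big1 ?addr0; last by move=> i _; rewrite row_mxEr mxE.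
    rewrite big_ord_recl big_ord1 !row_mxEl ptE.
    by rewrite (_ : lift _ _ = ord_max) ?ptE -?natrD ?ler_nat//; exact/val_inj.
  move=> p [[z Bz <-]|[j _ <-]] /=.
    case: Bz => [->|[->|[a /= an <-]]].
    - by apply: (ptH 0%N); rewrite /m /height; nia.
    - by apply: ptH; rewrite /m /height; nia.
    - by apply: ptH; rewrite /m; nia.
  split; first by move=> i; case: (split_ordP i) => c ->; rewrite ?row_mxEl ?row_mxEr mxE.
  rewrite big_split_ord /= [X in X + _]big1 ?add0r; last by move=> i _; rewrite row_mxEl mxE.
  rewrite (bigD1 j)//= row_mxEr mxE !eqxx big1 ?addr0; last first.
    by move=> i /negPf ij; rewrite row_mxEr mxE ij andbF.
  by rewrite ler1n -(ltr0n R).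
move=> x /H[x0 xm]; apply/hull_simplex => // j.
have -> : x = affine_map (edges V) (usubmx V) (m%:R^-1 *: x).
  by rewrite /affine_map VE col_mxKu addr0 mul_mx_scalar scalerA mulfV ?scale1r// gt_eqF.
rewrite bary_affine_map//; case: (split_ordP j) => i ->.
  rewrite row_mxEl mxE; under eq_bigr do rewrite mxE.
  by rewrite -mulr_sumr subr_ge0 mulrC ler_pdivrMr// mul1r.
by rewrite row_mxEr mxE mulr_ge0// invr_ge0 ltW.
Qed.

Variable K : nat -> set (set 'rV[R]_d).
Hypothesis K_repr : forall V : nat, (0 < V)%N -> unimodular_representatives V (K V).

(* Each unimodular class contains few members of the family: an affine map between two
   members is determined by the images of the rows of [frame], which are lattice points
   of a box. *)
Lemma card_K_ge V w : vol (convex_hull (@pyramid R k (base n))) = (w%:R / d`!%:R)%:E ->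
  (w + n.*2 < V)%N ->
  (2 ^ n <= cardinal (K V) * (height n + V).+2 ^ ((1 + d) * d))%N.
Proof.
move=> vw wV; have V0 : (0 < V)%N by exact: leq_ltn_trans wV.
set B := (height n + V).+1.
have [e [einj eK]] := finite_enumeration (finite_K K_repr V0).
pose r (I : {set 'I_n}) := size (enum I).
(* [D I] is the normalized volume left for the tuning triangle, positive by the hypothesis on [V];
   [h I] is [D I / 2n] rounded up, and [x I] is the excess of [2n * h I] over [D I]. *)
pose D I := (V - w - 2 * r I)%N.
pose h I := ((D I).-1 %/ n.*2).+1.
pose x I := (n.*2 * h I - D I)%N.
have cardI I : (r I <= n)%N by rewrite /r -cardE -[X in (_ <= X)%N](card_ord n) max_card.
have D0 I : (0 < D I)%N by have := cardI I; rewrite /D; lia.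
have n2 : (0 < n.*2)%N by rewrite double_gt0.
have Dh I : (D I <= n.*2 * h I)%N.
  by have := ltn_ceil (D I).-1 n2; have := D0 I; rewrite /h; lia.
have xn I : (x I <= n.*2)%N.
  by have := leq_trunc_div (D I).-1 n.*2; have := D0 I; rewrite /x /h mulnS mulnC; lia.
have hV I : (h I <= V)%N.
  have := leq_div (D I).-1 n.*2; have := D0 I; rewrite /h /D; lia.
pose P I := convex_hull (@pyramid R k (@arc_family R n (x I) (h I) (mem (enum I)))).
have LP I : lattice_polytope (P I) by exact: lattice_polytope_family.
have vP I : vol (P I) = (V%:R / d`!%:R)%:E.
  rewrite /P vol_family ?enum_uniq// (@vol_apex _ _ _ _ _ _ (D I)%:R)//.
  - rewrite vw -!EFinD -!mulrDl -!natrD -/(r I); congr (EFin (_%:R / _)).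
    by have := cardI I; rewrite /D; lia.
  - by rewrite -natrM /x -natrB ?subKn// leq_subr.
  - by rewrite ltr0n.
have /fin_all_exists[c cE] : forall I, exists i, unimodularly_equivalent (P I) (e i).
  move=> I; have [Q /eK[i <-] PQ] := K_exists K_repr V0 (LP I) (vP I).
  by exists i.
(* A reference member for each class that occurs; a member is coded by its class and an affine map
   onto it from the reference. *)
pose I0 (i : 'I_#|` fset_set (K V)|) := odflt finset.set0 [pick I | c I == i].
have cI0 I : c (I0 (c I)) = c I.
  by rewrite /I0; case: pickP => [J /eqP//|/(_ I)]; rewrite eqxx.
pose code (C : 'M['I_B.+1]_(1 + d, d)) : 'M[R]_(1 + d, d) :=
  map_mx (fun i : 'I_B.+1 => (i : nat)%:R) C.
have /fin_all_exists[f fE] : forall I, exists C, exists M b,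
    affine_map M b @` P (I0 (c I)) = P I /\ @frame R k n *m M + const_mx 1 *m b = code C.
  move=> I.
  have /unimodularly_equivalentP[M [b [Mi bi dM PE]]] : unimodularly_equivalent (P (I0 (c I))) (P I).
    apply: (unimodularly_equivalent_trans (cE _)).
    by rewrite cI0; exact: unimodularly_equivalent_sym.
  have /fin_all_exists[C CE] : forall ij : 'I_(1 + d) * 'I_d, exists m : 'I_B.+1,
      (@frame R k n *m M + const_mx 1 *m b) ij.1 ij.2 = (m : nat)%:R.
    move=> [i j] /=; set y := _ i j.
    have yE : y = affine_map M b (row i (@frame R k n)) ord0 j by rewrite -row_affine mxE.
    have Fi : pyramid (base n) (row i (@frame R k n)) by exact: frame_base.
    have yi : y \is a Num.int.
      rewrite yE; apply: (int_affine_map Mi bi); apply: (pyramid_int _ Fi).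
      exact: int_base.
    have Py : P I (affine_map M b (row i (@frame R k n))).
      rewrite -PE; exists (row i (@frame R k n)) => //; apply: sub_convex_hull.
      by apply: pyramid_sub Fi => z Bz; right; right.
    have /andP[y0 yB] := family_box n_gt0 (xn I) Py j.
    have : y \is a Num.nat by rewrite natrEint yi yE.
    move=> /natrP[m mE]; rewrite -yE mE ler_nat in yB.
    have mB : (m < B.+1)%N by rewrite ltnS (leq_trans yB)// /B ltnS leq_add2l.
    by exists (Ordinal mB).
  exists (\matrix_(i, j) C (i, j)), M, b; split=> //.
  by apply/matrixP => i j; rewrite (CE (i, j)) !mxE.
(* Equal codes give equal maps, the homogenized frame being invertible, hence equal polytopes, from
   which [embed_par_mem] recovers the sets. *)
have finj : injective (fun I => (c I, f I)).
  move=> I J [cIJ fIJ].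
  have [M [b [PI CI]]] := fE I; have [M' [b' [PJ CJ]]] := fE J.
  have : homog (@frame R k n) *m block_mx 1%:M b 0 M = homog (@frame R k n) *m block_mx 1%:M b' 0 M'.
    by rewrite -!homog_affine CI CJ fIJ.
  move=> /(can_inj (mulKmx (frame_unit n_gt0))) /eq_block_mx[_ bb _ MM].
  have PIJ : P I = P J by rewrite -PI -PJ cIJ bb MM.
  have sub (I' J' : {set 'I_n}) : P I' = P J' -> I' \subset J'.
    move=> PE; apply/fintype.subsetP => a aI; rewrite -mem_enum.
    apply: (@embed_par_mem (x J') (h J') (mem (enum J')) a (xn J')).
    rewrite -/(P J') -PE; apply: sub_convex_hull; left; exists (par a.*2.+1) => //.
    by left; exists a => //=; rewrite mem_enum.
  by apply/eqP; rewrite finset.eqEsubset !sub.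
have := leq_card _ finj.
rewrite -[X in (X <= _)%N]cardsT -powersetT card_powerset cardsT.
by rewrite !card_prod !card_ord card_mx card_ord.
Qed.

End FamilyCount.

(** * Growth estimates and the limit *)

Section Growth.

(** With [q] the integral part of [L / c], one has [L + 1 <= c (q + 1) <= 2^q] once [q >= 4c]; then
    take [c]-th powers. *)
Lemma poly_le_exp (c : nat) : exists L0, forall L, (L0 <= L)%N -> (L.+1 ^ c <= 2 ^ L)%N.
Proof.
have linear_le (p q : nat) : (0 < p)%N -> (4 * p <= q)%N -> (p * q.+1 <= 2 ^ q)%N.
  move=> p0 pq; have h1 : (q./2.+1 <= 2 ^ q./2)%N by rewrite ltn_expl.
  have h2 : (q./2.+1 ^ 2 <= 2 ^ q)%N.
    apply: leq_trans (_ : (2 ^ q./2) ^ 2 <= _)%N; first by rewrite leq_exp2r.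
    by rewrite -expnM leq_exp2l// muln2 -[X in (_ <= X)%N](odd_double_half q) leq_addl.
  apply: leq_trans h2; rewrite expnS expn1.
  have := odd_double_half q; nia.
case: (posnP c) => [->|c0].
  by exists 0%N => L _; rewrite expn0 expn_gt0.
exists (c * (4 * c))%N => L cL; pose q := (L %/ c)%N.
have q4 : (4 * c <= q)%N by rewrite /q leq_divRL// mulnC.
have LE : (L.+1 <= c * q.+1)%N by have := ltn_ceil L c0; rewrite /q; lia.
apply: leq_trans (_ : (2 ^ q) ^ c <= _)%N.
  by rewrite leq_exp2r// (leq_trans LE)// linear_le.
by rewrite -expnM leq_exp2l// /q leq_trunc_div.
Qed.

Lemma card_K_superpolynomial (R : realType) (k : nat) (K : nat -> set (set 'rV[R]_(2 + k))) :
  (forall V : nat, (0 < V)%N -> unimodular_representatives V (K V)) ->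
  forall a, exists V0, forall V, (V0 <= V)%N -> (V.+1 ^ a <= cardinal (K V))%N.
Proof.
move=> K_repr a; set d := (2 + k)%N in K K_repr *.
(* A frame image has [c] entries, each with at most [(V + 1)^2] values, so [2^n >= (V + 1)^b] leaves
   a factor [(V + 1)^a] for the classes. *)
pose c := ((1 + d) * d)%N; pose b := (a + 2 * c)%N.
have c0 : (0 < c)%N by [].
have b0 : (0 < b)%N by rewrite /b addn_gt0 orbC muln_gt0 c0.
have [L0 L0P] := poly_le_exp (3 * d).
(* For [n = b (L + 1)] this gives [26 n^2 <= (L + 1)^3]; the bound on the base, together with [2n],
   then stays below [(L + 1)^(3d) <= 2^L <= V]. *)
pose L1 := maxn L0 (26 * b ^ 2).
exists (2 ^ L1)%N => V VL; have V0 : (0 < V)%N by apply: leq_trans VL; rewrite expn_gt0.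
pose L := trunc_log 2 V.
have LL1 : (L1 <= L)%N by exact: trunc_log_max.
have LV : (2 ^ L <= V)%N by exact: trunc_logP.
have VL' : (V < 2 ^ L.+1)%N by exact: trunc_log_ltn.
pose n := (b * L.+1)%N.
have n0 : (0 < n)%N by rewrite muln_gt0 b0.
have bound : ((13 * n ^ 2) ^ d + n.*2 < V)%N.
  have m1 : (13 * n ^ 2 <= (13 * n ^ 2) ^ d)%N.
    by rewrite -{1}[X in (X <= _)%N]expn1 leq_pexp2l// muln_gt0 expn_gt0 n0.
  apply: (@leq_trans (2 * (13 * n ^ 2) ^ d)); first by move: m1; set X := (_ ^ d)%N; nia.
  apply: leq_trans LV; apply: leq_trans (L0P L _); last by rewrite (leq_trans _ LL1)// leq_maxl.
  apply: (@leq_trans ((26 * n ^ 2) ^ d)).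
    rewrite (_ : 26 * n ^ 2 = 2 * (13 * n ^ 2))%N; last by rewrite mulnA.
    by rewrite [X in (_ <= X)%N]expnMn leq_mul2r orbC -{1}[2%N]expn1 leq_pexp2l.
  rewrite [X in (_ <= X)%N]expnM leq_exp2r// /n expnMn mulnA.
  rewrite [X in (_ <= X)%N](expnS _ 2) leq_mul2r; apply/orP; right.
  by rewrite (leq_trans _ (leqnSn _))// (leq_trans _ LL1)// leq_maxr.
have [w _ vw] := lattice_polytope_vol (@lattice_polytope_base R k n n0).
have wle : (w <= (13 * n ^ 2) ^ d)%N.
  have := @vol_base_le R k n n0; rewrite vw lee_fin ler_pM2r; last by rewrite invr_gt0 ltr0n fact_gt0.
  by rewrite ler_nat.
have wV : (w + n.*2 < V)%N by apply: leq_ltn_trans bound; rewrite leq_add2r.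
have hV : ((height n + V).+2 <= V.+1 ^ 2)%N.
  have m1 : (13 * n ^ 2 <= (13 * n ^ 2) ^ d)%N.
    by rewrite -{1}[X in (X <= _)%N]expn1 leq_pexp2l// muln_gt0 expn_gt0 n0.
  have : (height n <= V)%N.
    by move: bound m1; rewrite /height; set X := (_ ^ d)%N; nia.
  nia.
have main : (2 ^ n <= cardinal (K V) * (V.+1 ^ 2) ^ c)%N.
  apply: leq_trans (card_K_ge n0 K_repr vw wV) _.
  by rewrite leq_mul2l leq_exp2r// hV orbT.
have : (V.+1 ^ b <= 2 ^ n)%N.
  by rewrite /n mulnC expnM leq_exp2r.
move=> /leq_trans /(_ main); rewrite /b expnD expnM leq_pmul2r//.
by rewrite !expn_gt0.
Qed.

End Growth.

Theorem theorem4p9 (R : realType) (d : nat) (d_ge2 : (2 <= d)%N)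
  (A K : nat -> set (set 'rV[R]_d))
  (A_repr : forall V : nat, (0 < V)%N -> affine_representatives V (A V))
  (K_repr : forall V : nat, (0 < V)%N -> unimodular_representatives V (K V)) :
  ((ln (cardinal (K V))%:R / ln (cardinal (L_of A V))%:R : R) @[V --> \oo] --> (1 : R)).
Proof.
case: d d_ge2 A K A_repr K_repr => [|[|k]]// _ A K A_repr K_repr.
pose d := (2 + k)%N; pose e := (2 * (d * d))%N.
apply/cvgrPdist_le => eps eps0.
(* From [(V + 1)^(e + m)] elements in [K V] follow [(V + 1)^m] in [L_of A V], so the quotient of
   logarithms exceeds 1 by at most [e / m], which this [m] keeps within [eps]. *)
pose m := (Num.trunc (e%:R / eps)).+1.
have me : e%:R / m%:R <= eps.
  rewrite ler_pdivrMr ?ltr0n// mulrC -ler_pdivrMr// /m ltW//.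
  by rewrite truncnS_gt.
have [V0 HV] := card_K_superpolynomial K_repr (e + m).
near=> V.
have V2 : (2 <= V)%N by near: V; exact: nbhs_infty_ge.
have VV0 : (V0 <= V)%N by near: V; exact: nbhs_infty_ge.
have Vgt0 : (0 < V)%N by exact: ltnW.
have := HV V VV0; have [_] := card_L_le_K (isT : (0 < d)%N) A_repr K_repr Vgt0.
have := card_K_le_L (isT : (0 < d)%N) A_repr K_repr Vgt0.
set x := cardinal (K V); set l := cardinal (L_of A V) => xl lx Vx.
have Vl : (V.+1 ^ m <= l)%N.
  have : (V.+1 ^ (e + m) <= l * V.+1 ^ e)%N.
    apply: (leq_trans Vx); apply: (leq_trans xl); rewrite leq_mul2l leq_pexp2l ?orbT//.
    by rewrite /e leq_pmull.
  by rewrite expnD mulnC leq_pmul2r// expn_gt0.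
have lnV : 0 < ln (V.+1%:R : R) by rewrite ln_gt0// ltr1n.
have l_gt0 : (0 < l)%N by apply: leq_trans Vl; rewrite expn_gt0.
have x_gt0 : (0 < x)%N by exact: leq_trans lx.
have lnl : m%:R * ln (V.+1%:R : R) <= ln l%:R.
  rewrite mulr_natl -lnXn ?ltr0n// -natrX ler_ln ?posrE ?ltr0n ?expn_gt0//.
  by rewrite ler_nat.
have ln_lx : ln l%:R <= ln (x%:R : R) by rewrite ler_ln ?posrE ?ltr0n// ler_nat.
have ln_xl : ln (x%:R : R) <= ln l%:R + e%:R * ln V.+1%:R.
  rewrite mulr_natl -lnXn ?ltr0n// -natrX -lnM ?posrE ?ltr0n ?expn_gt0//.
  have lV0 : (0 < l * V.+1 ^ e)%N by rewrite muln_gt0 l_gt0 expn_gt0.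
  rewrite -natrM ler_ln ?posrE ?ltr0n//.
  rewrite ler_nat.
  apply: (leq_trans xl); rewrite leq_mul2l leq_pexp2l ?orbT//.
  by rewrite /e leq_pmull.
have m0 : (0 : R) < m%:R by rewrite ltr0n.
have lnl0 : 0 < ln (l%:R : R) by apply: lt_le_trans lnl; rewrite mulr_gt0.
have -> : 1 - ln x%:R / ln (l%:R : R) = - ((ln x%:R - ln l%:R) / ln l%:R).
  by field; rewrite gt_eqF.
rewrite normrN ger0_norm; last by rewrite divr_ge0 ?subr_ge0// ltW.
apply: (le_trans _ me); rewrite ler_pdivrMr// mulrAC ler_pdivlMr//.
have : e%:R * (m%:R * ln (V.+1%:R : R)) <= e%:R * ln l%:R by rewrite ler_wpM2l.
have : (ln x%:R - ln l%:R) * m%:R <= e%:R * ln (V.+1%:R : R) * m%:R.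
  by rewrite ler_pM2r// lerBlDl.
lra.
Unshelve. all: by end_near.
Qed.
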